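(* Let $(u,\pi,v,\theta)$ be a smooth solution on $\mathbb{R}^3$ of the stationary tropical climate model. Suppose that one of the following decay conditions holds as $|x|\to+\infty$: (C1) $u(x)=o(|x|^{-2/3})$, $v(x)=O(|x|^{-2/3})$, $\theta(x)=o(|x|^{-4/3})$; (C2) $u(x)=o(|x|^{-2/3})$, $v(x)=o(|x|^{-2/3})$, $\theta(x)=O(|x|^{-4/3})$; (C3) $u(x)=o(|x|^{-2/3})$, $v(x)=O(|x|^{-4/3})$, $\theta(x)=o(|x|^{-2/3})$; (C4) $u(x)=o(|x|^{-2/3})$, $v(x)=o(|x|^{-4/3})$, $\theta(x)=O(|x|^{-2/3})$. Then $u=v=0$ and $\theta=0$.
   Context: A smooth solution of the stationary tropical climate model is a quadruple $(u,\pi,v,\theta)$ of $C^\infty$ functions on $\mathbb{R}^3$, with $u,v:\mathbb{R}^3\to\mathbb{R}^3$ and $\pi,\theta:\mathbb{R}^3\to\mathbb{R}$, satisfying on $\mathbb{R}^3$ $$-\Delta u+(u\cdot\nabla)u+\nabla\pi+\operatorname{div}(v\otimes v)=0,\quad -\Delta v+(u\cdot\nabla)v+\nabla\theta+(v\cdot\nabla)u=0,$$ $$-\Delta\theta+u\cdot\nabla\theta+\operatorname{div}v=0,\quad \operatorname{div}u=0.$$ *)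

(* Defs.v *)
From HB Require Import structures.
From mathcomp Require Import all_boot all_order all_algebra.
From mathcomp Require Import all_classical all_reals all_analysis.

Set Implicit Arguments.
Unset Strict Implicit.
Unset Printing Implicit Defensive.

Import Order.TTheory GRing.Theory Num.Theory.
Import numFieldNormedType.Exports.

Local Open Scope classical_set_scope.
Local Open Scope ring_scope.

Section EuclideanInfinity.
Context {R : realType} {n : nat}.

(* The library norm on ['rV[R]_n] is the max norm; this is the Euclidean one. *)
Definition enorm (x : 'rV[R]_n) : R := Num.sqrt (\sum_(i < n) x 0 i ^+ 2).

Definition einfty : set_system 'rV[R]_n :=
  filter_from [set: R] (fun M => [set x | M < enorm x]).

Global Instance einfty_filter : Filter einfty.
Proof.
apply: filter_from_filter; first by exists 0.
move=> M N _ _; exists (Num.max M N) => // x /=.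
by rewrite gt_max => /andP[].
Qed.

Canonical einfty_filter_on := FilterType einfty einfty_filter.

Definition epow (s : R) (x : 'rV[R]_n) : R := enorm x `^ s.

End EuclideanInfinity.

Section DifferentialOperators.
Context {R : realType} {n : nat}.

Definition partial (W : normedModType R) (i : 'I_n) (f : 'rV[R]_n -> W) :
  'rV[R]_n -> W := fun x => 'D_(delta_mx 0 i) f x.

Arguments partial {W} i f x.

(* Partial derivatives of every order exist and are continuous; the sequence [s]
   lists the directions of a mixed derivative. ['D_v f x] is a junk value where
   [f] is not derivable, hence the explicit [derivable] clause. *)
Definition smooth (W : normedModType R) (f : 'rV[R]_n -> W) : Prop :=
  forall s : seq 'I_n,
    continuous (foldr partial f s) /\
    forall (i : 'I_n) (x : 'rV[R]_n),
      derivable (foldr partial f s) x (delta_mx 0 i).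

Definition laplacian (W : normedModType R) (f : 'rV[R]_n -> W)
  (x : 'rV[R]_n) : W := \sum_(i < n) partial i (partial i f) x.

Definition grad (f : 'rV[R]_n -> R) (x : 'rV[R]_n) : 'rV[R]_n :=
  \row_i partial i f x.

Definition div (u : 'rV[R]_n -> 'rV[R]_n) (x : 'rV[R]_n) : R :=
  \sum_(i < n) partial i (fun y => u y 0 i) x.

(* [(u . grad) f], for scalar or vector-valued [f]. *)
Definition advect (W : normedModType R) (u : 'rV[R]_n -> 'rV[R]_n)
  (f : 'rV[R]_n -> W) (x : 'rV[R]_n) : W :=
  \sum_(j < n) u x 0 j *: partial j f x.

Definition tensor (u v : 'rV[R]_n -> 'rV[R]_n) (x : 'rV[R]_n) : 'M[R]_n :=
  \matrix_(i, j) (u x 0 i * v x 0 j).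

Definition div_mx (A : 'rV[R]_n -> 'M[R]_n) (x : 'rV[R]_n) : 'rV[R]_n :=
  \row_i \sum_(j < n) partial j (fun y => A y i j) x.

End DifferentialOperators.

Definition tropical_climate_smooth_solution (R : realType)
  (u : 'rV[R]_3 -> 'rV[R]_3) (p : 'rV[R]_3 -> R)
  (v : 'rV[R]_3 -> 'rV[R]_3) (theta : 'rV[R]_3 -> R) : Prop :=
  [/\ smooth u, smooth p, smooth v & smooth theta] /\
  forall x : 'rV[R]_3,
    [/\ - laplacian u x + advect u u x + grad p x + div_mx (tensor v v) x = 0,
        - laplacian v x + advect u v x + grad theta x + advect v u x = 0,
        - laplacian theta x + advect u theta x + div v x = 0
      & div u x = 0].

(* Main.v *)
Require Import Defs.
From HB Require Import structures.
From mathcomp Require Import all_boot all_order all_algebra.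
From mathcomp Require Import all_classical all_reals all_analysis.
From mathcomp Require Import ring lra zify.
Set Implicit Arguments.
Unset Strict Implicit.
Unset Printing Implicit Defensive.
Import Order.TTheory GRing.Theory Num.Theory.
Import numFieldNormedType.Exports.
Local Open Scope classical_set_scope.
Local Open Scope ring_scope.

(** Why the theorem holds.

    Test each equation with a cutoff of radius R times its own unknown. The
    coupling terms combine into fluxes, and the integral of the squared gradients
    of u, v and theta is bounded by integrals of derivatives of the cutoff
    against u |u|^2, u |v|^2, u theta^2, v (u.v), |u|^2, |v|^2, theta^2 and
    v theta, and by the integral of the cutoff times u.grad pi. On a volume R^3,
    cubic terms cost R^3 R^(-1) o(R^(-2)) = o(1) and quadratic ones, with the
    Laplacian of the cutoff, R^3 R^(-2) O(R^(-4/3)) = o(1). The flux of v theta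
    has one factor less, and is saved by v theta = o(|x|^(-2)): that is what the
    four decay conditions have in common, besides u = o(|x|^(-2/3)) and
    v, theta = O(|x|^(-2/3)).

    The pressure has no decay of its own. Let phi be the cutoff and let N solve
    N - R^2 Lap N = phi u. With A the curl of N, A_ij = R (d_i N_j - d_j N_i), and
    chi = 1 on the support of phi, the field w_i = R sum_j d_j (chi A_ij) is
    divergence-free, hence orthogonal to grad pi, and equal to phi u plus a
    remainder z whose scaled derivatives are bounded in L2 by u. So the pressure
    term is minus the pairing of grad pi with z, where the momentum equation
    replaces grad pi by Lap u - div F, F = u x u + v x v. The derivatives then
    fall on z, and the result is O(1/R) |u| (|u|/R + |F|) in L2 norms over the
    ball, with |u| = o(R^(5/6)) and |F| = O(R^(1/6)); it tends to 0 (pressure_formula,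
    pressure_bound, pressure_vanishing). One term of Lap z has too many derivatives of
    N; it is chi times a gradient, and u is divergence-free.

    So the squared gradients vanish (energy_identity, total_grad2_vanishing,
    vanishing_eq0), the unknowns are constant, and the decay makes them 0
    (gradient_free_eq0).

    Little analysis is needed for this. Smooth functions are treated as a ring
    with derivations. The integral over a large box is an ultralimit of Riemann
    sums on dyadic grids: it is linear and positive, and kills the derivatives of
    compactly supported functions, as the grids are invariant under dyadic
    shifts (Int_D). The equation for N is solved up to a small error in L2 by a
    finite Neumann series for the difference Laplacian, a combination of shifts
    with compact support that commutes with derivatives (resolvent). Radii are
    R = rho^3, and decay is measured in powers of (1 + |x|^2)^(-1/3), whose
    weighted volumes come from one integration by parts (weight_integral). *)

(** * The differential ring of smooth functions *)

Section SmoothFunctions.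
Context {R : realType} {n : nat}.
Local Notation V := 'rV[R]_n.
Local Notation e_ i := (delta_mx 0 i : V).
Local Notation pd := (@partial R n R).
Implicit Types (f g : V -> R) (i j : 'I_n) (x : V).

(** An inductive form of smoothness: unlike the one by lists of directions, it
    passes to products and compositions by induction on the order. *)
Fixpoint Ck (k : nat) f : Prop :=
  match k with
  | 0 => continuous f
  | k'.+1 => continuous f /\
      forall i, (forall x, derivable f x (e_ i)) /\ Ck k' (pd i f)
  end.

Lemma foldr_partial_rcons (W : normedModType R) (f : V -> W) (s : seq 'I_n) i :
  foldr (@partial R n W) f (rcons s i) = foldr (@partial R n W) (@partial R n W i f) s.
Proof. by rewrite -cats1 foldr_cat. Qed.

Lemma smooth_partial (W : normedModType R) (f : V -> W) i :
  smooth f -> smooth (@partial R n W i f).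
Proof. by move=> sf s; rewrite -foldr_partial_rcons; apply: sf. Qed.

Lemma smoothP f : smooth f <-> forall k, Ck k f.
Proof.
split=> [sf k|].
  elim: k f sf => [|k IH] f sf; first by case: (sf [::]).
  split; first by case: (sf [::]).
  by move=> i; split; [case: (sf [::])|apply/IH/smooth_partial].
move=> + s; elim/last_ind: s f => [|s i IH] f sf.
  by split=> [|i]; [exact: (sf 0)|case: (sf 1) => _ /(_ i)[]].
rewrite foldr_partial_rcons; apply: IH => k.
by case: (sf k.+1) => _ /(_ i)[].
Qed.

Lemma Ck_cont k f : Ck k f -> continuous f.
Proof. by case: k => [|k] // []. Qed.

Lemma CkW k f : Ck k.+1 f -> Ck k f.
Proof.
elim: k f => [|k IH] f; first by case.
by case=> cf df; split=> // i; case: (df i) => d1 d2; split => //; apply: IH.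
Qed.

Lemma partial_cst c i : pd i (cst c : V -> R) = cst 0.
Proof. by apply/funext => x; exact: derive_cst. Qed.

Lemma Ck_cst k c : Ck k (cst c).
Proof.
elim: k c => [|k IH] c; first exact: cst_continuous.
split; first exact: cst_continuous.
by move=> i; split=> [x|]; [exact: derivable_cst|rewrite partial_cst].
Qed.

Lemma partialD f g i : (forall x, derivable f x (e_ i)) ->
  (forall x, derivable g x (e_ i)) ->
  pd i (f + g) = pd i f + pd i g.
Proof. by move=> df dg; apply/funext => x; exact: deriveD. Qed.

Lemma partialM f g i : (forall x, derivable f x (e_ i)) ->
  (forall x, derivable g x (e_ i)) ->
  pd i (f * g) = f * pd i g + g * pd i f.
Proof. by move=> df dg; apply/funext => x; exact: deriveM. Qed.

Lemma CkD k f g : Ck k f -> Ck k g -> Ck k (f + g).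
Proof.
elim: k f g => [|k IH] f g; first by move=> cf cg x; apply: continuousD; [exact: cf|exact: cg].
move=> [cf df] [cg dg]; split; first by move=> x; apply: continuousD; [exact: cf|exact: cg].
move=> i; case: (df i) => df1 df2; case: (dg i) => dg1 dg2; split.
  by move=> x; apply: derivableD.
by rewrite partialD //; apply: IH.
Qed.

Lemma CkM k f g : Ck k f -> Ck k g -> Ck k (f * g).
Proof.
elim: k f g => [|k IH] f g; first by move=> cf cg x; apply: continuousM; [exact: cf|exact: cg].
move=> Ff Fg; have [cf df] := Ff; have [cg dg] := Fg.
split; first by move=> x; apply: continuousM; [exact: cf|exact: cg].
move=> i; case: (df i) => df1 df2; case: (dg i) => dg1 dg2; split.
  by move=> x; apply: derivableM.
by rewrite partialM //; apply: CkD; apply: IH => //; apply: CkW.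
Qed.

(** Smooth functions form a ring with derivations. Support conditions become
    equations such as (chi - 1) * phi = 0, and integrands are compared by ring
    identities. *)
Record smfun := SmFun { smval :> V -> R; smvalP : `[< smooth smval >] }.

HB.instance Definition _ := [isSub for smval].
HB.instance Definition _ := [Choice of smfun by <:].

Lemma smfun_smooth (f : smfun) : smooth f.
Proof. by case: f => f /= /asboolP. Qed.

Fact smfun_subring_closed : subring_closed (fun f : V -> R => `[< smooth f >]).
Proof.
split.
- by apply/asboolP/smoothP => k; exact: (Ck_cst k 1).
- move=> f g /asboolP/smoothP sf /asboolP/smoothP sg; apply/asboolP/smoothP => k.
  apply: CkD => //; have -> : - g = cst (-1) * g.
    by apply/funext => x; rewrite /GRing.mul /GRing.opp/= mulN1r.
  by apply: CkM => //; exact: Ck_cst.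
- move=> f g /asboolP/smoothP sf /asboolP/smoothP sg; apply/asboolP/smoothP => k.
  exact: CkM.
Qed.

HB.instance Definition _ := GRing.SubChoice_isSubComPzRing.Build _ _ smfun
  smfun_subring_closed.

Fact smfun_1_neq0 : 1%R != 0 :> smfun.
Proof.
apply/eqP => /(congr1 (fun f : smfun => f 0)).
by rewrite /= /GRing.one/= /cst/=; apply/eqP/oner_neq0.
Qed.
HB.instance Definition _ := GRing.PzSemiRing_isNonZero.Build smfun smfun_1_neq0.

Lemma smext (f g : smfun) : (forall x, f x = g x) -> f = g.
Proof. by move=> h; apply: val_inj; apply/funext. Qed.

Lemma smD (f g : smfun) x : (f + g) x = f x + g x. Proof. by []. Qed.
Lemma smM (f g : smfun) x : (f * g) x = f x * g x. Proof. by []. Qed.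
Lemma smN (f : smfun) x : (- f) x = - f x. Proof. by []. Qed.
Lemma sm0 x : (0 : smfun) x = 0. Proof. by []. Qed.
Lemma sm1 x : (1 : smfun) x = 1. Proof. by []. Qed.
Lemma smX (f : smfun) k x : (f ^+ k) x = f x ^+ k.
Proof. by elim: k => [|k IH] //; rewrite !exprS smM IH. Qed.
Lemma smMn (f : smfun) k x : (f *+ k) x = f x *+ k.
Proof. by elim: k => [|k IH] //; rewrite !mulrS smD IH. Qed.
Lemma sm_sum (I : Type) (r : seq I) (P : pred I) (F : I -> smfun) x :
  (\sum_(i <- r | P i) F i) x = \sum_(i <- r | P i) F i x.
Proof. by elim/big_rec2: _ => // i y z _ <-; rewrite smD. Qed.

Definition smE := (smD, smM, smN, sm0, sm1, smX, smMn, sm_sum).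

Definition smcst (c : R) : smfun :=
  SmFun (asboolT ((smoothP _).2 (fun k => Ck_cst k c))).

Lemma smcstE c x : smcst c x = c. Proof. by []. Qed.

Fact smcst_additive : zmod_morphism smcst.
Proof. by move=> a b; apply: smext. Qed.
HB.instance Definition _ := GRing.isZmodMorphism.Build R smfun smcst smcst_additive.
Fact smcst_monoid : monoid_morphism smcst.
Proof. by split=> [|a b]; apply: smext. Qed.
HB.instance Definition _ := GRing.isMonoidMorphism.Build R smfun smcst smcst_monoid.

End SmoothFunctions.
Arguments smfun R n : clear implicits.

HB.lock Definition D (R : realType) (n : nat) (i : 'I_n) (f : smfun R n) : smfun R n :=
  SmFun (asboolT (smooth_partial i (smfun_smooth f))).

Section Derivations.
Context {R : realType} {n : nat}.
Local Notation V := 'rV[R]_n.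
Local Notation e_ i := (delta_mx 0 i : V).
Local Notation pd := (@partial R n R).
Local Notation smfun := (smfun R n).
Implicit Types (i j : 'I_n) (x : V).

Lemma DE i (f : smfun) x : D i f x = 'D_(e_ i) f x.
Proof. by rewrite D.unlock. Qed.

Lemma sm_derivable (f : smfun) i x : derivable f x (e_ i).
Proof. by case: (smfun_smooth f [::]) => _ /(_ i x). Qed.

Lemma sm_continuous (f : smfun) : continuous f.
Proof. by case: (smfun_smooth f [::]). Qed.

Fact D_additive i : zmod_morphism (D i : smfun -> smfun).
Proof.
move=> f g; apply: smext => x; rewrite smD smN !DE.
by apply: deriveB; apply: sm_derivable.
Qed.
HB.instance Definition _ i :=
  GRing.isZmodMorphism.Build smfun smfun (D i : smfun -> smfun) (D_additive i).

Lemma DB i (f g : smfun) : D i (f - g) = D i f - D i g.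
Proof. exact: D_additive. Qed.
Lemma D0 i : D i 0 = 0 :> smfun.
Proof. by rewrite -[X in D _ X](subrr 0) DB subrr. Qed.
Lemma DN i (f : smfun) : D i (- f) = - D i f.
Proof. by rewrite -[- f]sub0r DB D0 sub0r. Qed.
Lemma DD i (f g : smfun) : D i (f + g) = D i f + D i g.
Proof. by rewrite -{1}[g]opprK DB DN opprK. Qed.
Lemma D_sum i (I : Type) (r : seq I) (P : pred I) (F : I -> smfun) :
  D i (\sum_(k <- r | P k) F k) = \sum_(k <- r | P k) D i (F k).
Proof. by elim/big_rec2: _ => [|k y z _ <-]; rewrite ?D0 ?DD. Qed.

Lemma DM i (f g : smfun) : D i (f * g) = D i f * g + f * D i g.
Proof.
apply: smext => x; rewrite smD !smM !DE.
rewrite (deriveM (@sm_derivable f i x) (@sm_derivable g i x)) addrC.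
by congr (_ + _); rewrite mulrC.
Qed.

Lemma D_cst i c : D i (smcst c) = 0 :> smfun.
Proof. by apply: smext => x; rewrite DE; exact: derive_cst. Qed.

Lemma DZ i c (f : smfun) : D i (smcst c * f) = smcst c * D i f.
Proof. by rewrite DM D_cst mul0r add0r. Qed.

(** Reduces partial derivatives to derivatives of functions of one variable. *)
Lemma is_derive_lineP (F : V -> R) (x v : V) (t l : R) :
  is_derive (t *: v + x) v F l <-> is_derive t 1 (fun h : R => F (h *: v + x)) l.
Proof.
have H : (fun h : R => h^-1 *: ((F \o shift (t *: v + x)) (h *: v) - F (t *: v + x)))
    = (fun h : R => h^-1 *: (((fun h : R => F (h *: v + x)) \o shift t) (h *: (1 : R))
         - F (t *: v + x))).
  apply/funext => h /=; congr (_ *: (F _ - _)).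
  by rewrite addrA -scalerDl; congr ((_ + _) *: _ + _); rewrite [RHS]mulr1.
split=> -[d e]; split; move: d e; by rewrite /derivable /derive H.
Qed.

Lemma sm_is_derive_line (f : smfun) i x (t : R) :
  is_derive t 1 (fun h : R => f (h *: e_ i + x)) (D i f (t *: e_ i + x)).
Proof. by rewrite DE; exact/is_derive_lineP/derivableP/sm_derivable. Qed.

(** The mean value theorem along an axis, behind the symmetry of second
    derivatives, the consistency of difference quotients and the vanishing of the
    integral of a derivative. *)
Lemma sm_mvt (f : smfun) i x h : exists2 c, `|c| <= `|h| &
  f (h *: e_ i + x) - f x = h * D i f (c *: e_ i + x).
Proof.
have dl t := sm_is_derive_line f i x t.
have cl : continuous (fun h : R => f (h *: e_ i + x)).
  move=> t; apply/differentiable_continuous/derivable1_diffP.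
  by case: (dl t).
have cw (A : set R) : {within A, continuous (fun h : R => f (h *: e_ i + x))}.
  exact: continuous_subspaceT.
have [h0|h0] := lerP 0 h.
  have [c] := MVT_segment h0 (fun t _ => dl t) (cw _).
  rewrite in_itv/= => /andP[c0 ch].
  rewrite scale0r add0r subr0 mulrC => ->; exists c => //.
  by rewrite !ger0_norm.
have [c] := MVT_segment (ltW h0) (fun t _ => dl t) (cw _).
rewrite in_itv/= => /andP[c0 ch].
rewrite scale0r add0r sub0r => e; exists c.
  by rewrite !ler0_norm ?lerN2 // ltW.
by rewrite -opprB e mulrN opprK mulrC.
Qed.

Lemma continuousP0 (f : V -> R) x : {for x, continuous f} ->
  forall e, 0 < e -> exists2 d, 0 < d & forall y, `|y - x| < d -> `|f y - f x| < e.
Proof.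
move=> cf e e0; move/cvgrPdist_lt : cf => /(_ e e0)/nbhs_ballP[d /= d0 H].
exists d => // y yx; rewrite distrC; apply: H.
by rewrite -ball_normE/= distrC.
Qed.

Lemma norm_e i : `|e_ i| <= 1.
Proof.
rewrite /Num.norm/= mx_normrE; apply: bigmax_le => // -[j k] _ /=.
by rewrite mxE normr_nat; case: (_ && _).
Qed.

Lemma is_derive_affine (f : V -> R) i c v x l :
  is_derive (c *: x + v) (e_ i) f l ->
  is_derive x (e_ i) (fun y => f (c *: y + v)) (c * l).
Proof.
move=> fl; rewrite -[x]add0r -(scale0r (e_ i)).
apply/is_derive_lineP.
have -> : (fun h : R => f (c *: (h *: e_ i + x) + v)) =
    (fun h : R => f (h *: e_ i + (c *: x + v))) \o ( *%R c).
  by apply/funext => h /=; rewrite scalerDr scalerA addrA.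
have dc : is_derive (0 : R) 1 ( *%R c) c.
  by have := is_deriveZ c (is_derive_id (0 : R) 1); rewrite /GRing.scale/= mulr1.
rewrite mulrC; apply: is_derive1_comp.
by apply/is_derive_lineP; rewrite mulr0 scale0r add0r.
Qed.

Lemma Ck_affine k (f : V -> R) c v :
  smooth f -> Ck k (fun y => f (c *: y + v)).
Proof.
elim: k f => [|k IH] f sf.
  move=> x; have ca : {for x, continuous (fun y : V => c *: y + v)}.
    by apply: continuousD; [exact: scaler_continuous|exact: cst_continuous].
  by apply: (continuous_comp ca); case: (sf [::]) => + _; apply.
split; first exact: Ck_cont (IH f sf).
have dl i (x : V) : is_derive x (e_ i) (fun y => f (c *: y + v))
    (c * pd i f (c *: x + v)).
  by apply/is_derive_affine/derivableP; case: (sf [::]).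
move=> i; split=> [x|]; first by case: (dl i x).
have -> : pd i (fun y => f (c *: y + v)) = cst c * (fun y => pd i f (c *: y + v)).
  by apply/funext => x; rewrite /partial; case: (dl i x).
by apply: CkM; [exact: Ck_cst|apply/IH/smooth_partial].
Qed.

(** Composition with an affine map: dilations of cutoffs and lattice shifts. *)
Definition aff c v (f : smfun) : smfun :=
  SmFun (asboolT ((smoothP _).2 (fun k => Ck_affine k c v (smfun_smooth f)))).

Lemma affE c v (f : smfun) x : aff c v f x = f (c *: x + v).
Proof. by []. Qed.

Fact aff_additive c v : zmod_morphism (aff c v).
Proof. by move=> f g; apply: smext. Qed.
HB.instance Definition _ c v :=
  GRing.isZmodMorphism.Build smfun smfun (aff c v) (aff_additive c v).
Fact aff_monoid c v : monoid_morphism (aff c v).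
Proof. by split=> [|f g]; apply: smext. Qed.
HB.instance Definition _ c v :=
  GRing.isMonoidMorphism.Build smfun smfun (aff c v) (aff_monoid c v).

Lemma D_aff i c v (f : smfun) : D i (aff c v f) = smcst c * aff c v (D i f).
Proof.
apply: smext => x; rewrite smM affE !DE smcstE.
have dl := is_derive_affine (derivableP (@sm_derivable f i (c *: x + v))).
by case: dl.
Qed.

Lemma DC i j (f : smfun) : D i (D j f) = D j (D i f).
Proof.
(* both mixed derivatives are the second difference quotient at a nearby point *)
have key k l (x : V) s : 0 < s -> exists2 z, `|z - x| <= s + s &
    f (s *: e_ l + (s *: e_ k + x)) - f (s *: e_ l + x) - (f (s *: e_ k + x) - f x)
    = s * s * D k (D l f) z.
  move=> s0; have [c cs] := sm_mvt (aff 1 (s *: e_ k) f - f) l x s.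
  rewrite DB D_aff rmorph1 mul1r !smD !smN !affE !scale1r.
  set y := c *: e_ l + x.
  have [d ds] := sm_mvt (D l f) k y s.
  rewrite [_ + y]addrC => -> e; exists (d *: e_ k + y).
    rewrite /y addrA addrK (le_trans (ler_normD _ _)) // !normrZ.
    rewrite (gtr0_norm s0) in cs ds.
    apply: lerD; rewrite -[s]mulr1; apply: ler_pM => //; exact: norm_e.
  rewrite -mulrA -e addrCA [s *: e_ k + (_ + _)]addrC [s *: e_ k + x]addrC.
  by ring.
move: (key i j) (key j i).
move: (D i (D j f)) (D j (D i f)) => a b {}key1 key2.
apply: smext => x; apply/eqP; rewrite -subr_eq0 -normr_le0.
apply/ler_addgt0Pl => e e0; rewrite addr0.
have e2 : 0 < e / 2 by rewrite divr_gt0.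
have [d1 d10 H1] := continuousP0 (@sm_continuous a x) e2.
have [d2 d20 H2] := continuousP0 (@sm_continuous b x) e2.
set s := Num.min d1 d2 / 3.
have s0 : 0 < s by rewrite divr_gt0 // lt_min d10 d20.
have ss : s + s < Num.min d1 d2 by rewrite /s; move: s0; rewrite /s; lra.
have [z1 z1s E1] := key1 x s s0.
have [z2 z2s E2] := key2 x s s0.
have E : a z1 = b z2.
  have ss0 : s * s != 0 by rewrite mulf_neq0 ?gt_eqF.
  apply: (mulfI ss0); rewrite -E1 -E2.
  by rewrite [in RHS]addrCA; ring.
have := H1 z1 (le_lt_trans z1s _); have := H2 z2 (le_lt_trans z2s _).
rewrite -E; move: ss; rewrite lt_min => /andP[-> ->] /(_ isT) h2 /(_ isT) h1.
rewrite -(subrKA (a z1)) (le_trans (ler_normD _ _)) //.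
by rewrite [e]splitr lerD // ltW // distrC.
Qed.

End Derivations.

(** * Cutoffs and the weight *)

Section Composition.
Context {R : realType} {n : nat}.
Local Notation V := 'rV[R]_n.
Local Notation e_ i := (delta_mx 0 i : V).
Local Notation smfun := (smfun R n).

Lemma sm_Ck (f : smfun) k : Ck k f.
Proof. by move: k; apply/smoothP; exact: smfun_smooth. Qed.

(** Composition with a function of one variable that comes in a family G stable
    under differentiation: this replaces the formula for higher derivatives of
    a composite. It serves twice, for exp(-1/t) and for t^(-1/3). *)
Lemma Ck_comp (G : nat -> R -> R) (a b : nat -> R) (f : smfun) :
  (forall m x, is_derive (f x) 1 (G m) (a m * G m.+1 (f x) + b m * G m.+2 (f x))) ->
  forall k m, Ck k (G m \o f).
Proof.
move=> dG k; elim: k => [|k IH] m /=.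
  move=> x; apply: continuous_comp; first exact: sm_continuous.
  apply/differentiable_continuous/derivable1_diffP.
  by case: (dG m x).
split; first exact: Ck_cont (IH m).
have dl (i : 'I_n) (x : V) : is_derive x (e_ i) (G m \o f)
    ((a m * G m.+1 (f x) + b m * G m.+2 (f x)) * D i f x).
  have -> : x = 0 *: e_ i + x by rewrite scale0r add0r.
  move: (dG m (0 *: e_ i + x)) (sm_is_derive_line f i x 0) => dg df.
  exact/is_derive_lineP/is_derive1_comp.
move=> i; split=> [x|]; first by case: (dl i x).
have -> : @partial R n R i (G m \o f) =
    (cst (a m) * (G m.+1 \o f) + cst (b m) * (G m.+2 \o f)) * D i f.
  by apply/funext => x; rewrite /partial; case: (dl i x).
apply: CkM; last exact: sm_Ck.
by apply: CkD; apply: CkM => //; exact: Ck_cst.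
Qed.

Lemma smooth_comp (G : nat -> R -> R) (a b : nat -> R) (f : smfun) :
  (forall m x, is_derive (f x) 1 (G m) (a m * G m.+1 (f x) + b m * G m.+2 (f x))) ->
  smooth (G 0%N \o f).
Proof. by move=> dG; apply/smoothP => k; exact: Ck_comp dG k 0%N. Qed.

Lemma is_derive_coord (i j : 'I_n) (x : V) :
  is_derive x (e_ j) (fun y : V => y 0 i) (i == j)%:R.
Proof.
rewrite -[x]add0r -(scale0r (e_ j)); apply/is_derive_lineP.
have -> : (fun h : R => (h *: e_ j + x) 0 i) = ((i == j)%:R \*: id) + cst (x 0 i).
  by apply/funext => h; rewrite !mxE eqxx/= mulrC.
by apply: is_derive_eq; rewrite addr0 [LHS]mulr1.
Qed.

Lemma Ck_coord k (i : 'I_n) : Ck k (fun y : V => y 0 i).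
Proof.
have c0 : continuous (fun y : V => y 0 i) by move=> y; exact: coord_continuous.
case: k => [|k] //; split => // j; split=> [x|].
  by case: (is_derive_coord i j x).
have -> : @partial R n R j (fun y : V => y 0 i) = cst (i == j)%:R.
  by apply/funext => x; rewrite /partial; case: (is_derive_coord i j x).
exact: Ck_cst.
Qed.

Definition X i : smfun := SmFun (asboolT ((smoothP _).2 (fun k => Ck_coord k i))).

Lemma XE i x : X i x = x 0 i. Proof. by []. Qed.

Lemma D_X i j : D j (X i) = (i == j)%:R.
Proof.
apply: smext => x; rewrite DE smMn sm1.
by case: (is_derive_coord i j x).
Qed.

End Composition.

HB.lock Definition r2 {R : realType} {n : nat} : smfun R n := \sum_(i < n) X i * X i.

Section Radius.
Context {R : realType} {n : nat}.
Local Notation V := 'rV[R]_n.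
Local Notation smfun := (smfun R n).

Lemma r2E (x : V) : r2 x = \sum_i x 0 i ^+ 2.
Proof. by rewrite r2.unlock smE; apply: eq_bigr => i _; rewrite smM XE expr2. Qed.

Lemma r2_ge0 (x : V) : 0 <= r2 x.
Proof. by rewrite r2E sumr_ge0 // => i _; rewrite sqr_ge0. Qed.

Lemma D_r2 j : D j r2 = X j *+ 2 :> smfun.
Proof.
rewrite r2.unlock D_sum (bigD1 j) //= big1 => [|i ij].
  by rewrite DM D_X eqxx mul1r mulr1 addr0.
by rewrite DM D_X (negbTE ij) mul0r mulr0 addr0.
Qed.

End Radius.

Section Flat.
Context {R : realType}.
Implicit Types (t s : R) (m : nat).

(** The family of all functions t^(-m) exp(-1/t), extended by 0 to t <= 0, is
    closed under differentiation up to linear combinations. *)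
Definition flat m t : R := if 0 < t then t^-1 ^+ m * expR (- t^-1) else 0.

(** From exp(s) = exp(s/N)^N >= (s/N)^N with s = 1/t and N = m + 2. The quadratic
    bound makes all functions of the family differentiable at 0. *)
Lemma flat_bound m t : 0 <= flat m t <= (m.+2)%:R ^+ m.+2 * t ^+ 2.
Proof.
rewrite /flat; case: ifPn => [t0|_]; last first.
  by rewrite lexx mulr_ge0 ?sqr_ge0 // exprn_ge0.
have s0 : 0 < t^-1 by rewrite invr_gt0.
have m0 : 0 < (m.+2)%:R :> R by rewrite ltr0n.
apply/andP; split; first by rewrite mulr_ge0 ?expR_ge0 ?exprn_ge0 ?ltW.
rewrite expRN ler_pdivrMr ?expR_gt0 //.
have -> : t^-1 ^+ m = (t^-1 / m.+2%:R) ^+ m.+2 * (m.+2%:R ^+ m.+2 * t ^+ 2).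
  rewrite mulrA -exprMn divfK ?gt_eqF // -(addn2 m) exprD -mulrA -exprMn.
  by rewrite mulVf ?gt_eqF // expr1n mulr1.
have M0 : 0 < m.+2%:R ^+ m.+2 * t ^+ 2 by rewrite mulr_gt0 ?exprn_gt0.
rewrite mulrC ler_pM2l //.
have -> : expR t^-1 = expR (t^-1 / m.+2%:R) ^+ m.+2.
  by rewrite -expRM_natl; congr expR; field; rewrite !gt_eqF.
rewrite lerXn2r ?nnegrE ?expR_ge0 //; first by rewrite divr_ge0 ?ltW.
by rewrite (le_trans _ (expR_ge1Dx _)) // lerDr.
Qed.

Lemma flat_deriv m t : is_derive t 1 (flat m) (- m%:R * flat m.+1 t + 1 * flat m.+2 t).
Proof.
have [t0|t0|<-] := ltrgtP 0 t.
- have : is_derive t 1 (fun s => s^-1 ^+ m * expR (- s^-1))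
      (- m%:R * flat m.+1 t + 1 * flat m.+2 t).
    have tn : t != 0 by rewrite gt_eqF.
    have di : is_derive t 1 (fun s : R => s^-1) (- t ^- 2).
      by have := is_deriveV tn (is_derive_id t (1 : R)); rewrite /GRing.scale/= mulr1.
    have de : is_derive t 1 (fun s : R => expR (- s^-1)) (expR (- t^-1) * t^-2).
      have dn : is_derive t 1 (fun s : R => - s^-1) (t ^- 2).
        by have := is_deriveN di; rewrite opprK.
      exact: is_derive1_comp (is_derive_expR _) dn.
    have -> : (fun s : R => s^-1 ^+ m * expR (- s^-1)) =
        ((fun s : R => s^-1) ^+ m) * (fun s : R => expR (- s^-1)).
      by apply/funext => s; rewrite exprfctE.
    apply: (is_derive_eq (is_deriveM (is_deriveX m di) de)); rewrite exprfctE.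
    rewrite /flat t0 /GRing.scale/=.
    case: m => [|m] /=.
      by rewrite mul0r !mul0r mulr0 addr0 oppr0 mul0r add0r; field.
    by rewrite !exprS; field.
  apply: near_eq_is_derive; near=> s; rewrite /flat ifT //.
  by near: s; apply: lt_nbhsr.
- have : is_derive t 1 (cst 0 : R -> R) (- m%:R * flat m.+1 t + 1 * flat m.+2 t).
    by rewrite /flat !ltNge !(ltW t0) /= !mulr0 addr0; exact: is_derive_cst.
  apply: near_eq_is_derive; near=> s; rewrite /flat ifF // ltNge.
  by apply/negbTE; rewrite negbK ltW //; near: s; apply: lt_nbhsl.
- have -> : - m%:R * flat m.+1 0 + 1 * flat m.+2 0 = 0 :> R.
    by rewrite /flat ltxx !mulr0 addr0.
  have c : (fun h : R => h^-1 *: ((flat m \o shift (0 : R)) (h *: (1 : R)) - flat m 0))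
      @ 0^' --> (0 : R).
    pose C : R := (m.+2)%:R ^+ m.+2.
    have C0 : 0 < C by rewrite exprn_gt0 // ltr0n.
    apply/cvgrPdist_le => e e0; near=> h.
    rewrite sub0r normrN /flat/= ltxx subr0 addr0 -/(flat m _) [h *: 1]mulr1.
    rewrite [_ *: _]mulrC normrM normfV.
    have h0 : 0 < `|h| by rewrite normr_gt0; near: h; exact: nbhs_dnbhs_neq.
    rewrite ler_pdivrMr //.
    have /andP[f0 f1] := flat_bound m h.
    rewrite ger0_norm // (le_trans f1) // -real_normK ?num_real // expr2 mulrA.
    rewrite ler_pM2r // -/C mulrC -ler_pdivlMr //; near: h.
    by apply: dnbhs0_le; rewrite divr_gt0.
  by split; [apply/cvg_ex; exists 0|apply/cvg_lim].
Unshelve. all: by end_near. Qed.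

Lemma flat_ge0 m t : 0 <= flat m t.
Proof. by case/andP: (flat_bound m t). Qed.

Lemma flat0_gt0 t : 0 < t -> 0 < flat 0 t.
Proof. by move=> t0; rewrite /flat t0 expr0 mul1r expR_gt0. Qed.

Lemma flat0_le0 t : t <= 0 -> flat 0 t = 0.
Proof. by move=> t0; rewrite /flat ltNge t0. Qed.

Lemma flat0_homo t s : t <= s -> flat 0 t <= flat 0 s.
Proof.
move=> ts; have [t0|t0] := lerP t 0.
  by rewrite flat0_le0 // flat_ge0.
rewrite /flat t0 (lt_le_trans t0 ts) !expr0 !mul1r ler_expR lerN2.
by rewrite lef_pV2 ?posrE // (lt_le_trans t0 ts).
Qed.

End Flat.

Section Bumps.
Context {R : realType} {n : nat}.
Local Notation V := 'rV[R]_n.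
Local Notation smfun := (smfun R n).

Definition flat_comp (f : smfun) : smfun :=
  SmFun (asboolT (smooth_comp (G := @flat R) (fun m x => flat_deriv m (f x)))).

Lemma flat_compE f x : flat_comp f x = flat 0 (f x). Proof. by []. Qed.

Definition bumpfun : smfun := flat_comp (1 - r2).

Lemma bump_gt0 x : r2 x < 1 -> 0 < bumpfun x.
Proof. by move=> h; rewrite flat_compE flat0_gt0 // !smE subr_gt0. Qed.

Lemma bump_eq0 x : 1 <= r2 x -> bumpfun x = 0.
Proof. by move=> h; rewrite flat_compE flat0_le0 // !smE subr_le0. Qed.

Lemma bump_ge0 x : 0 <= bumpfun x.
Proof. by rewrite flat_compE flat_ge0. Qed.

Lemma bump_center x : r2 x <= 1 / 2 -> flat 0 (1 / 2) <= bumpfun x.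
Proof. by move=> h; rewrite flat_compE flat0_homo // !smE; lra. Qed.

(** Equal to 1 on the unit ball and to 0 where |x|^2 >= 2: as the inner flat
    function vanishes for |x| <= 1, the outer one then has the constant argument
    flat 0 1, and the argument is nonpositive once |x|^2 >= 2. *)
Definition plateau : smfun :=
  smcst (flat 0 (flat 0 (1 : R)))^-1 *
  flat_comp (smcst (flat 0 1) - flat_comp (r2 - 1)).

Lemma plateau1 x : r2 x <= 1 -> plateau x = 1.
Proof.
move=> h; rewrite smM smcstE flat_compE !smE smcstE flat_compE [flat 0 ((_ : smfun) x)]flat0_le0 ?subr0.
  by rewrite mulVf // gt_eqF // !flat0_gt0.
by rewrite !smE subr_le0.
Qed.

Lemma plateau0 x : 2 <= r2 x -> plateau x = 0.
Proof.
move=> h; rewrite smM smcstE flat_compE [X in _ * X]flat0_le0 ?mulr0 //.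
by rewrite !smE flat_compE smcstE subr_le0 flat0_homo // !smE; lra.
Qed.

(** The family t^(-1/3 - m) is the one to which the composition lemma applies. *)
Lemma weight_deriv (m : nat) (x : V) :
  is_derive ((1 + r2 : smfun) x) 1 (fun t : R => t `^ (- (1 / 3) - m%:R))
   ((- (1 / 3) - m%:R) * (1 + r2 : smfun) x `^ (- (1 / 3) - (m.+1)%:R)
    + 0 * (1 + r2 : smfun) x `^ (- (1 / 3) - (m.+2)%:R)).
Proof.
have t0 : 0 < (1 + r2 : smfun) x by rewrite !smE ltr_pwDl // r2_ge0.
have -> : - (1 / 3) - (m.+1)%:R = (- (1 / 3) - m%:R) - 1 :> R.
  by rewrite -natr1; ring.
by rewrite mul0r addr0; exact: is_derive1_powR.
Qed.

(** The weight (1 + |x|^2)^(-1/3), of the size of |x|^(-2/3) at infinity. Its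
    cube is rational, so that identities between its powers are algebraic. *)
Definition weight : smfun := SmFun (asboolT (smooth_comp weight_deriv)).

Lemma weightE x : weight x = (1 + r2 x) `^ (- (1 / 3)).
Proof. by rewrite /= subr0. Qed.

Lemma weight_gt0 x : 0 < weight x.
Proof. by rewrite weightE powR_gt0 // ltr_pwDl // r2_ge0. Qed.

Lemma weight_cube : weight ^+ 3 * (1 + r2) = 1.
Proof.
apply: smext => x; rewrite !smE weightE.
have t0 : 0 < 1 + r2 x by rewrite ltr_pwDl // r2_ge0.
rewrite -powR_mulrn ?powR_ge0 // -powRrM.
have -> : - (1 / 3) * 3%:R = -1 :> R by field.
by rewrite powR_inv1 ?ltW // mulVf // gt_eqF.
Qed.

Lemma D_weight i : smcst 3 * D i weight = - (smcst 2 * X i * weight ^+ 4) :> smfun.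
Proof.
set w : smfun := weight; have W : w ^+ 3 * (1 + r2) = 1 by exact: weight_cube.
have E : (w * w * D i w) *+ 3 * (1 + r2) + w ^+ 3 * (X i *+ 2) = 0.
  transitivity (D i (w ^+ 3 * (1 + r2))); last by rewrite W -(rmorph1 smcst) D_cst.
  rewrite DM DD D_r2 !exprS expr0 mulr1 !DM -(rmorph1 smcst) D_cst rmorph1; ring.
have -> : smcst 3 * D i w = 3%:R * D i w * (w ^+ 3 * (1 + r2)).
  by rewrite W mulr1 rmorph_nat.
rewrite rmorph_nat; apply/eqP; rewrite -subr_eq0; apply/eqP.
by transitivity (w * 0 : smfun); [rewrite -E; ring|rewrite mulr0].
Qed.

End Bumps.

(** * Integration by Riemann sums *)

Section UltraLimit.
Context {R : realType}.
Implicit Types (a b : nat -> R).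

Fact ex_ultra : exists U : set_system nat, UltraFilter U /\ \oo `<=` U.
Proof. exact: ultraFilterLemma. Qed.

Definition ultra := sval (cid ex_ultra).

#[local] Instance ultra_filter : UltraFilter ultra := (svalP (cid ex_ultra)).1.

Lemma ultra_oo (A : set nat) k0 : (forall k, (k0 <= k)%N -> A k) -> ultra A.
Proof. by move=> kA; apply: (svalP (cid ex_ultra)).2; exists k0. Qed.

(** The limit along an ultrafilter exists for every bounded sequence and is
    linear and monotone; no convergence of Riemann sums has to be proved. *)
Definition ulim a : R := lim (a @ ultra).

Lemma ulim_cvg a (C : R) : (forall k, `|a k| <= C) -> a @ ultra --> ulim a.
Proof.
move=> aC; suff [p ap] : exists p : R, a @ ultra --> p.
  by rewrite /ulim; exact: cvgP ap.
have ua : ultra (a @^-1` `[- C, C]%classic).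
  by apply: filterE => k; have := aC k; rewrite /= in_itv/= ler_norml.
have [p [_ clp]] := @segment_compact R (- C) C (a @ ultra) _ ua.
exists p => B Bp; have [//|uB] := @in_ultra_setVsetC _ _ (a @^-1` B) ultra_filter.
by have [x [/= nBx Bx]] := clp (~` B) B uB Bp; case: nBx.
Qed.

Lemma ulim_eq a b k0 : (forall k, (k0 <= k)%N -> a k = b k) -> ulim a = ulim b.
Proof.
move=> ab; rewrite /ulim; congr lim; apply/seteqP; split=> A /=.
  by apply: filterS2 (ultra_oo ab) => k /= ->.
by apply: filterS2 (ultra_oo ab) => k /= ->.
Qed.

Lemma ulim_unique a l : a @ ultra --> l -> ulim a = l.
Proof. exact: (cvg_lim (@Rhausdorff R)). Qed.

Lemma ulim_le a b (Ca Cb : R) k0 : (forall k, `|a k| <= Ca) -> (forall k, `|b k| <= Cb) ->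
  (forall k, (k0 <= k)%N -> a k <= b k) -> ulim a <= ulim b.
Proof.
move=> aC bC ab; apply: ler_cvg_to (ulim_cvg aC) (ulim_cvg bC) _.
exact: ultra_oo ab.
Qed.

Lemma ulim_cst c : ulim (fun=> c) = c.
Proof. by apply: ulim_unique; exact: cvg_cst. Qed.

Lemma ulimD a b (Ca Cb : R) : (forall k, `|a k| <= Ca) -> (forall k, `|b k| <= Cb) ->
  ulim (fun k => a k + b k) = ulim a + ulim b.
Proof.
move=> aC bC; apply: ulim_unique; apply: cvgD; [exact: ulim_cvg aC|exact: ulim_cvg bC].
Qed.

Lemma ulimZ a c (Ca : R) : (forall k, `|a k| <= Ca) -> ulim (fun k => c * a k) = c * ulim a.
Proof.
by move=> aC; apply: ulim_unique; apply: cvgM; [exact: cvg_cst|exact: ulim_cvg aC].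
Qed.

End UltraLimit.

Section RiemannSums.
Context {R : realType} {n : nat}.
Local Notation V := 'rV[R]_n.
Local Notation e_ i := (delta_mx 0 i : V).
Local Notation smfun := (smfun R n).
Implicit Types (k M s : nat) (f g : smfun) (x : V).

Lemma coord_le_norm x (i : 'I_n) : `|x 0 i| <= `|x|.
Proof.
rewrite [leRHS]/Num.norm/= mx_normrE.
exact: (@le_bigmax _ _ _ _ (fun ij : 'I_1 * 'I_n => `|x ij.1 ij.2|) (0, i)).
Qed.

Lemma norm_le_coord x c : 0 <= c -> (forall i, `|x 0 i| <= c) -> `|x| <= c.
Proof.
move=> c0 H; rewrite [leLHS]/Num.norm/= mx_normrE; apply: bigmax_le => //.
by move=> -[j i] _ /=; rewrite ord1.
Qed.

Lemma sm_bounded f (M : R) : exists2 C : R, 0 <= C & forall x, `|x| <= M -> `|f x| <= C.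
Proof.
have cB : compact [set x : V | `|x| <= M].
  apply: bounded_closed_compact; last first.
    rewrite (_ : mkset _ = (fun x : V => `|x|) @^-1` [set y | y <= M]) //.
    by apply: closed_comp => [x _|]; [exact: norm_continuous|exact: closed_le].
  by exists M; split=> [|y My x /= xM]; rewrite ?num_real // (le_trans xM) // ltW.
have := continuous_compact (continuous_subspaceT (@sm_continuous _ _ f)) cB.
move=> /compact_bounded[C [_ HC]].
exists (`|C| + 1) => [|x xM]; first by rewrite addr_ge0.
by apply: (HC (`|C| + 1)); [rewrite ltr_pwDr // ler_norm|exists x].
Qed.

Local Notation mesh k := (2^-1 ^+ k : R).
Local Notation side k M := (2 * M * 2 ^ k)%N.

Definition gridpt k M (j : {ffun 'I_n -> 'I_(side k M)}) : V :=
  \row_i ((j i)%:R * mesh k - M%:R).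

(* The grid consists of the points of [-M, M)^n in 2^-k Z^n. *)
Definition rsum k M (f : V -> R) : R := mesh k ^+ n * \sum_j f (@gridpt k M j).

Lemma mesh_gt0 k : 0 < mesh k. Proof. by rewrite exprn_gt0. Qed.

Lemma mesh_small (K e : R) : 0 <= K -> 0 < e ->
  exists k0, forall k, (k0 <= k)%N -> K * mesh k <= e.
Proof.
move=> K0 e0; exists (Num.truncn (K / e)).+1 => k kk.
rewrite exprVn ler_pdivrMr ?exprn_gt0 // mulrC -ler_pdivrMr //.
have /truncn_itv/andP[_ /ltW Ke] : 0 <= K / e by rewrite divr_ge0 // ltW.
rewrite (le_trans Ke) // -natrX ler_nat (leq_trans kk) // ltnW // ltn_expl //.
Qed.

Lemma mesh_side k M : (side k M)%:R * mesh k = (2 * M)%:R.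
Proof.
by rewrite natrM natrX -mulrA -exprMn mulfV ?expr1n ?mulr1.
Qed.

Lemma gridpt_box k M j : `|@gridpt k M j| <= M%:R.
Proof.
apply: norm_le_coord => // i; rewrite mxE ler_norml.
have jm : (j i)%:R * mesh k <= (side k M)%:R * mesh k.
  by rewrite ler_pM2r ?mesh_gt0 // ler_nat ltnW.
have j0 : 0 <= (j i)%:R * mesh k by rewrite mulr_ge0 // ltW ?mesh_gt0.
by rewrite mesh_side in jm; move: jm; rewrite natrM; lra.
Qed.

Lemma mesh_card k M : mesh k ^+ n * #|{ffun 'I_n -> 'I_(side k M)}|%:R = (2 * M)%:R ^+ n.
Proof. by rewrite card_ffun !card_ord natrX -exprMn mulrC mesh_side. Qed.

Lemma rsum_le k M (f g : V -> R) : (forall x, `|x| <= M%:R -> f x <= g x) ->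
  rsum k M f <= rsum k M g.
Proof.
move=> fg; rewrite ler_pM2l ?exprn_gt0 //; apply: ler_sum => j _.
exact/fg/gridpt_box.
Qed.

Lemma rsum_cst k M c : rsum k M (cst c) = (2 * M)%:R ^+ n * c.
Proof. by rewrite /rsum sumr_const -[c *+ _]mulr_natl mulrA mesh_card. Qed.

Lemma rsumD k M (f g : V -> R) : rsum k M (fun x => f x + g x) = rsum k M f + rsum k M g.
Proof. by rewrite /rsum big_split mulrDr. Qed.

Lemma rsumZ k M c (f : V -> R) : rsum k M (fun x => c * f x) = c * rsum k M f.
Proof. by rewrite /rsum -mulr_sumr mulrCA. Qed.

Lemma rsum_bound k M (f : V -> R) C : (forall x, `|x| <= M%:R -> `|f x| <= C) ->
  `|rsum k M f| <= (2 * M)%:R ^+ n * C.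
Proof.
move=> fC; rewrite ler_norml -mulrN -!(rsum_cst k M).
by apply/andP; split; apply: rsum_le => x /fC; rewrite ler_norml => /andP[].
Qed.

Lemma rsum_bounded M f : exists C, forall k, `|rsum k M f| <= C.
Proof.
have [C _ fC] := sm_bounded f M%:R.
by exists ((2 * M)%:R ^+ n * C) => k; exact: rsum_bound.
Qed.

Lemma sum_itv (m A B : nat) : (B <= m)%N -> (\sum_(j < m) (A <= j < B) = B - A)%N.
Proof.
move=> Bm; have -> : (\sum_(j < m) (A <= j < B) = minn B m - A)%N; last by lia.
elim: m {Bm} => [|m IH]; first by rewrite big_ord0; lia.
by rewrite big_ord_recr /= IH; lia.
Qed.

(** Dyadic boxes of mesh 2^-s contain, in every finer grid, exactly the number of
    points that their volume predicts. *)
Lemma grid_count k s M (A B : 'I_n -> nat) : (s <= k)%N ->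
  (forall i, B i <= side s M)%N ->
  mesh k ^+ n * \sum_(j : {ffun 'I_n -> 'I_(side k M)})
     \prod_i (A i * 2 ^ (k - s) <= j i < B i * 2 ^ (k - s))%N%:R
  = \prod_i ((B i - A i)%N%:R * mesh s).
Proof.
move=> sk Bm; rewrite -(bigA_distr_bigA (fun i (j : 'I_(side k M)) =>
   (A i * 2 ^ (k - s) <= j < B i * 2 ^ (k - s))%N%:R)).
rewrite -[n in _ ^+ n]card_ord -prodr_const -big_split /=.
apply: eq_bigr => i _.
have e2 : (2 ^ k = 2 ^ s * 2 ^ (k - s))%N by rewrite -expnD subnKC.
rewrite -natr_sum sum_itv; last first.
  by rewrite e2 mulnA leq_mul2r Bm orbT.
rewrite -mulnBl natrM mulrCA; congr (_ * _).
rewrite natrX -[X in mesh X * _](subnK sk) exprD mulrAC -exprMn mulVf //.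
by rewrite expr1n mul1r.
Qed.

(* The wrap-around of the cyclic shift is invisible to functions that vanish
   near the boundary of the box. *)
Definition cyc k M s (i : 'I_n) (j : {ffun 'I_n -> 'I_(side k M)}) :
    {ffun 'I_n -> 'I_(side k M)} :=
  [ffun i' => if i' == i
     then Ordinal (ltn_pmod (j i' + s) (leq_ltn_trans (leq0n _) (ltn_ord (j i'))))
     else j i'].

Lemma cyc_inj k M s i : injective (@cyc k M s i).
Proof.
move=> j1 j2 /ffunP E; apply/ffunP => i'; move: (E i'); rewrite !ffunE.
case: eqP => // _ /(congr1 val)/= /eqP.
by rewrite eqn_modDr !modn_small // => /eqP/val_inj.
Qed.

Definition supp_lt (r : R) (f : V -> R) := forall x, r <= `|x| -> f x = 0.

Lemma rsum_shift k M s (i : 'I_n) (f : V -> R) : (s <= 2 ^ k)%N ->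
  supp_lt (M%:R - 1) f ->
  rsum k M (fun x => f ((s%:R * mesh k) *: e_ i + x)) = rsum k M f.
Proof.
move=> s2 fs; rewrite /rsum; congr (_ * _).
rewrite [RHS](reindex_inj (@cyc_inj k M s i)) /=; apply: eq_bigr => j _.
have M0 : (0 < M)%N by have := leq_ltn_trans (leq0n _) (ltn_ord (j i)); rewrite !muln_gt0 => /andP[].
have m0 := mesh_gt0 k.
have [jm|jm] := ltnP (j i + s) (side k M).
  congr f; apply/rowP => i'; rewrite !mxE !ffunE eqxx /=.
  case: eqP => [->|_] /=; last by rewrite mulr0 add0r.
  by rewrite modn_small // natrD; ring.
have js : (j i + s < side k M + side k M)%N.
  have : (2 ^ k <= side k M)%N by rewrite -{1}[(2 ^ k)%N]mul1n leq_mul2r; lia.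
  by have := ltn_ord (j i); lia.
have jR : (side k M)%:R * mesh k <= (j i + s)%:R * mesh k.
  by rewrite ler_pM2r // ler_nat.
have sR : s%:R * mesh k <= 1.
  apply: le_trans (_ : (2 ^ k)%:R * mesh k <= 1); first by rewrite ler_pM2r // ler_nat.
  by rewrite natrX -exprMn mulfV // expr1n.
rewrite mesh_side natrD natrM in jR.
rewrite !fs //.
- apply: le_trans (coord_le_norm _ i); rewrite !mxE ffunE eqxx /=.
  have -> : ((j i + s) %% side k M = j i + s - side k M)%N.
    by rewrite -{1}(subnK jm) modnDr modn_small //; lia.
  rewrite natrB // mulrBl mesh_side natrD natrM ler_normr.
  have := ltn_ord (j i); rewrite -(ltr_nat R) -(ltr_pM2r m0) mesh_side natrM.
  move: sR jR; rewrite !mulrDl => sR jR ji.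
  by apply/orP; right; lra.
- apply: le_trans (coord_le_norm _ i); rewrite !mxE !eqxx /= ler_normr.
  by apply/orP; left; move: jR; rewrite mulrDl; lra.
Qed.

End RiemannSums.

Notation mesh k := (2^-1 ^+ k).

Section Integral.
Context {R : realType} {n : nat}.
Local Notation V := 'rV[R]_n.
Local Notation e_ i := (delta_mx 0 i : V).
Local Notation smfun := (smfun R n).
Implicit Types (k M s : nat) (f g : smfun) (x : V).

(** The integral over the box [-M, M)^n, as a limit of Riemann sums over dyadic
    grids. Positivity, linearity, invariance under dyadic shifts and the volume
    of dyadic boxes are all that is used of it. *)
Definition Int M f : R := ulim (fun k => rsum k M f).

Lemma Int_le M f g : (forall x, `|x| <= M%:R -> f x <= g x) -> Int M f <= Int M g.
Proof.
move=> fg; have [C fC] := rsum_bounded M f; have [C' gC] := rsum_bounded M g.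
by apply: (ulim_le (k0 := 0) fC gC) => k _; exact: rsum_le.
Qed.

Lemma IntD M f g : Int M (f + g) = Int M f + Int M g.
Proof.
have [C fC] := rsum_bounded M f; have [C' gC] := rsum_bounded M g.
rewrite /Int -(ulimD fC gC); apply: (ulim_eq (k0 := 0)) => k _.
by rewrite -rsumD.
Qed.

Lemma IntZ M c f : Int M (smcst c * f) = c * Int M f.
Proof.
have [C fC] := rsum_bounded M f.
by rewrite /Int -(ulimZ _ fC); apply: (ulim_eq (k0 := 0)) => k _; rewrite -rsumZ.
Qed.

Lemma Int0 M : Int M 0 = 0.
Proof. by rewrite -(mul0r 0) -(rmorph0 smcst) IntZ mul0r. Qed.

Lemma IntN M f : Int M (- f) = - Int M f.
Proof. by apply/eqP; rewrite -addr_eq0 -IntD addNr Int0. Qed.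

Lemma IntB M f g : Int M (f - g) = Int M f - Int M g.
Proof. by rewrite IntD IntN. Qed.

Lemma Int_sum M (I : Type) (r : seq I) (P : pred I) (F : I -> smfun) :
  Int M (\sum_(i <- r | P i) F i) = \sum_(i <- r | P i) Int M (F i).
Proof. by elim/big_rec2: _ => [|i y z _ <-]; rewrite ?Int0 ?IntD. Qed.

Lemma Int_ge0 M f : (forall x, `|x| <= M%:R -> 0 <= f x) -> 0 <= Int M f.
Proof. by move=> f0; rewrite -(Int0 M); apply: Int_le. Qed.

Lemma Int_ge_cst M f c k0 : (forall k, (k0 <= k)%N -> c <= rsum k M f) -> c <= Int M f.
Proof.
move=> cf; have [C fC] := rsum_bounded M f; rewrite -(ulim_cst c).
exact: (ulim_le (Ca := `|c|) (k0 := k0) _ fC).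
Qed.

Lemma Int_le_cst M f c k0 : (forall k, (k0 <= k)%N -> rsum k M f <= c) -> Int M f <= c.
Proof.
move=> cf; have [C fC] := rsum_bounded M f; rewrite -(ulim_cst c).
exact: (ulim_le (Cb := `|c|) (k0 := k0) fC).
Qed.

(** Every grid of mesh at most 2^-k0 is invariant under the shift, up to the
    wrap-around. *)
Lemma Int_shift M k0 (i : 'I_n) f : supp_lt (M%:R - 1) f ->
  Int M (aff 1 (mesh k0 *: e_ i) f) = Int M f.
Proof.
move=> fs; apply: (ulim_eq (k0 := k0)) => k k0k.
have k2 : (2 ^ (k - k0) <= 2 ^ k)%N by rewrite leq_exp2l // leq_subr.
rewrite -(rsum_shift i k2 fs); congr rsum; apply/funext => x.
rewrite affE scale1r addrC; congr (f (_ *: _ + _)).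
rewrite natrX -[X in _ * mesh X](subnK k0k) exprD mulrA -exprMn mulfV //.
by rewrite expr1n mul1r.
Qed.

(** The Riemann sum of a difference quotient of mesh size is zero by the shift
    invariance of the grid, and by the mean value theorem it differs from that of
    the derivative by O(2^-k). *)
Lemma Int_D M (i : 'I_n) f : supp_lt (M%:R - 1) f -> Int M (D i f) = 0.
Proof.
move=> fs.
have [C C0 HC] := sm_bounded (D i (D i f)) (M%:R + 1).
have B k : `|rsum k M (D i f)| <= (2 * M)%:R ^+ n * (C * mesh k).
  have m0 : 0 < mesh k :> R := mesh_gt0 k.
  have m1 : mesh k <= 1 :> R by rewrite exprn_ile1 ?invr_ge0 ?invf_le1 ?ler1n ?ltr0n ?ler0n.
  (* subtract the difference quotient, whose Riemann sum vanishes *)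
  have -> : rsum k M (D i f) =
      rsum k M (fun x => D i f x - (mesh k)^-1 * (f (mesh k *: e_ i + x) - f x)).
    rewrite [RHS](_ : _ = rsum k M (fun x => D i f x +
       (- (mesh k)^-1) * (f (mesh k *: e_ i + x) + -1 * f x))); last first.
      by congr rsum; apply/funext => x; ring.
    rewrite rsumD rsumZ rsumD rsumZ.
    have -> : rsum k M (fun x => f (mesh k *: e_ i + x)) = rsum k M f.
      rewrite -(rsum_shift i _ fs (s := 1)) ?expn_gt0 //.
      by congr rsum; apply/funext => x; rewrite mul1r.
    by rewrite mulN1r subrr mulr0 addr0.
  apply: rsum_bound => x xM.
  have [c cm ->] := sm_mvt f i x (mesh k).
  rewrite mulKf ?gt_eqF //.
  have [d dm E] := sm_mvt (D i f) i x c.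
  rewrite distrC E normrM mulrC.
  rewrite (gtr0_norm m0) in cm.
  apply: ler_pM => //; apply: HC.
  rewrite addrC (le_trans (ler_normD _ _)) // lerD // normrZ.
  rewrite -[leRHS]mulr1 ler_pM ?norm_e //.
  exact: le_trans dm (le_trans cm m1).
apply/eqP; rewrite -normr_le0; apply/ler_addgt0Pl => e e0; rewrite addr0.
set K := (2 * M)%:R ^+ n * C.
have K0 : 0 <= K by rewrite mulr_ge0 ?exprn_ge0.
have [k0 Hk0] := mesh_small K0 e0.
have BB k : (k0 <= k)%N -> `|rsum k M (D i f)| <= e.
  by move=> /Hk0; apply: le_trans; rewrite -mulrA.
rewrite ler_norml; apply/andP; split.
  by apply: (Int_ge_cst (k0 := k0)) => k /BB; rewrite ler_norml => /andP[].
by apply: (Int_le_cst (k0 := k0)) => k /BB; rewrite ler_norml => /andP[].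
Qed.

Lemma Int_ge_cube M f (c : R) s (A : 'I_n -> nat) : 0 <= c ->
  (forall x, 0 <= f x) -> (forall i, (A i < 2 * M * 2 ^ s)%N) ->
  (forall x, (forall i, (A i)%:R * mesh s <= x 0 i + M%:R < (A i).+1%:R * mesh s) ->
     c <= f x) ->
  c * mesh s ^+ n <= Int M f.
Proof.
move=> c0 f0 AM cf; apply: (Int_ge_cst (k0 := s)) => k sk.
have := @grid_count R n k s M A (fun i => (A i).+1) sk AM.
have -> : \prod_i (((A i).+1 - A i)%N%:R * mesh s) = mesh s ^+ n :> R.
  rewrite (eq_bigr (fun=> mesh s)) => [|i _]; last by rewrite subSnn mul1r.
  by rewrite prodr_const card_ord.
move=> <-; rewrite mulrCA /rsum ler_pM2l ?exprn_gt0 ?mesh_gt0 // mulr_sumr.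
apply: ler_sum => j _.
have [/forallP jQ|] := boolP [forall i, (A i * 2 ^ (k - s) <= j i < (A i).+1 * 2 ^ (k - s))%N].
  rewrite big1 ?mulr1 => [|i _]; last by rewrite jQ.
  apply: cf => i; rewrite mxE subrK.
  have m0 := mesh_gt0 (R := R) k.
  have E : mesh s = (2 ^ (k - s))%:R * mesh k :> R.
    by rewrite -[X in _ * mesh X](subnK sk) exprD natrX mulrA -exprMn mulfV // expr1n mul1r.
  by rewrite E !mulrA -!natrM ler_pM2r // ltr_pM2r // ler_nat ltr_nat; exact: jQ.
move=> /forallPn[i ni]; rewrite (bigD1 i) //= (negbTE ni) mul0r mulr0.
exact: f0.
Qed.

Lemma Int_le_cube M f (C : R) (r : nat) : 0 <= C -> (r < M)%N ->
  (forall x, f x <= C) -> (forall x, r%:R < `|x| -> f x <= 0) ->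
  Int M f <= C * (2 * r + 1)%:R ^+ n.
Proof.
move=> C0 rM fC f0; apply: (Int_le_cst (k0 := 0)) => k _.
have BM (i : 'I_n) : (M + r + 1 <= 2 * M * 2 ^ 0)%N by lia.
have := @grid_count R n k 0 M (fun i => (M - r)%N) (fun i => (M + r + 1)%N) (leq0n k) BM.
have -> : \prod_(i < n) (((M + r + 1) - (M - r))%N%:R * mesh 0) = (2 * r + 1)%:R ^+ n :> R.
  rewrite (eq_bigr (fun=> (2 * r + 1)%:R)) => [|i _].
    by rewrite prodr_const card_ord.
  by rewrite expr0 mulr1; congr (_%:R); lia.
move=> <-; rewrite mulrCA /rsum ler_pM2l ?exprn_gt0 ?mesh_gt0 // mulr_sumr.
apply: ler_sum => j _; rewrite subn0.
have [xr|xr] := lerP `|@gridpt R n k M j| r%:R; last first.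
  by rewrite (le_trans (f0 _ xr)) // mulr_ge0 // prodr_ge0.
rewrite big1 ?mulr1 ?fC // => i _.
have := le_trans (coord_le_norm _ i) xr; rewrite mxE ler_norml => /andP[x1 x2].
have m0 := mesh_gt0 (R := R) k.
have E a : a%:R = (a * 2 ^ k)%:R * mesh k :> R.
  by rewrite natrM natrX -mulrA -exprMn mulfV // expr1n mulr1.
suff -> : ((M - r) * 2 ^ k <= j i < (M + r + 1) * 2 ^ k)%N by [].
rewrite -(ler_nat R) -(ltr_nat R) -(ler_pM2r m0) -(ltr_pM2r m0) -!E.
rewrite natrB ?(ltnW rM) // !natrD; move: x1 x2; set y := _ * _; clear => ? ?.
by apply/andP; split; lra.
Qed.

End Integral.

(** * Supports and the L2 norm *)

Section Supports.
Context {R : realType} {n : nat}.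
Local Notation V := 'rV[R]_n.
Local Notation e_ i := (delta_mx 0 i : V).
Local Notation smfun := (smfun R n).
Implicit Types (f g : smfun) (x : V) (r : R) (i : 'I_n).

Definition supported r f := forall x, r < `|x| -> f x = 0.

Lemma supported0 r : supported r 0. Proof. by []. Qed.
Lemma supported_mull r f g : supported r f -> supported r (f * g).
Proof. by move=> h x /h; rewrite smM => ->; rewrite mul0r. Qed.
Lemma supported_mulr r f g : supported r g -> supported r (f * g).
Proof. by move=> h x /h; rewrite smM => ->; rewrite mulr0. Qed.
Lemma supportedD r f g : supported r f -> supported r g -> supported r (f + g).
Proof. by move=> hf hg x xr; rewrite smD hf // hg // addr0. Qed.
Lemma supportedN r f : supported r f -> supported r (- f).
Proof. by move=> hf x xr; rewrite smN hf // oppr0. Qed.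
Lemma supported_sum r (I : Type) (s : seq I) (P : pred I) (F : I -> smfun) :
  (forall k, supported r (F k)) -> supported r (\sum_(i <- s | P i) F i).
Proof. by move=> h; elim/big_rec: _ => [|i y _ hy]; [exact: supported0|exact: supportedD]. Qed.
Lemma supported_weak r r' f : r <= r' -> supported r f -> supported r' f.
Proof. by move=> rr h x xr; apply: h; exact: le_lt_trans xr. Qed.

Lemma supported_D r i f : supported r f -> supported r (D i f).
Proof.
move=> h x xr; rewrite DE (near_eq_derive (g := cst 0)) ?derive_cst //.
have : \forall y \near x, r < `|y|.
  apply: (@open_nbhs_nbhs _ x [set y : V | r < `|y|]); split=> //.
  rewrite (_ : mkset _ = (fun x : V => `|x|) @^-1` [set y | r < y]) //.
  by apply: open_comp => [y _|]; [exact: norm_continuous|exact: open_gt].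
by apply: filterS => y /h.
Qed.

Lemma supported_aff r v f : supported r f -> supported (r + `|v|) (aff 1 v f).
Proof.
move=> h x xr; rewrite affE scale1r; apply: h; rewrite -(ltrD2r `|v|).
rewrite (lt_le_trans xr) // -[in X in X <= _](addrK v x).
by rewrite (le_trans (ler_normB _ _)).
Qed.

Lemma supported_bounded r f : supported r f -> exists2 C : R, 0 <= C & forall x, `|f x| <= C.
Proof.
move=> h; have [C C0 HC] := sm_bounded f r; exists C => // x.
by have [/HC//|/h ->] := lerP `|x| r; rewrite normr0.
Qed.

End Supports.

Section EuclideanNorm.
Context {R : realType} {n : nat}.
Local Notation V := 'rV[R]_n.
Local Notation e_ i := (delta_mx 0 i : V).
Local Notation smfun := (smfun R n).
Implicit Types (f g : smfun) (x : V) (r : R) (i : 'I_n) (M : nat).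

Lemma supported_supp M f : supported (M%:R - 2) f -> supp_lt (M%:R - 1) f.
Proof. by move=> h x xM; apply: h; lra. Qed.

Lemma IBP M i f g : supported (M%:R - 2) (f * g) ->
  Int M (D i f * g) = - Int M (f * D i g).
Proof.
move=> h; apply/eqP; rewrite -addr_eq0 -IntD -DM Int_D //.
exact: supported_supp.
Qed.

Definition L2norm M f : R := Num.sqrt (Int M (f * f)).

Lemma Int_sqr_ge0 M f : 0 <= Int M (f * f).
Proof. by apply: Int_ge0 => x _; rewrite smM -expr2 sqr_ge0. Qed.

Lemma L2norm_ge0 M f : 0 <= L2norm M f. Proof. exact: sqrtr_ge0. Qed.

Lemma L2norm_sqr M f : L2norm M f ^+ 2 = Int M (f * f).
Proof. by rewrite sqr_sqrtr // Int_sqr_ge0. Qed.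

Lemma L2norm_le_sqrt M f c : 0 <= c -> Int M (f * f) <= c ^+ 2 -> L2norm M f <= c.
Proof.
by move=> c0 h; rewrite -(ler_pXn2r (n := 2)) ?nnegrE ?L2norm_ge0 // L2norm_sqr.
Qed.

Lemma Cauchy_Schwarz M f g : `|Int M (f * g)| <= L2norm M f * L2norm M g.
Proof.
rewrite -(ler_pXn2r (n := 2)) ?nnegrE ?mulr_ge0 ?L2norm_ge0 //.
rewrite real_normK ?num_real // exprMn !L2norm_sqr.
set A := Int M (f * f); set B := Int M (f * g); set C := Int M (g * g).
have A0 : 0 <= A by exact: Int_sqr_ge0.
have C0 : 0 <= C by exact: Int_sqr_ge0.
(* the nonnegative quadratic polynomial t |-> |f + t g|^2 *)
have Q t : 0 <= A + 2 * t * B + t ^+ 2 * C.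
  have := Int_sqr_ge0 M (f + smcst t * g); congr (0 <= _).
  have -> : (f + smcst t * g) * (f + smcst t * g) = f * f + smcst (2 * t) * (f * g)
     + smcst (t ^+ 2) * (g * g) by rewrite rmorphM rmorphXn rmorph_nat; ring.
  by rewrite !IntD !IntZ.
clearbody A B C.
have [C1|C1] := eqVneq C 0.
  have [->|B0] := eqVneq B 0; first by rewrite expr0n C1 mulr0.
  have := Q (- (A + 1) / (2 * B)); rewrite C1 mulr0 addr0.
  have -> : 2 * (- (A + 1) / (2 * B)) * B = - (A + 1) by field.
  by move=> ?; exfalso; lra.
have Cp : 0 < C by rewrite lt_neqAle eq_sym C1.
have := Q (- B / C).
have -> : A + 2 * (- B / C) * B + (- B / C) ^+ 2 * C = (A * C - B ^+ 2) / C by field.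
by rewrite pmulr_lge0 ?invr_gt0 // subr_ge0.
Qed.

Lemma L2normD M f g : L2norm M (f + g) <= L2norm M f + L2norm M g.
Proof.
apply: L2norm_le_sqrt; first by rewrite addr_ge0 // L2norm_ge0.
have -> : (f + g) * (f + g) = f * f + (f * g + f * g) + g * g by ring.
have CS := le_trans (ler_norm _) (Cauchy_Schwarz M f g).
by rewrite !IntD sqrrD !L2norm_sqr lerD2r lerD2l mulr2n lerD.
Qed.

Lemma L2normN M f : L2norm M (- f) = L2norm M f.
Proof. by rewrite /L2norm mulrNN. Qed.

Lemma L2normB M f g : L2norm M (f - g) <= L2norm M f + L2norm M g.
Proof. by rewrite -(L2normN M g) L2normD. Qed.

Lemma L2norm0 M : L2norm M 0 = 0.
Proof. by rewrite /L2norm mul0r Int0 sqrtr0. Qed.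

Lemma L2norm_sum M (I : Type) (s : seq I) (P : pred I) (F : I -> smfun) :
  L2norm M (\sum_(i <- s | P i) F i) <= \sum_(i <- s | P i) L2norm M (F i).
Proof.
elim/big_rec2: _ => [|i y z _ h]; first by rewrite L2norm0.
by rewrite (le_trans (L2normD _ _ _)) // lerD2l.
Qed.

Lemma L2norm_mul M f g K : 0 <= K -> (forall x, `|f x| <= K) -> L2norm M (f * g) <= K * L2norm M g.
Proof.
move=> K0 fK; apply: L2norm_le_sqrt; first by rewrite mulr_ge0 // L2norm_ge0.
rewrite exprMn L2norm_sqr -IntZ; apply: Int_le => x _.
rewrite !smM smcstE mulrACA ler_wpM2r // -?expr2 ?sqr_ge0 //.
by rewrite -[leLHS]real_normK ?num_real // ler_pXn2r ?nnegrE.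
Qed.

Lemma L2normZ M c f : L2norm M (smcst c * f) = `|c| * L2norm M f.
Proof.
rewrite /L2norm mulrACA -rmorphM IntZ -expr2 sqrtrM ?sqr_ge0 //.
by rewrite sqrtr_sqr.
Qed.

Lemma L2norm_cube M f (r : nat) C : (r < M)%N -> 0 <= C -> supported r%:R f ->
  (forall x, `|f x| <= C) -> L2norm M f <= C * (2 * r + 1)%:R ^+ n.
Proof.
move=> rM C0 fr fC.
have Q1 : 1 <= (2 * r + 1)%:R ^+ n :> R by rewrite exprn_ege1 // ler1n addn1.
apply: L2norm_le_sqrt; first by rewrite mulr_ge0 // (le_trans _ Q1).
rewrite exprMn; apply: le_trans (_ : C ^+ 2 * (2 * r + 1)%:R ^+ n <= _); last first.
  by rewrite ler_wpM2l ?sqr_ge0 // expr2 ler_peMl // (le_trans _ Q1).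
apply: Int_le_cube => //; first exact: sqr_ge0.
  move=> x; rewrite smM -expr2 -real_normK ?num_real // ler_pXn2r ?nnegrE //.
by move=> x /fr; rewrite smM => ->; rewrite mul0r.
Qed.

End EuclideanNorm.

(** * Scaled derivations and the resolvent *)

(** The derivation c * D i. With c the radius of the cutoffs, derivatives of
    cutoffs are bounded independently of the radius, and the resolvent is that
    of the unit scale. *)
HB.lock Definition sD (R : realType) (n : nat) (c : R) (i : 'I_n) (f : smfun R n) : smfun R n :=
  smcst c * D i f.

Section ScaledDerivations.
Context {R : realType} {n : nat}.
Local Notation V := 'rV[R]_n.
Local Notation smfun := (smfun R n).
Implicit Types (f g : smfun) (x : V) (i j : 'I_n) (M : nat).
Variable c : R.
Local Notation d := (@sD R n c).

Lemma sDE i f : d i f = smcst c * D i f. Proof. by rewrite sD.unlock. Qed.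
Lemma sDD i f g : d i (f + g) = d i f + d i g. Proof. by rewrite !sDE DD mulrDr. Qed.
Lemma sDN i f : d i (- f) = - d i f. Proof. by rewrite !sDE DN mulrN. Qed.
Lemma sDB i f g : d i (f - g) = d i f - d i g. Proof. by rewrite sDD sDN. Qed.
Lemma sD0 i : d i 0 = 0. Proof. by rewrite sDE D0 mulr0. Qed.
Lemma sD_cst i a : d i (smcst a) = 0. Proof. by rewrite sDE D_cst mulr0. Qed.
Lemma sDM i f g : d i (f * g) = d i f * g + f * d i g.
Proof. by rewrite !sDE DM; ring. Qed.
Lemma sDC i j f : d i (d j f) = d j (d i f).
Proof. by rewrite !sDE !DZ DC. Qed.
Lemma sD_sum i (I : Type) (r : seq I) (P : pred I) (F : I -> smfun) :
  d i (\sum_(k <- r | P k) F k) = \sum_(k <- r | P k) d i (F k).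
Proof. by elim/big_rec2: _ => [|k y z _ <-]; rewrite ?sD0 ?sDD. Qed.
Lemma supported_sD (r : R) i f : supported r f -> supported r (d i f).
Proof. by move=> h; rewrite sDE; apply/supported_mulr/supported_D. Qed.

Lemma IBPs M i f g : supported (M%:R - 2) (f * g) ->
  Int M (d i f * g) = - Int M (f * d i g).
Proof.
move=> h; rewrite !sDE -mulrA IntZ IBP //.
by rewrite mulrCA IntZ mulrN.
Qed.

Definition lap f : smfun := \sum_i d i (d i f).

Lemma lapD f g : lap (f + g) = lap f + lap g.
Proof. by rewrite /lap -big_split; apply: eq_bigr => i _; rewrite !sDD. Qed.
Lemma lapN f : lap (- f) = - lap f.
Proof. by rewrite /lap -sumrN; apply: eq_bigr => i _; rewrite !sDN. Qed.
Lemma lap_sD j f : lap (d j f) = d j (lap f).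
Proof.
by rewrite /lap sD_sum; apply: eq_bigr => i _; rewrite -sDC [in RHS]sDC.
Qed.
Lemma supported_lap (r : R) f : supported r f -> supported r (lap f).
Proof. by move=> h; apply: supported_sum => i; do 2! apply: supported_sD. Qed.

(** Expanding |f - Lap f|^2 and integrating by parts: -f Lap f becomes |grad f|^2
    and |Lap f|^2 becomes the square of the Hessian. *)
Lemma elliptic M f : supported (M%:R - 2) f ->
  Int M ((f - lap f) * (f - lap f)) = Int M (f * f)
    + 2 * \sum_i Int M (d i f * d i f)
    + \sum_i \sum_j Int M (d i (d j f) * d i (d j f)).
Proof.
move=> fs.
have -> : (f - lap f) * (f - lap f) = f * f - smcst 2 * (lap f * f) + lap f * lap f.
  by rewrite rmorph_nat; ring.
rewrite IntD IntB IntZ; congr (_ + _).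
  congr (_ + _); rewrite -mulrN; congr (_ * _).
  rewrite /lap mulr_suml Int_sum -sumrN; apply: eq_bigr => i _.
  by rewrite IBPs ?opprK //; apply: supported_mulr.
rewrite {1}/lap mulr_suml Int_sum; apply: eq_bigr => i _.
rewrite /lap mulr_sumr Int_sum; apply: eq_bigr => j _.
rewrite IBPs; last by apply: supported_mull; do ?apply: supported_sD.
rewrite [d i (d j (d j f))]sDC mulrC [Int M (d j _ * _)]IBPs ?opprK; last by apply: supported_mull; do ?apply: supported_sD.
by rewrite [d j (d i f)]sDC.
Qed.

Lemma elliptic_bounds M f : supported (M%:R - 2) f ->
  [/\ L2norm M f <= L2norm M (f - lap f),
      forall i, L2norm M (d i f) <= L2norm M (f - lap f) &
      forall i j, L2norm M (d i (d j f)) <= L2norm M (f - lap f)].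
Proof.
move=> fs; have E := elliptic fs.
have S0 : 0 <= Int M (f * f) by exact: Int_sqr_ge0.
have S1 : 0 <= \sum_i Int M (d i f * d i f) by apply: sumr_ge0 => *; exact: Int_sqr_ge0.
have S2 i : 0 <= \sum_j Int M (d i (d j f) * d i (d j f)).
  by apply: sumr_ge0 => *; exact: Int_sqr_ge0.
have S3 : 0 <= \sum_i \sum_j Int M (d i (d j f) * d i (d j f)) by apply: sumr_ge0.
split.
- by apply: ler_wsqrtr; rewrite E; lra.
- move=> i; apply: ler_wsqrtr; rewrite E.
  suff : Int M (d i f * d i f) <= \sum_i Int M (d i f * d i f) by lra.
  rewrite [leRHS](bigD1 i) //= lerDl.
  by apply: sumr_ge0 => *; exact: Int_sqr_ge0.
- move=> i j; apply: ler_wsqrtr; rewrite E.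
  suff : Int M (d i (d j f) * d i (d j f)) <=
     \sum_i \sum_j Int M (d i (d j f) * d i (d j f)) by lra.
  rewrite [leRHS](bigD1 i) //= (bigD1 j) //= -addrA lerDl.
  by apply: addr_ge0; apply: sumr_ge0 => *; [exact: Int_sqr_ge0|exact: S2].
Qed.

End ScaledDerivations.

Section Resolvent.
Context {R : realType} {n : nat}.
Local Notation V := 'rV[R]_n.
Local Notation e_ i := (delta_mx 0 i : V).
Local Notation smfun := (smfun R n).
Implicit Types (f g : smfun) (x : V) (i j : 'I_n) (M k m : nat).

Definition shifts k f : smfun :=
  \sum_i (aff 1 (mesh k *: e_ i) f + aff 1 (- (mesh k *: e_ i)) f).

Lemma affD v f g : aff 1 v (f + g) = aff 1 v f + aff 1 v g.
Proof. exact: smext. Qed.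
Lemma affN v f : aff 1 v (- f) = - aff 1 v f.
Proof. exact: smext. Qed.

Lemma shiftsD k f g : shifts k (f + g) = shifts k f + shifts k g.
Proof.
by rewrite /shifts -big_split; apply: eq_bigr => i _; rewrite !affD addrACA.
Qed.
Lemma shiftsN k f : shifts k (- f) = - shifts k f.
Proof.
by rewrite /shifts -sumrN; apply: eq_bigr => i _; rewrite !affN opprD.
Qed.

Lemma affZ v a f : aff 1 v (smcst a * f) = smcst a * aff 1 v f.
Proof. exact: smext. Qed.

Lemma D_shift i v f : D i (aff 1 v f) = aff 1 v (D i f).
Proof. by rewrite D_aff rmorph1 mul1r. Qed.

Lemma shifts0 k : shifts k 0 = 0.
Proof. by rewrite -[X in shifts k X](subrr 0) shiftsD shiftsN subrr. Qed.

Lemma shiftsZ k a f : shifts k (smcst a * f) = smcst a * shifts k f.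
Proof.
by rewrite /shifts mulr_sumr; apply: eq_bigr => i _; rewrite !affZ mulrDr.
Qed.

Lemma D_shifts k i f : D i (shifts k f) = shifts k (D i f).
Proof.
by rewrite /shifts D_sum; apply: eq_bigr => j _; rewrite DD !D_shift.
Qed.

Lemma norm_mesh_e k i : `|mesh k *: e_ i| <= 1.
Proof.
have m0 : 0 <= mesh k :> R by rewrite exprn_ge0.
have m1 : mesh k <= 1 :> R.
  by rewrite exprn_ile1 ?invr_ge0 ?invf_le1 ?ler1n ?ltr0n ?ler0n.
by rewrite normrZ ger0_norm // -[leRHS]mulr1 ler_pM ?norm_e.
Qed.

Lemma supported_aff1 r v f : `|v| <= 1 -> supported r f -> supported (r + 1) (aff 1 v f).
Proof. by move=> v1 /(@supported_aff _ _ _ v); apply: supported_weak; rewrite lerD2l. Qed.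

Lemma supported_shifts r k f : supported r f -> supported (r + 1) (shifts k f).
Proof.
move=> fr; apply: supported_sum => i.
by apply: supportedD; apply: supported_aff1; rewrite // ?normrN norm_mesh_e.
Qed.

Lemma L2norm_shift M k i f : supported (M%:R - 2) f -> L2norm M (aff 1 (mesh k *: e_ i) f) = L2norm M f.
Proof.
move=> fs; rewrite /L2norm -rmorphM Int_shift //.
exact/supported_supp/supported_mull.
Qed.

Lemma L2norm_shiftN M k i f : supported (M%:R - 3) f ->
  L2norm M (aff 1 (- (mesh k *: e_ i)) f) = L2norm M f.
Proof.
move=> fs; rewrite -(L2norm_shift k i); first by congr L2norm; apply: smext => x;
  rewrite !affE !scale1r addrK.
have -> : M%:R - 2 = M%:R - 3 + 1 :> R by lra.
by apply: supported_aff1 => //; rewrite normrN norm_mesh_e.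
Qed.

Lemma L2norm_shifts M k f : supported (M%:R - 3) f -> L2norm M (shifts k f) <= (2 * n)%:R * L2norm M f.
Proof.
move=> fs; apply: le_trans (L2norm_sum _ _ _ _) _.
have fs2 : supported (M%:R - 2) f by apply: supported_weak _ fs; lra.
apply: le_trans (_ : \sum_(i < n) (2 * L2norm M f) <= _).
  apply: ler_sum => i _; apply: le_trans (L2normD _ _ _) _.
  by rewrite L2norm_shift // L2norm_shiftN // mulr2n mulrDl mul1r.
by rewrite sumr_const card_ord -[leLHS]mulr_natl natrM; nra.
Qed.

(** The error made by the difference Laplacian of mesh 2^-k. *)
Definition lap_defect k f : smfun :=
  smcst (mesh k ^- 2) * (shifts k f - smcst (2 * n)%:R * f) - lap 1 f.

Lemma lap1 f : lap 1 f = \sum_i D i (D i f).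
Proof. by apply: eq_bigr => i _; rewrite !sDE rmorph1 !mul1r. Qed.

Lemma lap_defectE k f : lap_defect k f = \sum_i
  (smcst (mesh k ^- 2) * (aff 1 (mesh k *: e_ i) f + aff 1 (- (mesh k *: e_ i)) f - f *+ 2)
   - D i (D i f)).
Proof.
rewrite /lap_defect lap1 sumrB; congr (_ - _).
rewrite -mulr_sumr; congr (_ * _); rewrite sumrB; congr (_ - _).
by rewrite sumr_const card_ord rmorph_nat mulr_natl -mulrnA.
Qed.

(** The second difference is a second derivative at a nearby point. *)
Lemma lap_defect_small r f : supported r f -> exists2 C : R, 0 <= C &
  forall k x, `|lap_defect k f x| <= mesh k * C.
Proof.
move=> fr.
have HB i : exists2 C : R, 0 <= C & forall x, `|D i (D i (D i f)) x| <= C.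
  by apply: (@supported_bounded _ _ r); do 3 apply: supported_D.
pose C i := s2val (cid2 (HB i)).
have C0 i : 0 <= C i by rewrite /C; case: cid2.
have HC i x : `|D i (D i (D i f)) x| <= C i by rewrite /C; case: cid2.
exists (\sum_i 3 * C i) => [|k x].
  by apply: sumr_ge0 => i _; rewrite mulr_ge0.
have m0 : 0 < mesh k :> R by exact: mesh_gt0.
rewrite lap_defectE sm_sum mulr_sumr; apply: le_trans (ler_norm_sum _ _ _) _.
apply: ler_sum => i _; rewrite !smD !smN smM smcstE !smD smN smMn.
set w := mesh k *: e_ i.
have [c cm] := sm_mvt (f - aff 1 (- w) f) i x (mesh k).
rewrite DB D_shift !smD !smN !affE !scale1r -/w.
have [e em] := sm_mvt (D i f) i (c *: e_ i + x - w) (mesh k).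
have Y : w + (c *: e_ i + x - w) = c *: e_ i + x by rewrite addrC subrK.
move=> E2 E; rewrite -/w Y in E2; rewrite E2 in E.
have -> : f (x + w) + f (x - w) - f x *+ 2 =
   f (w + x) - f (w + x - w) - (f x - f (x - w)).
  have -> : w + x - w = x by rewrite addrC addKr.
  by rewrite [w + x]addrC mulr2n; ring.
rewrite E mulrA -expr2 mulKf ?expf_neq0 ?gt_eqF //.
have -> : e *: e_ i + (c *: e_ i + x - w) = (e + c - mesh k) *: e_ i + x.
  by rewrite /w scalerBl scalerDl -!addrA; congr (_ + (_ + _)); rewrite addrC.
have [t tm ->] := sm_mvt (D i (D i f)) i x (e + c - mesh k).
rewrite normrM mulrA ler_pM //.
rewrite (gtr0_norm m0) in cm em.
rewrite (le_trans (ler_normB _ _)) // (gtr0_norm m0).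
by have := le_trans (ler_normD e c) (lerD em cm); lra.
Qed.

(** The Neumann series of (1 - a Laplacian_h)^-1, where Laplacian_h is the
    difference Laplacian of mesh h = 2^-k: as (1 + 2 n b) N - b T N = f with
    b = a / h^2 and T the sum of the shifts, N is the limit of the iteration
    N := (f + b T N) / (1 + 2 n b). *)
Fixpoint neumann (a : R) k m f : smfun :=
  if m is m'.+1 then
    smcst (1 + (2 * n)%:R * (a / mesh k ^+ 2))^-1 *
      (f + smcst (a / mesh k ^+ 2) * shifts k (neumann a k m' f))
  else 0.

Lemma neumann_D a k m i f : D i (neumann a k m f) = neumann a k m (D i f).
Proof.
elim: m => [|m IH] /=; first by rewrite D0.
by rewrite DZ DD DZ D_shifts IH.
Qed.

Lemma shifts_neumann a k m f : shifts k (neumann a k m f) = neumann a k m (shifts k f).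
Proof.
elim: m => [|m IH] /=; first exact: shifts0.
by rewrite shiftsZ shiftsD shiftsZ IH.
Qed.

Lemma neumann_lin a k m b f g :
  neumann a k m (smcst b * f + g) = smcst b * neumann a k m f + neumann a k m g.
Proof.
elim: m => [|m IH] /=; first by rewrite mulr0 addr0.
by rewrite IH shiftsD shiftsZ; ring.
Qed.

Lemma neumann0 a k m : neumann a k m 0 = 0.
Proof.
by have := neumann_lin a k m 1 0 0; rewrite rmorph1 !mul1r addr0 => /eqP;
  rewrite -subr_eq subrr eq_sym => /eqP.
Qed.

Lemma neumannD a k m f g : neumann a k m (f + g) = neumann a k m f + neumann a k m g.
Proof. by have := neumann_lin a k m 1 f g; rewrite rmorph1 !mul1r. Qed.

Lemma neumannZ a k m b f : neumann a k m (smcst b * f) = smcst b * neumann a k m f.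
Proof. by have := neumann_lin a k m b f 0; rewrite neumann0 !addr0. Qed.

Lemma neumannB a k m f g : neumann a k m (f - g) = neumann a k m f - neumann a k m g.
Proof.
by rewrite neumannD -[- g]mulN1r -(rmorph1 smcst) -rmorphN neumannZ rmorphN rmorph1 mulN1r.
Qed.

Lemma neumann_sum a k m (I : Type) (s : seq I) (P : pred I) (F : I -> smfun) :
  neumann a k m (\sum_(i <- s | P i) F i) = \sum_(i <- s | P i) neumann a k m (F i).
Proof. by elim/big_rec2: _ => [|i y z _ <-]; rewrite ?neumann0 ?neumannD. Qed.

Lemma lap_defect_neumann a k m f :
  lap_defect k (neumann a k m f) = neumann a k m (lap_defect k f).
Proof.
rewrite /lap_defect !lap1 neumannB neumannZ neumannB neumannZ neumann_sum.
rewrite shifts_neumann; congr (_ - _).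
by apply: eq_bigr => i _; rewrite !neumann_D.
Qed.

Lemma supported_neumann a k m r f : supported r f -> supported (r + m%:R) (neumann a k m f).
Proof.
move=> fr; elim: m => [|m IH] /=; first exact: supported0.
apply: supported_mulr; apply: supportedD; first by apply: supported_weak fr; rewrite lerDl.
apply: supported_mulr; rewrite -natr1 addrA; exact: supported_shifts.
Qed.

Section Estimates.
Variables (a : R) (k : nat).
Hypothesis a0 : 0 < a.
Let b : R := a / mesh k ^+ 2.
Let c : R := (1 + (2 * n)%:R * b)^-1.

Let b0 : 0 < b. Proof. by rewrite divr_gt0 // exprn_gt0 // mesh_gt0. Qed.
Let c0 : 0 < c. Proof. by rewrite invr_gt0 ltr_pwDl // mulr_ge0 // ltW. Qed.
Let cb : c + (2 * n)%:R * (c * b) = 1.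
Proof.
rewrite mulrCA -{1}[c]mulr1 -mulrDr /c mulVf // gt_eqF //.
by rewrite -invr_gt0.
Qed.

(** The factor by which the iteration contracts. *)
Definition neumann_ratio : R := (2 * n)%:R * (c * b).

Lemma neumann_ratio_lt1 : 0 <= neumann_ratio < 1.
Proof.
rewrite /neumann_ratio; apply/andP; split.
  by rewrite mulr_ge0 // mulr_ge0 // ltW.
by rewrite -subr_gt0 -[X in X - _]cb addrK.
Qed.

Lemma neumannS m f :
  neumann a k m.+1 f = smcst c * f + smcst (c * b) * shifts k (neumann a k m f).
Proof.
rewrite (_ : neumann a k m.+1 f = smcst c * (f + smcst b * shifts k (neumann a k m f))) //.
by rewrite mulrDr mulrA -(rmorphM smcst).
Qed.

Lemma L2norm_neumann M m f r : supported r f -> r + m%:R + 3 <= M%:R ->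
  L2norm M (neumann a k m f) <= L2norm M f.
Proof.
move=> fr; elim: m => [|m IH] rM; first by rewrite L2norm0 L2norm_ge0.
rewrite -natr1 in rM; have {}IH := IH ltac:(lra).
rewrite neumannS; apply: le_trans (L2normD _ _ _) _; rewrite !L2normZ.
rewrite !gtr0_norm // ?mulr_gt0 //.
have sN : supported (M%:R - 3) (neumann a k m f).
  by apply: supported_weak (@supported_neumann a k m r f fr); lra.
have := L2norm_shifts k sN; set y := L2norm M (shifts _ _) => h.
rewrite -[leRHS]mul1r -cb mulrDl lerD2l [(2 * n)%:R * _]mulrC -[leRHS]mulrA.
rewrite ler_pM2l ?mulr_gt0 //; apply: le_trans h _.
by rewrite ler_wpM2l.
Qed.

(** The shifts are isometries of the L2 norm, so that each step contracts. *)
Lemma L2norm_neumann_step M m f r : supported r f -> r + m%:R + 4 <= M%:R ->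
  L2norm M (neumann a k m.+1 f - neumann a k m f) <= neumann_ratio ^+ m * (c * L2norm M f).
Proof.
move=> fr; elim: m => [|m IH] rM.
  rewrite expr0 mul1r neumannS /= subr0 shifts0 mulr0 addr0.
  by rewrite L2normZ gtr0_norm.
rewrite -natr1 in rM; have {}IH := IH ltac:(lra).
have -> : neumann a k m.+2 f - neumann a k m.+1 f =
   smcst (c * b) * shifts k (neumann a k m.+1 f - neumann a k m f).
  rewrite shiftsD shiftsN [neumann a k m.+2 f]neumannS.
  by set S := shifts k (neumann a k m.+1 f); rewrite neumannS; ring.
rewrite L2normZ gtr0_norm ?mulr_gt0 //.
have sN : supported (M%:R - 3) (neumann a k m.+1 f - neumann a k m f).
  apply: supportedD; first by apply: supported_weak (@supported_neumann a k m.+1 r f fr); rewrite -natr1; lra.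
  by apply: supportedN; apply: supported_weak (@supported_neumann a k m r f fr); lra.
have h := L2norm_shifts k sN.
rewrite exprS -mulrA {1}/neumann_ratio [(2 * n)%:R * _]mulrC -[leRHS]mulrA.
rewrite ler_pM2l ?mulr_gt0 //; apply: le_trans h _.
by rewrite ler_wpM2l.
Qed.

(** The residual splits into the last step of the iteration, small for large
    order, and the defect of the difference Laplacian, small for fine mesh; the
    series commutes with the defect as both are built of shifts and derivatives. *)
Lemma neumann_residual m f :
  neumann a k m f - smcst a * lap 1 (neumann a k m f) - f =
  smcst c^-1 * (neumann a k m f - neumann a k m.+1 f)
  + smcst a * neumann a k m (lap_defect k f).
Proof.
have cc : smcst c^-1 * smcst c = 1 :> smfun.
  by rewrite -rmorphM mulVf ?gt_eqF // rmorph1.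
have ccb : smcst c^-1 * smcst (c * b) = smcst b :> smfun.
  by rewrite -rmorphM mulKf ?gt_eqF.
have ci : smcst c^-1 = 1 + smcst (2 * n)%:R * smcst b :> smfun.
  by rewrite invrK rmorphD rmorph1 rmorphM.
have ab : smcst b = smcst a * smcst (mesh k ^- 2) :> smfun by rewrite -rmorphM.
rewrite -lap_defect_neumann /lap_defect neumannS.
set N := neumann a k m f; set S := shifts k N.
have -> : smcst c^-1 * (N - (smcst c * f + smcst (c * b) * S)) =
  smcst c^-1 * N - (smcst c^-1 * smcst c) * f - (smcst c^-1 * smcst (c * b)) * S by ring.
by rewrite cc ccb mul1r ci ab; ring.
Qed.

End Estimates.

(** The residual of the Neumann series is small in L2, uniformly in the box,
    once the mesh is fine and then the order large. *)
Lemma residual_bound (a : R) f (r : nat) : 0 < a -> supported r%:R f ->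
  exists2 K : R, 0 <= K & forall k m M, (r + m + 7 <= M)%N ->
    L2norm M (neumann a k m f - smcst a * lap 1 (neumann a k m f) - f) <=
    K * (neumann_ratio a k ^+ m + mesh k).
Proof.
move=> a0 fr.
have [C1 C10 H1] := supported_bounded fr.
have [C2 C20 H2] := lap_defect_small fr.
have dr k : supported (r.+1)%:R (lap_defect k f).
  rewrite -natr1; apply: supportedD.
    apply: supported_mulr; apply: supportedD; first exact: supported_shifts.
    by apply: supportedN; apply: supported_mulr; apply: supported_weak fr; lra.
  by apply/supportedN/supported_lap; apply: supported_weak fr; lra.
pose Q : R := (2 * r.+1 + 1)%:R ^+ n.
have Q0 : 0 <= Q by rewrite exprn_ge0.
exists (C1 * (2 * r + 1)%:R ^+ n + a * (C2 * Q)) => [|k m M rM].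
  by rewrite addr_ge0 ?mulr_ge0 ?exprn_ge0 // ltW.
have rMR : r%:R + m%:R + 7 <= M%:R :> R by rewrite -!natrD ler_nat.
have /andP[th0 th1] := neumann_ratio_lt1 k a0.
have m0 : 0 < mesh k :> R by exact: mesh_gt0.
rewrite neumann_residual //; apply: le_trans (L2normD _ _ _) _; rewrite !L2normZ.
set b := (a / _); set c := (1 + _)^-1.
have c0 : 0 < c.
  by rewrite invr_gt0 ltr_pwDl // mulr_ge0 // divr_ge0 ?exprn_ge0 ?ltW.
have N1 : L2norm M f <= C1 * (2 * r + 1)%:R ^+ n by apply: L2norm_cube => //; lia.
have N2 : L2norm M (lap_defect k f) <= mesh k * C2 * Q.
  by apply: L2norm_cube => //; [lia|rewrite mulr_ge0 // ltW].
have ci0 : 0 < c^-1 by rewrite invr_gt0.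
rewrite (gtr0_norm a0) (gtr0_norm ci0).
rewrite -[X in L2norm M X]opprB L2normN.
have S1 : c^-1 * L2norm M (neumann a k m.+1 f - neumann a k m f) <=
    neumann_ratio a k ^+ m * (C1 * (2 * r + 1)%:R ^+ n).
  rewrite mulrC ler_pdivrMr //.
  apply: le_trans (L2norm_neumann_step k a0 fr _) _; first by lra.
  by rewrite -/b -/c -mulrA ler_wpM2l ?exprn_ge0 // mulrC ler_pM2r.
have S2 : a * L2norm M (neumann a k m (lap_defect k f)) <= mesh k * (a * (C2 * Q)).
  rewrite mulrCA ler_pM2l // mulrA; apply: le_trans N2.
  by apply: (L2norm_neumann k a0 (dr k)); rewrite -natr1; lra.
apply: le_trans (lerD S1 S2) _.
have X0 : 0 <= C1 * (2 * r + 1)%:R ^+ n by rewrite mulr_ge0 ?exprn_ge0.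
have Y0 : 0 <= a * (C2 * Q) by rewrite !mulr_ge0 // ltW.
have P0 : 0 <= neumann_ratio a k ^+ m by rewrite exprn_ge0.
nra.
Qed.

(** An approximate inverse of 1 - c^2 Laplacian on compactly supported
    functions, commuting with derivatives. The mesh is chosen before the order:
    the ratio of the iteration tends to 1 as the mesh tends to 0. *)
Lemma resolvent (c eps : R) (fs : seq smfun) (r : nat) : 0 < c -> 0 < eps ->
  (forall f, f \in fs -> supported r%:R f) ->
  exists (G : smfun -> smfun) (M0 : nat), [/\ forall i f, D i (G f) = G (D i f),
    forall f, f \in fs -> supported M0%:R (G f) &
    forall f, f \in fs -> forall M, (M0 + 7 <= M)%N ->
      L2norm M (G f - lap c (G f) - f) <= eps].
Proof.
move=> c0 e0 fsr.
have a0 : 0 < c ^+ 2 by rewrite exprn_gt0.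
have lapc g : lap c g = smcst (c ^+ 2) * lap 1 g.
  rewrite lap1 mulr_sumr; apply: eq_bigr => i _.
  by rewrite !sDE DZ mulrA -rmorphM.
have [K K0 HK] : exists2 K : R, 0 <= K & forall f, f \in fs ->
    forall k m M, (r + m + 7 <= M)%N ->
    L2norm M (neumann (c ^+ 2) k m f - smcst (c ^+ 2) * lap 1 (neumann (c ^+ 2) k m f) - f) <=
    K * (neumann_ratio (c ^+ 2) k ^+ m + mesh k).
  elim: fs fsr => [|f fs IH] fsr; first by exists 0.
  have [K1 K10 H1] := residual_bound a0 (fsr f (mem_head _ _)).
  have [K2 K20 H2] := IH (fun g gs => fsr g (mem_behead (s := f :: fs) gs)).
  exists (K1 + K2) => [|g]; first by rewrite addr_ge0.
  rewrite inE => gfs k m M rM.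
  have /andP[th0 _] := neumann_ratio_lt1 k a0.
  have P0 : 0 <= neumann_ratio (c ^+ 2) k ^+ m + mesh k.
    by rewrite addr_ge0 ?exprn_ge0.
  case/orP: gfs => [/eqP ->|gfs].
    by apply: le_trans (H1 k m M rM) _; rewrite ler_wpM2r // lerDl.
  by apply: le_trans (H2 g gfs k m M rM) _; rewrite ler_wpM2r // lerDr.
have e2 : 0 < eps / 2 by rewrite divr_gt0.
have [k /(_ k (leqnn k)) Hk] := mesh_small K0 e2.
have /andP[th0 th1] := neumann_ratio_lt1 k a0.
have [m Hm] : exists m, K * neumann_ratio (c ^+ 2) k ^+ m <= eps / 2.
  have th : `|neumann_ratio (c ^+ 2) k| < 1 by rewrite ger0_norm.
  have := cvg_expr th => /cvgrPdist_le /(_ (eps / 2 / (K + 1))).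
  case; first by rewrite divr_gt0 // ltr_wpDl.
  move=> m _ /(_ m (leqnn m)) /=; rewrite sub0r normrN ger0_norm ?exprn_ge0 // => h.
  exists m; rewrite ler_pdivlMr ?ltr_wpDl // in h.
  apply: le_trans h; rewrite mulrC ler_wpM2l ?exprn_ge0 // lerDl //.
exists (neumann (c ^+ 2) k m), (r + m)%N; split=> [i f|f ffs|f ffs M rM].
- exact: neumann_D.
- by rewrite natrD; apply/supported_neumann/fsr.
rewrite lapc; apply: le_trans (HK f ffs k m M rM) _.
by rewrite mulrDr; lra.
Qed.

End Resolvent.

(** * The pressure *)

HB.lock Definition sdiv (R : realType) (n : nat) (c : R) (w : 'I_n -> smfun R n) : smfun R n :=
  \sum_j sD c j (w j).

HB.lock Definition scurl (R : realType) (n : nat) (c : R) (w : 'I_n -> smfun R n)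
    (i j : 'I_n) : smfun R n :=
  sD c i (w j) - sD c j (w i).

(** The field that makes chi (f + r) + z divergence-free when N - Lap N = f + r:
    that sum is the divergence of the antisymmetric field chi * curl N. *)
HB.lock Definition corrector (R : realType) (n : nat) (c : R) (chi : smfun R n)
    (w : 'I_n -> smfun R n) (i : 'I_n) : smfun R n :=
  chi * (sD c i (sdiv c w) - w i) + \sum_j sD c j chi * scurl c w i j.

(** The Laplacian of the corrector, except for the term chi * grad (Lap (div N)):
    that one has a derivative too many to be bounded, and is removed by pairing it
    with a divergence-free field. *)
HB.lock Definition corrector_lap (R : realType) (n : nat) (c : R) (chi : smfun R n)
    (f w r : 'I_n -> smfun R n) (i : 'I_n) : smfun R n :=
  lap c chi * (sD c i (sdiv c w) - w i)
  + smcst 2 * (\sum_k sD c k chi * sD c k (sD c i (sdiv c w) - w i))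
  - (chi * w i - f i - chi * r i)
  + \sum_j (lap c (sD c j chi) * scurl c w i j
            + smcst 2 * (\sum_k sD c k (sD c j chi) * sD c k (scurl c w i j))
            + sD c j chi * (scurl c w i j - (sD c i (r j) - sD c j (r i)))).

Section PressureIdentity.
Context {R : realType} {n : nat}.
Local Notation smfun := (smfun R n).
Implicit Types (f g : smfun) (i j k : 'I_n).
Variables (c : R) (M : nat).
Local Notation d := (@sD R n c).
Local Notation L := (lap c).
Local Notation I := (Int M).
Local Notation spM f := (supported (M%:R - 2) f).

(** Differentiating f * g = 0 and multiplying by g; hence D f vanishes wherever g
    does not. This is how the derivations see supports. *)
Lemma sD_zero i f g : f * g = 0 -> d i f * g = 0.
Proof.
move=> fg0; have E : d i f * g * g = 0.
  transitivity (d i (f * g) * g - f * g * d i g); first by rewrite sDM; ring.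
  by rewrite fg0 sD0 !mul0r subr0.
apply: smext => x; have /(congr1 (fun h : smfun => h x)) := E.
rewrite !smM sm0 => /eqP; rewrite mulf_eq0 => /orP[/eqP //|/eqP ->].
by rewrite mulr0.
Qed.

Lemma sD_zeror i f g : f * g = 0 -> f * d i g = 0.
Proof. by rewrite mulrC [f * d i g]mulrC; exact: sD_zero. Qed.

Lemma lap_zeror f g : f * g = 0 -> f * L g = 0.
Proof.
by move=> fg; rewrite /lap mulr_sumr big1 // => i _; do 2! apply: sD_zeror.
Qed.

Lemma lapM f g : L (f * g) =
  L f * g + smcst 2 * (\sum_k d k f * d k g) + f * L g.
Proof.
rewrite /lap mulr_suml !mulr_sumr -!big_split; apply: eq_bigr => i _ /=.
by rewrite !sDM !sDD !sDM rmorph_nat; ring.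
Qed.

Lemma lap_sum (J : Type) (s : seq J) (P : pred J) (F : J -> smfun) :
  L (\sum_(i <- s | P i) F i) = \sum_(i <- s | P i) L (F i).
Proof.
elim/big_rec2: _ => [|i y z _ <-]; last by rewrite lapD.
by rewrite /lap big1 // => i _; rewrite !sD0.
Qed.

Lemma IBP2 f g : spM g -> I (L f * g) = I (f * L g).
Proof.
move=> gs; rewrite /lap mulr_suml mulr_sumr !Int_sum; apply: eq_bigr => i _.
rewrite IBPs; last exact: supported_mulr.
rewrite [I (f * _)](_ : _ = I (d i (d i g) * f)); last by rewrite mulrC.
rewrite [I (d i (d i g) * f)]IBPs; last by apply: supported_mull; apply: supported_sD.
by rewrite mulrC.
Qed.

(** The double divergence of an antisymmetric field vanishes, in weak form. *)
Lemma antisym_pairing f (B : 'I_n -> 'I_n -> smfun) :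
  (forall i j, B j i = - B i j) -> (forall i j, spM (B i j)) ->
  \sum_i I (d i f * \sum_j d j (B i j)) = 0.
Proof.
move=> Ba Bs; set S := LHS.
have E : S = - \sum_i \sum_j I (d j (d i f) * B i j).
  rewrite /S -sumrN; apply: eq_bigr => i _.
  rewrite mulr_sumr Int_sum -sumrN; apply: eq_bigr => j _.
  rewrite mulrC [I (d j (B i j) * _)]IBPs; last exact: supported_mull.
  by rewrite mulrC.
have E2 : S = \sum_i \sum_j I (d j (d i f) * B i j).
  rewrite [LHS]E [X in - X]exchange_big -sumrN; apply: eq_bigr => i _.
  rewrite -sumrN; apply: eq_bigr => j _.
  by rewrite Ba mulrN IntN opprK sDC.
lra.
Qed.

Variables (u : 'I_n -> smfun) (F : 'I_n -> 'I_n -> smfun) (p : smfun) (nu : R).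
Hypothesis div_u : \sum_j d j (u j) = 0.
Hypothesis momentum : forall i, d i p = smcst nu * L (u i) - \sum_j d j (F i j).

Variables phi chi H : smfun.
Hypothesis chi_phi : (chi - 1) * phi = 0.
Hypothesis H_chi : (H - 1) * chi = 0.
Hypothesis chi_s : spM chi.

Variables N r : 'I_n -> smfun.
Local Notation f i := (phi * u i)%R.
(* N solves the resolvent equation for f = phi u up to the error r. *)
Hypothesis N_eq : forall i, N i - L (N i) = f i + r i.

Local Notation q := (sdiv c N).
Local Notation g := (sdiv c (fun i => f i)).
Local Notation rho := (sdiv c r).
Local Notation A := (scurl c N).
Local Notation z := (corrector c chi N).
Local Notation y := (corrector_lap c chi (fun i => f i) N r).

Let lapNi i : L (N i) = N i - f i - r i.
Proof.
transitivity (N i - (N i - L (N i))); first by ring.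
by rewrite N_eq; ring.
Qed.

Let lapq : L q = q - g - rho.
Proof.
rewrite !sdiv.unlock lap_sum -!sumrB; apply: eq_bigr => j _.
by rewrite lap_sD lapNi !sDB.
Qed.

Let divA i : \sum_j d j (A i j) = d i q - L (N i).
Proof.
rewrite sdiv.unlock sD_sum /lap -sumrB; apply: eq_bigr => j _.
by rewrite scurl.unlock sDB sDC.
Qed.

Let lapA i j : L (A i j) = A i j - (d i (f j) - d j (f i)) - (d i (r j) - d j (r i)).
Proof. by rewrite scurl.unlock lapD lapN !lap_sD !lapNi !sDB; ring. Qed.

Let chi_f i : chi * f i = f i.
Proof.
transitivity ((chi - 1) * phi * u i + f i); first by ring.
by rewrite chi_phi mul0r add0r.
Qed.

(* chi is constant on the support of phi. *)
Let dchi_f k i : d k chi * f i = 0.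
Proof.
have := sD_zero k chi_phi; rewrite sDB -(rmorph1 smcst) sD_cst subr0 mulrA => ->.
by rewrite mul0r.
Qed.

Let dchi_df k j i : d k chi * d j (f i) = 0.
Proof. exact/sD_zeror/dchi_f. Qed.

Let dchi_g k : d k chi * g = 0.
Proof. by rewrite sdiv.unlock mulr_sumr big1 // => j _; exact: dchi_df. Qed.

Let H_z i : (H - 1) * z i = 0.
Proof.
rewrite corrector.unlock mulrDr mulrA H_chi mul0r add0r mulr_sumr big1 // => j _.
by rewrite mulrA (sD_zeror j H_chi) mul0r.
Qed.

Let curl_field i : \sum_j d j (chi * A i j) = z i + f i + chi * r i.
Proof.
transitivity (\sum_j d j chi * A i j + chi * \sum_j d j (A i j)).
  by rewrite mulr_sumr -big_split; apply: eq_bigr => j _; rewrite sDM.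
rewrite divA lapNi corrector.unlock -[in RHS](chi_f i); ring.
Qed.

Let pressure_split : \sum_i I (d i p * f i) =
  - (\sum_i I (d i p * z i)) - \sum_i I (r i * (chi * d i p)).
Proof.
have : \sum_i I (d i p * \sum_j d j (chi * A i j)) = 0.
  apply: antisym_pairing => [i j|i j]; first by rewrite scurl.unlock; ring.
  exact: supported_mull.
rewrite (eq_bigr (fun i => I (d i p * z i) + I (d i p * f i) + I (r i * (chi * d i p)))).
  by rewrite !big_split /=; lra.
move=> i _; rewrite curl_field -!IntD; congr I; ring.
Qed.

Let z_s i : spM (z i).
Proof.
rewrite corrector.unlock; apply: supportedD; first exact: supported_mull.
by apply: supported_sum => j; apply: supported_mull; exact: supported_sD.
Qed.

Let momentum_z : \sum_i I (d i p * z i) =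
  nu * \sum_i I (u i * L (z i)) + \sum_i \sum_j I (F i j * d j (z i)).
Proof.
rewrite mulr_sumr -big_split; apply: eq_bigr => i _ /=.
rewrite momentum mulrBl IntB -mulrA IntZ IBP2 //; congr (_ + _).
rewrite mulr_suml Int_sum -sumrN; apply: eq_bigr => j _.
by rewrite IBPs ?opprK //; exact: supported_mulr.
Qed.

Let lap_z i : L (z i) = y i + chi * d i (L q).
Proof.
have Es : L (\sum_j d j chi * A i j) =
  \sum_j (L (d j chi) * A i j + smcst 2 * (\sum_k d k (d j chi) * d k (A i j))
            + d j chi * (A i j - (d i (r j) - d j (r i)))).
  rewrite lap_sum; apply: eq_bigr => j _; rewrite lapM lapA; congr (_ + _).
  transitivity (d j chi * (A i j - (d i (r j) - d j (r i)))
     - d j chi * d i (f j) + d j chi * d j (f i)); first by ring.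
  by rewrite !dchi_df subr0 addr0.
rewrite corrector.unlock lapD lapM lapD lapN lap_sD lapNi Es corrector_lap.unlock.
rewrite -[X in _ = _ - (_ - X - _) + _ + _](chi_f i); ring.
Qed.

Let H_y i : (H - 1) * y i = 0.
Proof.
have -> : y i = L (z i) - chi * d i (L q) by rewrite lap_z addrK.
by rewrite mulrBr lap_zeror // mulrA H_chi mul0r subr0.
Qed.

(* Moving the derivative from Lap q onto u and chi: the first vanishes as u is
   divergence-free, and in the second Lap q = q - g - rho, where dchi kills g. *)
Let u_transport : \sum_i I (u i * (chi * d i (L q))) =
  - \sum_i I (H * u i * (d i chi * (q - rho))).
Proof.
have E i : I (u i * (chi * d i (L q))) =
    - I (L q * chi * d i (u i)) - I (H * u i * (d i chi * (q - rho))).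
  transitivity (I (d i (L q) * (u i * chi))); first by congr I; ring.
  rewrite IBPs; last by apply: supported_mulr; exact: supported_mulr.
  rewrite -!IntN -IntD; congr I; rewrite sDM lapq.
  have E1 : (H - 1) * d i chi = 0 by exact: sD_zeror.
  transitivity (- ((q - g - rho) * chi * d i (u i)) - H * u i * (d i chi * (q - rho))
    + (H - 1) * d i chi * (u i * (q - rho)) + d i chi * g * u i); first by ring.
  by rewrite E1 dchi_g; ring.
rewrite (eq_bigr _ (fun i _ => E i)) big_split /= !sumrN -Int_sum -mulr_sumr.
by rewrite div_u mulr0 Int0 oppr0 add0r.
Qed.

(** The pressure term of the energy identity, without the pressure except in the
    error r: phi u differs by the corrector from a divergence-free field, which is
    orthogonal to the gradient of the pressure, and against the corrector the
    pressure is replaced by means of the momentum equation. *)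
Lemma pressure_formula : \sum_i I (d i p * f i) =
  - nu * (\sum_i I (H * u i * y i) - \sum_i I (H * u i * (d i chi * (q - rho))))
  - (\sum_i \sum_j I (H * F i j * d j (z i))) - \sum_i I (r i * (chi * d i p)).
Proof.
have E1 : \sum_i I (u i * L (z i)) =
    \sum_i I (H * u i * y i) - \sum_i I (H * u i * (d i chi * (q - rho))).
  have Z i : u i * L (z i) = H * u i * y i + u i * (chi * d i (L q)).
    rewrite lap_z; move: (H_y i); move: (y i) (d i (L q)) => Y W HY.
    transitivity (H * u i * Y - u i * ((H - 1) * Y) + u i * (chi * W)); first by ring.
    by rewrite HY mulr0 subr0.
  rewrite -u_transport -big_split; apply: eq_bigr => i _ /=.
  by rewrite Z; exact: IntD.
have E2 : \sum_i \sum_j I (F i j * d j (z i)) = \sum_i \sum_j I (H * F i j * d j (z i)).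
  apply: eq_bigr => i _; apply: eq_bigr => j _; congr I.
  transitivity (H * F i j * d j (z i) - F i j * ((H - 1) * d j (z i))); first by ring.
  by rewrite (sD_zeror j (H_z i)) mulr0 subr0.
have E3 := etrans momentum_z (congr2 (fun a b => nu * a + b) E1 E2).
apply: etrans pressure_split _; apply: etrans (congr1 (fun t => - t - _) E3) _.
by rewrite opprD mulNr.
Qed.

Hypothesis H_phi : (H - 1) * phi = 0.
Hypothesis N_s : forall i, spM (N i).
Variables K Psi : R.
Hypothesis K0 : 0 <= K.
Hypothesis phi_K : (forall x, `|phi x| <= K) /\ forall j x, `|d j phi x| <= K.
Hypothesis chi_K : [/\ forall x, `|chi x| <= K, forall j x, `|d j chi x| <= K,
  forall j k x, `|d j (d k chi) x| <= K & forall x, `|L chi x| <= K].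
Hypothesis Ldchi_K : forall j x, `|L (d j chi) x| <= K.
(* Psi bounds the velocity near the support of the cutoffs, and the errors. *)
Hypothesis Hu_Psi : forall i, L2norm M (H * u i) <= Psi.
Hypothesis r_Psi : forall i, L2norm M (r i) <= Psi.
Hypothesis dr_Psi : forall j i, L2norm M (d j (r i)) <= Psi.

(* Phi dominates, by elliptic regularity, all derivatives of N, of curl N and of
   grad (div N) - N that occur in the corrector. *)
Variable Phi : R.
Hypothesis Phi_def : Phi = 2 * (n%:R + 1) * (K + 1) * Psi.

Let L2normM (h l : smfun) a : (forall x, `|h x| <= K) -> L2norm M l <= a -> L2norm M (h * l) <= K * a.
Proof. by move=> hK la; apply: le_trans (L2norm_mul M l K0 hK) _; rewrite ler_wpM2l. Qed.

Let L2normDa (h l : smfun) a b : L2norm M h <= a -> L2norm M l <= b -> L2norm M (h + l) <= a + b.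
Proof. by move=> ha lb; apply: le_trans (L2normD _ _ _) (lerD ha lb). Qed.

Let L2normBa (h l : smfun) a b : L2norm M h <= a -> L2norm M l <= b -> L2norm M (h - l) <= a + b.
Proof. by move=> ha lb; apply: le_trans (L2normB _ _ _) (lerD ha lb). Qed.

Let L2norm_suma (G : 'I_n -> smfun) a : (forall i, L2norm M (G i) <= a) ->
  L2norm M (\sum_i G i) <= n%:R * a.
Proof.
move=> Ga; apply: le_trans (L2norm_sum _ _ _ _) _.
apply: le_trans (ler_sum _ (fun i _ => Ga i)) _.
by rewrite sumr_const card_ord mulr_natl.
Qed.

Let Psi0 : (0 < n)%N -> 0 <= Psi.
Proof. by move=> np; apply: le_trans (Hu_Psi (Ordinal np)); exact: L2norm_ge0. Qed.

Let f_le i : L2norm M (f i) <= K * Psi.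
Proof.
have -> : f i = phi * (H * u i) - (H - 1) * phi * u i by ring.
by rewrite H_phi mul0r subr0; apply: L2normM => //; case: phi_K.
Qed.

(* As u is divergence-free, the divergence of phi u has no derivative of u. *)
Let g_le : L2norm M g <= n%:R * (K * Psi).
Proof.
rewrite sdiv.unlock; have -> : \sum_j d j (f j) = \sum_j d j phi * (H * u j).
  transitivity (\sum_j d j phi * (H * u j) - \sum_j (H - 1) * d j phi * u j
     + phi * \sum_j d j (u j)).
    rewrite mulr_sumr -sumrB -big_split; apply: eq_bigr => j _ /=.
    by rewrite sDM; ring.
  rewrite div_u mulr0 addr0 [X in _ - X]big1 ?subr0 // => j _.
  by rewrite (sD_zeror j H_phi) mul0r.
by apply: L2norm_suma => j; apply: L2normM => //; case: phi_K.
Qed.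

Let N_le i : [/\ L2norm M (N i) <= (K + 1) * Psi, forall j, L2norm M (d j (N i)) <= (K + 1) * Psi
  & forall j k, L2norm M (d j (d k (N i))) <= (K + 1) * Psi].
Proof.
have B : L2norm M (N i - L (N i)) <= (K + 1) * Psi.
  by rewrite N_eq mulrDl mul1r; apply: L2normDa.
by have [B0 B1 B2] := elliptic_bounds c (N_s i); split=> *; apply: le_trans B.
Qed.

Let q_le : [/\ L2norm M q <= n%:R * ((K + 1) * Psi),
  forall j, L2norm M (d j q) <= n%:R * ((K + 1) * Psi)
  & forall j k, L2norm M (d j (d k q)) <= n%:R * ((K + 1) * Psi)].
Proof.
have B : L2norm M (q - L q) <= n%:R * ((K + 1) * Psi).
  rewrite lapq (_ : q - _ = g + rho); last by ring.
  by rewrite mulrDl mul1r mulrDr; apply: L2normDa => //; rewrite sdiv.unlock; apply: L2norm_suma.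
have q_s : spM q by rewrite sdiv.unlock; apply: supported_sum => j; apply: supported_sD.
by have [B0 B1 B2] := elliptic_bounds c q_s; split=> *; apply: le_trans B.
Qed.

Let Phi_ge (m : R) : 0 <= m -> m <= 2 * (n%:R + 1) -> (0 < n)%N -> m * ((K + 1) * Psi) <= Phi.
Proof.
move=> m0 mn np; rewrite Phi_def -mulrA ler_wpM2r // mulr_ge0 ?Psi0 //.
by rewrite addr_ge0.
Qed.

Let A_le i j : L2norm M (A i j) <= Phi /\ forall k, L2norm M (d k (A i j)) <= Phi.
Proof.
have np : (0 < n)%N := leq_ltn_trans (leq0n _) (ltn_ord i).
have n0 : 0 <= n%:R :> R by [].
have [_ dNi ddNi] := N_le i; have [_ dNj ddNj] := N_le j.
have P := @Phi_ge 2 ltac:(lra) ltac:(lra) np.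
rewrite scurl.unlock; split=> [|k]; rewrite ?sDB; apply: le_trans P; rewrite [2]mulr2n mulrDl mul1r;
  exact: L2normBa.
Qed.

Let zz_le i : [/\ L2norm M (d i q - N i) <= Phi & forall k, L2norm M (d k (d i q - N i)) <= Phi].
Proof.
have np : (0 < n)%N := leq_ltn_trans (leq0n _) (ltn_ord i).
have n0 : 0 <= n%:R :> R by [].
have [Ni dNi ddNi] := N_le i; have [_ dq ddq] := q_le.
have P := @Phi_ge (n%:R + 1) ltac:(lra) ltac:(lra) np.
split=> [|k]; rewrite ?sDB; apply: le_trans P; rewrite mulrDl mul1r; exact: L2normBa.
Qed.

Let dz_le i j : L2norm M (d j (z i)) <= (2 + 2 * n%:R) * K * Phi.
Proof.
case: chi_K => c0 c1 c2 _; have [z0 z1] := zz_le i.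
rewrite corrector.unlock sDD sDM sD_sum.
have -> : (2 + 2 * n%:R) * K * Phi = (K * Phi + K * Phi) + n%:R * (K * Phi + K * Phi) by ring.
apply: L2normDa; first by apply: L2normDa; apply: L2normM.
apply: L2norm_suma => k; rewrite sDM; have [A0 A1] := A_le i k.
by apply: L2normDa; apply: L2normM.
Qed.

Let Psi_Phi : (0 < n)%N -> Psi <= Phi /\ n%:R * Psi <= Phi.
Proof.
have n0 : 0 <= n%:R :> R by [].
move=> np; have P := Phi_ge (m := 1) ltac:(lra) ltac:(lra) np.
have P' := @Phi_ge n%:R ltac:(lra) ltac:(lra) np.
have P0 := Psi0 np; have KP : 0 <= K * Psi by rewrite mulr_ge0.
split; [apply: le_trans P|apply: le_trans P']; first by lra.
by rewrite ler_wpM2l //; lra.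
Qed.

Let Cy : R := K * (4 + 6 * n%:R + 2 * n%:R ^+ 2 + 4 * n%:R) + 1.

Let y_le i : L2norm M (y i) <= Cy * Phi.
Proof.
have np : (0 < n)%N := leq_ltn_trans (leq0n _) (ltn_ord i).
have n0 : 0 <= n%:R :> R by [].
case: chi_K => c0 c1 c2 cL; have [z0 z1] := zz_le i.
have [P1 _] := Psi_Phi np.
have F1 : L2norm M (f i) <= Phi.
  apply: le_trans (f_le i) _; apply: le_trans (Phi_ge (m := 1) _ _ np); [|lra|lra].
  by rewrite mul1r ler_wpM2r ?Psi0 // lerDl.
have N1 : L2norm M (N i) <= Phi.
  have [Ni _ _] := N_le i; apply: le_trans Ni _.
  by apply: le_trans (Phi_ge (m := 1) _ _ np); [rewrite mul1r|lra|lra].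
have two a : L2norm M a <= n%:R * (K * Phi) -> L2norm M (smcst 2 * a) <= 2 * (n%:R * (K * Phi)).
  by move=> h; rewrite L2normZ ger0_norm // ler_wpM2l.
have Phi0 : 0 <= Phi by apply: le_trans N1; exact: L2norm_ge0.
apply: le_trans (_ : (K * Phi + 2 * (n%:R * (K * Phi))) + (K * Phi + Phi + K * Phi)
   + n%:R * ((K * Phi + 2 * (n%:R * (K * Phi))) + K * (Phi + (Phi + Phi))) <= _); last first.
  have -> : Cy * Phi = K * (4 + 6 * n%:R + 2 * n%:R ^+ 2 + 4 * n%:R) * Phi + Phi.
    by rewrite /Cy; ring.
  have KP : 0 <= K * Phi by rewrite mulr_ge0.
  have nKP : 0 <= n%:R * (K * Phi) by rewrite mulr_ge0.
  by rewrite expr2; lra.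
rewrite corrector_lap.unlock; apply: L2normDa; first apply: L2normBa; first apply: L2normDa.
- exact: L2normM.
- by apply: two; apply: L2norm_suma => k; apply: L2normM.
- apply: L2normBa; last by apply: L2normM => //; exact: le_trans (r_Psi i) P1.
  by apply: L2normBa => //; apply: L2normM.
- apply: L2norm_suma => j; have [A0 A1] := A_le i j; apply: L2normDa; first apply: L2normDa.
  + exact: L2normM.
  + by apply: two; apply: L2norm_suma => k; apply: L2normM.
  + apply: L2normM => //; apply: L2normBa => //.
    by apply: L2normBa; exact: le_trans (dr_Psi _ _) P1.
Qed.

Let qrho_le i : L2norm M (d i chi * (q - rho)) <= K * (Phi + Phi).
Proof.
have np : (0 < n)%N := leq_ltn_trans (leq0n _) (ltn_ord i).
have n0 : 0 <= n%:R :> R by [].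
case: chi_K => _ c1 _ _; have [_ P2] := Psi_Phi np.
apply: L2normM => //; apply: L2normBa.
  have [q0 _ _] := q_le; apply: le_trans q0 _.
  by apply: Phi_ge => //; lra.
by apply: le_trans P2; rewrite sdiv.unlock; apply: L2norm_suma.
Qed.

Lemma pressure_estimate : 0 <= nu ->
  `|\sum_i I (d i p * f i)| <=
  (Cy + 2 * K + (2 + 2 * n%:R) * K) * Phi *
    (nu * \sum_i L2norm M (H * u i) + \sum_i \sum_j L2norm M (H * F i j))
  + \sum_i L2norm M (r i) * L2norm M (chi * d i p).
Proof.
move=> nu0; rewrite pressure_formula.
have CS a b B : L2norm M b <= B -> `|I (a * b)| <= L2norm M a * B.
  by move=> bB; apply: le_trans (Cauchy_Schwarz _ _ _) _; rewrite ler_wpM2l // L2norm_ge0.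
have Phi0 (i : 'I_n) : 0 <= Phi.
  by have [A0 _] := A_le i i; apply: le_trans A0; exact: L2norm_ge0.
have Cy0 : 0 <= Cy.
  by rewrite addr_ge0 // mulr_ge0 // !addr_ge0 ?mulr_ge0 ?exprn_ge0.
set C := Cy + 2 * K + (2 + 2 * n%:R) * K.
have X1 : `|\sum_i I (H * u i * y i)| <= \sum_i L2norm M (H * u i) * (Cy * Phi).
  by apply: le_trans (ler_norm_sum _ _ _) _; apply: ler_sum => i _; apply: CS.
have X2 : `|\sum_i I (H * u i * (d i chi * (q - rho)))| <=
    \sum_i L2norm M (H * u i) * (K * (Phi + Phi)).
  by apply: le_trans (ler_norm_sum _ _ _) _; apply: ler_sum => i _; apply: CS.
have X3 : `|\sum_i \sum_j I (H * F i j * d j (z i))| <=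
    \sum_i \sum_j L2norm M (H * F i j) * ((2 + 2 * n%:R) * K * Phi).
  apply: le_trans (ler_norm_sum _ _ _) _; apply: ler_sum => i _.
  by apply: le_trans (ler_norm_sum _ _ _) _; apply: ler_sum => j _; apply: CS.
have X4 : `|\sum_i I (r i * (chi * d i p))| <= \sum_i L2norm M (r i) * L2norm M (chi * d i p).
  by apply: le_trans (ler_norm_sum _ _ _) _; apply: ler_sum => i _; apply: CS.
apply: le_trans (ler_normB _ _) _; apply: lerD _ X4.
apply: le_trans (ler_normB _ _) _.
rewrite [leRHS]mulrDr; apply: lerD.
  rewrite normrM normrN (ger0_norm nu0) mulrCA ler_wpM2l //.
  apply: le_trans (ler_normB _ _) _; apply: le_trans (lerD X1 X2) _.
  rewrite -!mulr_suml -mulrDr mulrC.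
  have [n0|np] := posnP n.
    by rewrite big1 ?mulr0 // => i _; have := ltn_ord i; rewrite {2}n0.
  pose i := Ordinal np.
  rewrite ler_wpM2r ?sumr_ge0 // => [j _|]; first exact: L2norm_ge0.
  rewrite /C !mulrDl; have P0 := Phi0 i.
  have KP : 0 <= K * Phi by rewrite mulr_ge0.
  have nKP : 0 <= n%:R * (K * Phi) by rewrite mulr_ge0.
  by clear Phi0; rewrite mulrDr; lra.
apply: le_trans X3 _; rewrite !mulr_sumr; apply: ler_sum => i _.
rewrite !mulr_sumr; apply: ler_sum => j _.
rewrite mulrC ler_wpM2r ?L2norm_ge0 //.
rewrite /C [leRHS]mulrDl lerDr mulr_ge0 ?(Phi0 i) //.
by rewrite addr_ge0 // mulr_ge0.
Qed.

End PressureIdentity.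

Section PressureBound.
Context {R : realType} {n : nat}.
Local Notation smfun := (smfun R n).
Implicit Types (f g : smfun).

Lemma L2norm_unif f (b : nat) : supported b%:R f ->
  exists2 B : R, 0 <= B & forall M, (b < M)%N -> L2norm M f <= B.
Proof.
move=> fb; have [C C0 HC] := supported_bounded fb.
exists (C * (2 * b + 1)%:R ^+ n) => [|M bM]; first by rewrite mulr_ge0 ?exprn_ge0.
exact: L2norm_cube.
Qed.

Lemma L2norm_unif_sum (I : finType) (G : I -> smfun) (b : nat) :
  (forall i, supported b%:R (G i)) ->
  exists2 B : R, 0 <= B & forall M, (b < M)%N -> \sum_i L2norm M (G i) <= B.
Proof.
move=> Gb; pose B i := s2val (cid2 (L2norm_unif (Gb i))).
have B0 i : 0 <= B i by rewrite /B; case: cid2.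
have HB i M : (b < M)%N -> L2norm M (G i) <= B i by rewrite /B; case: cid2 => ? ? h /h.
exists (\sum_i B i) => [|M bM]; first exact: sumr_ge0.
by apply: ler_sum => i _; exact: HB.
Qed.

Lemma box_margins (a b M : nat) : (a + b + 7 <= M)%N ->
  [/\ (b < M)%N, b%:R <= M%:R - 2 :> R, (a + 7 <= M)%N & a%:R <= M%:R - 2 :> R].
Proof.
by move=> h; split; rewrite ?lerBrDr -?natrD ?ler_nat; lia.
Qed.

Lemma D_lap c j f : D j (lap c f) = lap c (D j f).
Proof. by rewrite D_sum; apply: eq_bigr => i _; rewrite !sDE !DZ ![D j (D i _)]DC. Qed.

Definition pressure_const (K : R) : R :=
  (K * (4 + 6 * n%:R + 2 * n%:R ^+ 2 + 4 * n%:R) + 1 + 2 * K + (2 + 2 * n%:R) * K)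
  * (2 * (n%:R + 1) * (K + 1)).

Lemma pressure_const_ge0 K : 0 <= K -> 0 <= pressure_const K.
Proof.
by move=> K0; rewrite !mulr_ge0 ?addr_ge0 ?mulr_ge0 ?exprn_ge0 ?addr_ge0 ?mulr_ge0 ?exprn_ge0.
Qed.

(** The pressure estimate with the approximate resolvent put in. The box enters
    only through a threshold: all norms are bounded uniformly in it, so that the
    error of the resolvent can be chosen first. *)
Lemma pressure_bound (c : R) (u : 'I_n -> smfun) (F : 'I_n -> 'I_n -> smfun)
    (p : smfun) (nu : R) (phi chi H : smfun) (K : R) (b : nat) (eps : R) :
  0 < c -> 0 <= nu -> 0 <= K -> 0 < eps ->
  \sum_j sD c j (u j) = 0 ->
  (forall i, sD c i p = smcst nu * lap c (u i) - \sum_j sD c j (F i j)) ->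
  (chi - 1) * phi = 0 -> (H - 1) * chi = 0 ->
  supported b%:R phi -> supported b%:R chi -> supported b%:R H ->
  (forall x, `|phi x| <= K) /\ (forall j x, `|sD c j phi x| <= K) ->
  [/\ forall x, `|chi x| <= K, forall j x, `|sD c j chi x| <= K,
    forall j k x, `|sD c j (sD c k chi) x| <= K & forall x, `|lap c chi x| <= K] ->
  (forall j x, `|lap c (sD c j chi) x| <= K) ->
  exists M0 : nat, forall M, (M0 <= M)%N ->
    `|\sum_i Int M (sD c i p * (phi * u i))| <=
    pressure_const K * (\sum_i L2norm M (H * u i)) *
      (nu * \sum_i L2norm M (H * u i) + \sum_i \sum_j L2norm M (H * F i j)) + eps.
Proof.
move=> c0 nu0 K0 e0 div_u momentum chi_phi H_chi phi_b chi_b H_b phi_K chi_K Ldchi_K.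
have [BU BU0 HBU] := @L2norm_unif_sum 'I_n (fun i => H * u i) b (fun i => @supported_mull _ _ _ _ _ H_b).
have [BF BF0 HBF] := @L2norm_unif_sum ('I_n * 'I_n)%type (fun ij => H * F ij.1 ij.2) b
  (fun i => @supported_mull _ _ _ _ _ H_b).
have [BP BP0 HBP] := @L2norm_unif_sum 'I_n (fun i => chi * sD c i p) b (fun i => @supported_mull _ _ _ _ _ chi_b).
set C := pressure_const K; have C0 : 0 <= C by exact: pressure_const_ge0.
pose delta := eps / (C * (nu * BU + BF) + BP + 1).
have Q0 : 0 < C * (nu * BU + BF) + BP + 1.
  by rewrite ltr_wpDl // addr_ge0 // mulr_ge0 // addr_ge0 // mulr_ge0.
have d0 : 0 < delta by rewrite divr_gt0.
pose dd := Num.min delta (delta / c).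
have dd0 : 0 < dd by rewrite lt_min d0 divr_gt0.
pose f i : smfun := phi * u i.
(* the resolvent has to be accurate on the fields and on their derivatives *)
pose fs := [seq f i | i <- enum 'I_n] ++ [seq D j (f i) | i <- enum 'I_n, j <- enum 'I_n].
have f_in i : f i \in fs by rewrite mem_cat map_f ?mem_enum.
have df_in i j : D j (f i) \in fs.
  rewrite mem_cat; apply/orP; right; apply/allpairsP.
  by exists (i, j); rewrite !mem_enum.
have fs_b g : g \in fs -> supported b%:R g.
  rewrite mem_cat => /orP[/mapP[i _ ->]|/allpairsP[[i j] [_ _ ->]]] /=.
    exact: supported_mull.
  by apply: supported_D; exact: supported_mull.
have [G [M0 [GD Gs Gr]]] := resolvent c0 dd0 fs_b.
pose N i : smfun := G (f i).
pose r i : smfun := N i - lap c (N i) - f i.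
exists (M0 + b + 7)%N => M MM.
have [bM b2 Mb M2] := @box_margins M0 b M MM.
have rd i : L2norm M (r i) <= delta.
  by apply: le_trans (Gr _ (f_in i) M Mb) _; rewrite ge_min lexx.
have drd j i : L2norm M (sD c j (r i)) <= delta.
  have -> : sD c j (r i) = smcst c * (G (D j (f i)) - lap c (G (D j (f i))) - D j (f i)).
    by rewrite sDE /r !DB D_lap /N GD.
  rewrite L2normZ gtr0_norm // mulrC -ler_pdivlMr //.
  by apply: le_trans (Gr _ (df_in i j) M Mb) _; rewrite ge_min lexx orbT.
have H_phi : (H - 1) * phi = 0.
  transitivity ((H - 1) * chi * phi - (H - 1) * ((chi - 1) * phi)); first by ring.
  by rewrite H_chi chi_phi mul0r mulr0 subr0.
set U := \sum_i L2norm M (H * u i); set FF := \sum_i \sum_j L2norm M (H * F i j).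
have U0 : 0 <= U by apply: sumr_ge0 => i _; exact: L2norm_ge0.
have F0 : 0 <= FF by apply: sumr_ge0 => i _; apply: sumr_ge0 => j _; exact: L2norm_ge0.
have UB : U <= BU by exact: HBU.
have FB : FF <= BF by rewrite /FF pair_big; exact: HBF.
have N_eq i : N i - lap c (N i) = phi * u i + r i by rewrite /r /f; ring.
have Hu i : L2norm M (H * u i) <= U + delta.
  rewrite /U (bigD1 i) //= -addrA lerDl addr_ge0 ?(ltW d0) //.
  by apply: sumr_ge0 => j _; exact: L2norm_ge0.
have dU : delta <= U + delta by rewrite lerDr.
have E := pressure_estimate div_u momentum chi_phi H_chi
  (supported_weak b2 chi_b) N_eq H_phi (fun i => supported_weak M2 (Gs _ (f_in i))) K0 phi_K chi_K
  Ldchi_K Hu (fun i => le_trans (rd i) dU) (fun j i => le_trans (drd j i) dU) erefl nu0.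
apply: le_trans E _.
have -> : (K * (4 + 6 * n%:R + 2 * n%:R ^+ 2 + 4 * n%:R) + 1 + 2 * K + (2 + 2 * n%:R) * K) *
  (2 * (n%:R + 1) * (K + 1) * (U + delta)) * (nu * U + FF)
  = C * U * (nu * U + FF) + C * delta * (nu * U + FF).
  by rewrite /C /pressure_const; ring.
rewrite -addrA lerD2l.
have S : \sum_i L2norm M (r i) * L2norm M (chi * sD c i p) <= delta * BP.
  apply: le_trans (_ : delta * \sum_i L2norm M (chi * sD c i p) <= _); last first.
    by rewrite ler_wpM2l ?(ltW d0) // HBP.
  by rewrite mulr_sumr; apply: ler_sum => i _; rewrite ler_wpM2r ?L2norm_ge0.
apply: le_trans (lerD (lexx _) S) _.
have -> : eps = delta * (C * (nu * BU + BF) + BP + 1) by rewrite /delta divfK ?gt_eqF.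
have X : nu * U + FF <= nu * BU + BF by rewrite lerD // ler_wpM2l.
have Y : C * delta * (nu * U + FF) <= delta * (C * (nu * BU + BF)).
  by rewrite mulrAC mulrC ler_wpM2l ?(ltW d0) // ler_wpM2l.
by apply: le_trans (lerD Y (lexx _)) _; rewrite -mulrDr ler_wpM2l ?(ltW d0) // lerDl.
Qed.

End PressureBound.

(** * Rescaled cutoffs and weighted volumes *)

Section Rescaling.
Context {R : realType} {n : nat}.
Local Notation V := 'rV[R]_n.
Local Notation smfun := (smfun R n).
Implicit Types (f g : smfun) (rho M : nat) (x : V).

(** Radii are cubes, which turns |x|^(-2/3) into an integer power of rho. *)
Definition cube_radius rho : R := rho%:R ^+ 3.

Definition rescale rho f : smfun := aff (cube_radius rho)^-1 0 f.

Lemma cube_radius_gt0 rho : (0 < rho)%N -> 0 < cube_radius rho.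
Proof. by move=> r0; rewrite exprn_gt0 // ltr0n. Qed.

Lemma rescaleE rho f x : rescale rho f x = f ((cube_radius rho)^-1 *: x).
Proof. by rewrite affE addr0. Qed.

Lemma rescaleM rho f g : rescale rho (f * g) = rescale rho f * rescale rho g.
Proof. exact: smext. Qed.

Lemma rescale_zero rho f g : (f - 1) * g = 0 -> (rescale rho f - 1) * rescale rho g = 0.
Proof.
move=> h; apply: smext => x.
have := congr1 (fun k : smfun => k ((cube_radius rho)^-1 *: x)) h.
by rewrite !(smM, smD, smN, sm1, rescaleE).
Qed.

Lemma D_rescale rho (i : 'I_n) f : D i (rescale rho f) = smcst (cube_radius rho)^-1 * rescale rho (D i f).
Proof. exact: D_aff. Qed.

Lemma sD_rescale rho (i : 'I_n) f : (0 < rho)%N -> sD (cube_radius rho) i (rescale rho f) = rescale rho (D i f).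
Proof.
move=> r0; rewrite sDE D_rescale mulrA -rmorphM mulfV ?gt_eqF ?cube_radius_gt0 //.
by rewrite rmorph1 mul1r.
Qed.

Lemma lap_rescale rho f : (0 < rho)%N -> lap (cube_radius rho) (rescale rho f) = rescale rho (lap 1 f).
Proof.
move=> r0; rewrite lap1 /lap; apply: smext => x; rewrite rescaleE !sm_sum.
by apply: eq_bigr => i _; rewrite !sD_rescale // rescaleE.
Qed.

Lemma supported_rescale rho (r : R) f : (0 < rho)%N -> supported r f -> supported (cube_radius rho * r) (rescale rho f).
Proof.
move=> r0 fr x xr; rewrite rescaleE; apply: fr.
by rewrite normrZ gtr0_norm ?invr_gt0 ?cube_radius_gt0 // mulrC ltr_pdivlMr ?cube_radius_gt0 // mulrC.
Qed.

Lemma common_bound (J : finType) (r : R) (G : J -> smfun) : (forall i, supported r (G i)) ->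
  exists2 K : R, 0 <= K & forall i x, `|G i x| <= K.
Proof.
move=> Gr; pose B i := s2val (cid2 (supported_bounded (Gr i))).
have B0 i : 0 <= B i by rewrite /B; case: cid2.
have HB i x : `|G i x| <= B i by rewrite /B; case: cid2 => ? ? h /=.
exists (\sum_i B i) => [|i x]; first exact: sumr_ge0.
by rewrite (le_trans (HB i x)) // (bigD1 i) //= lerDl sumr_ge0.
Qed.

Lemma r2_scale (c : R) x : r2 (c *: x) = c ^+ 2 * r2 x.
Proof.
rewrite !r2E mulr_sumr; apply: eq_bigr => i _.
by rewrite mxE exprMn.
Qed.

Lemma norm_sqr_le_r2 x : `|x| ^+ 2 <= r2 x.
Proof.
rewrite -[leRHS]sqr_sqrtr ?r2_ge0 // ler_pXn2r ?nnegrE ?sqrtr_ge0 //.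
apply: norm_le_coord; first exact: sqrtr_ge0.
move=> i; rewrite -sqrtr_sqr ler_wsqrtr // r2E (bigD1 i) //= lerDl.
by apply: sumr_ge0 => j _; exact: sqr_ge0.
Qed.

Lemma supported_of_r2 (r : R) f : 0 <= r -> (forall x, r ^+ 2 <= r2 x -> f x = 0) -> supported r f.
Proof.
move=> r0 h x rx; apply: h; apply: le_trans (norm_sqr_le_r2 x).
by rewrite ler_pXn2r ?nnegrE // ltW.
Qed.

(** A third cutoff, equal to 1 on the support of plateau; its square dominates
    everything that is supported where bumpfun is. *)
Definition outer : smfun := aff (1 / 2) 0 plateau.

Lemma outer1 x : r2 x <= 4 -> outer x = 1.
Proof.
move=> h; rewrite affE addr0 plateau1 // r2_scale expr_div_n expr1n; lra.
Qed.

Lemma outer0 x : 8 <= r2 x -> outer x = 0.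
Proof.
move=> h; rewrite affE addr0 plateau0 // r2_scale expr_div_n expr1n; lra.
Qed.

Lemma supported_bump : supported 4%:R (bumpfun : smfun).
Proof. by apply: supported_of_r2 => // x h; rewrite bump_eq0 //; lra. Qed.
Lemma supported_plateau : supported 4%:R (plateau : smfun).
Proof. by apply: supported_of_r2 => // x h; rewrite plateau0 //; lra. Qed.
Lemma supported_outer : supported 4%:R (outer : smfun).
Proof. by apply: supported_of_r2 => // x h; rewrite outer0 //; lra. Qed.

Lemma plateau_bump : (plateau - 1) * bumpfun = 0 :> smfun.
Proof.
apply: smext => x; rewrite smM smD smN sm1 sm0.
have [h|h] := lerP 1 (r2 x); first by rewrite bump_eq0 // mulr0.
by rewrite plateau1 ?subrr ?mul0r // ltW.
Qed.

Lemma outer_plateau : (outer - 1) * plateau = 0 :> smfun.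
Proof.
apply: smext => x; rewrite smM smD smN sm1 sm0.
have [h|h] := lerP 2 (r2 x); first by rewrite plateau0 // mulr0.
by rewrite outer1 ?subrr ?mul0r //; lra.
Qed.

Lemma outer_bump : (outer - 1) * bumpfun = 0 :> smfun.
Proof.
transitivity ((outer - 1) * plateau * bumpfun - (outer - 1) * ((plateau - 1) * bumpfun)).
  by ring.
by rewrite outer_plateau plateau_bump mul0r mulr0 subr0.
Qed.

Definition dominated (K : R) f := forall x, `|f x| <= K * (outer x * outer x).

Lemma dominatedI (K : R) f : (outer - 1) * f = 0 -> (forall x, `|f x| <= K) -> dominated K f.
Proof.
move=> fo fK y; have := congr1 (fun h : smfun => h y) fo.
rewrite smM smD smN sm1 sm0 => /eqP; rewrite mulf_eq0 => /orP[|/eqP ->].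
  by rewrite subr_eq0 => /eqP ->; rewrite !mulr1.
by rewrite normr0 -expr2 mulr_ge0 ?sqr_ge0 // (le_trans _ (fK y)).
Qed.

Lemma dominated_rescale (K : R) f g rho : dominated K f ->
  forall x, `|(rescale rho f * g) x| <= (smcst K * rescale rho (outer * outer)) x * `|g x|.
Proof. by move=> fK x; rewrite !smM smcstE !rescaleE smM normrM ler_wpM2r. Qed.

Lemma Int_abs_le M f g : (forall x, `|f x| <= g x) -> `|Int M f| <= Int M g.
Proof.
move=> fg; rewrite ler_norml -IntN; apply/andP; split; apply: Int_le => x _.
  by rewrite smN lerNl; apply: le_trans (fg x); rewrite -normrN ler_norm.
by apply: le_trans (fg x); exact: ler_norm.
Qed.

Lemma D_outer2_zero (i : 'I_n) x : r2 x < 1 -> D i (outer * outer) x = 0.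
Proof.
move=> x1; have : (outer * outer - 1) * bumpfun = 0 :> smfun.
  transitivity ((outer + 1) * ((outer - 1) * bumpfun) : smfun); first by ring.
  by rewrite outer_bump mulr0.
move=> /(sD_zero 1 i); rewrite sDE DB -(rmorph1 smcst) D_cst subr0 rmorph1 mul1r.
move=> /(congr1 (fun h : smfun => h x)); rewrite smM sm0 => /eqP.
by rewrite mulf_eq0 (gt_eqF (bump_gt0 x1)) orbF => /eqP.
Qed.

Lemma D_X_weight (i : 'I_n) (k : nat) : smcst 3 * D i (X i * weight ^+ k) =
  smcst 3 * weight ^+ k - smcst (2 * k%:R) * (X i * X i * weight ^+ (k + 3)) :> smfun.
Proof.
have DX : smcst 3 * D i (weight ^+ k) = - smcst (2 * k%:R) * X i * weight ^+ (k + 3) :> smfun.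
  elim: k => [|k IH].
    by rewrite expr0 -(rmorph1 smcst) D_cst !mulr0 rmorph0 oppr0 !mul0r.
  transitivity (smcst 3 * D i weight * weight ^+ k + weight * (smcst 3 * D i (weight ^+ k)) : smfun).
    by rewrite exprS DM; ring.
  rewrite IH D_weight.
  rewrite -[k.+1%:R]natr1 mulrDr mulr1 rmorphD addSn !exprS exprD !exprS expr0; ring.
transitivity (smcst 3 * weight ^+ k + X i * (smcst 3 * D i (weight ^+ k)) : smfun).
  by rewrite DM D_X eqxx mulr1n; ring.
by rewrite DX; ring.
Qed.

End Rescaling.

Section WeightedIntegrals.
Context {R : realType}.
Local Notation V := 'rV[R]_3.
Local Notation smfun := (smfun R 3).
Implicit Types (f g : smfun) (i j : 'I_3) (rho M : nat) (x : V).

Lemma weight_r2 x : weight x ^+ 3 * (1 + r2 x) = 1.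
Proof.
by have := congr1 (fun h : smfun => h x) weight_cube; rewrite smM smX smD sm1.
Qed.

Lemma div_X_weight (k : nat) : smcst 3 * (\sum_i D i (X i * weight ^+ k)) =
  smcst (9 - 2 * k%:R) * weight ^+ k + smcst (2 * k%:R) * weight ^+ (k + 3) :> smfun.
Proof.
rewrite mulr_sumr (eq_bigr _ (fun i _ => D_X_weight i k)) sumrB sumr_const card_ord.
rewrite -mulr_sumr -mulr_suml (_ : \sum_i X i * X i = r2); last by rewrite r2.unlock.
apply: smext => x; rewrite !(smD, smN, smM, smcstE, smX, smMn).
have E := weight_r2 x; rewrite exprD.
have -> : r2 x * (weight x ^+ k * weight x ^+ 3) = weight x ^+ k * (1 - weight x ^+ 3).
  by rewrite -E; ring.
ring.
Qed.

Lemma weight_le_inv rho x : (0 < rho)%N -> 1 <= r2 ((cube_radius rho)^-1 *: x) ->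
  weight x * rho%:R ^+ 2 <= 1.
Proof.
move=> r0; have rR : 0 < rho%:R :> R by rewrite ltr0n.
rewrite r2_scale exprVn mulrC ler_pdivlMr ?exprn_gt0 ?cube_radius_gt0 // mul1r => h.
have w0 := weight_gt0 x.
rewrite -(ler_pXn2r (n := 3)) ?nnegrE //; last by rewrite mulr_ge0 ?exprn_ge0 ?ltW.
rewrite expr1n exprMn -exprM -[leRHS](weight_r2 x) ler_wpM2l ?exprn_ge0 ?(ltW w0) //.
by move: h; rewrite /cube_radius -exprM => h; apply: le_trans h _; rewrite lerDr.
Qed.

(** The homogeneous bound for weighted volumes, by integrating by parts
    div (x weight^k) >= weight^k / 3; the boundary term lives where |x| is of
    the size of the radius. *)
Lemma weight_integral (k : nat) : (k <= 4)%N ->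
  exists2 C : R, 0 <= C & forall rho M, (0 < rho)%N -> (4 * rho ^ 3 + 2 <= M)%N ->
    Int M (rescale rho (outer * outer) * weight ^+ k : smfun) <= C * rho%:R ^+ (9 - 2 * k).
Proof.
move=> k4.
have sO : supported 4%:R (outer * outer : smfun) by apply: supported_mull; exact: supported_outer.
have [K K0 HK] := @common_bound R 3 _ 4%:R (fun i => D i (outer * outer) * X i)
  (fun i => @supported_mull _ _ _ _ _ (@supported_D _ _ _ i _ sO)).
exists (9 * K * 9 ^+ 3) => [|rho M r0 rM]; first by rewrite !mulr_ge0.
have rR : 0 < rho%:R :> R by rewrite ltr0n.
have R0 : 0 < cube_radius rho :> R by exact: cube_radius_gt0.
set T : smfun := rescale rho (outer * outer).
have Ts : supported (4 * rho ^ 3)%N%:R T.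
  by rewrite natrM natrX mulrC; exact: supported_rescale.
have Ts2 : supported (M%:R - 2) T.
  by apply: supported_weak Ts; rewrite lerBrDr -natrD ler_nat.
have T0 x : 0 <= T x by rewrite rescaleE smM -expr2 sqr_ge0.
have I1 : Int M (T * weight ^+ k) <= 3 * Int M (T * (\sum_i D i (X i * weight ^+ k))).
  rewrite -IntZ mulrCA div_X_weight; apply: Int_le => x _.
  rewrite !(smM, smD, smcstE, smX) ler_wpM2l //.
  have w0 := weight_gt0 x.
  have kR : k%:R <= 4 :> R by rewrite ler_nat.
  have wk : 0 <= weight x ^+ k by rewrite exprn_ge0 ?ltW.
  have wk3 : 0 <= 2 * k%:R * weight x ^+ (k + 3).
    apply: mulr_ge0; first by apply: mulr_ge0.
    by rewrite exprn_ge0 // ltW.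
  nra.
have I2 : Int M (T * (\sum_i D i (X i * weight ^+ k))) =
    Int M (- \sum_i (D i T * X i * weight ^+ k)).
  rewrite mulr_sumr -sumrN !Int_sum; apply: eq_bigr => i _.
  rewrite mulrC IBP; last exact: supported_mulr.
  by rewrite -IntN; congr Int; ring.
have I3 : Int M (- \sum_i (D i T * X i * weight ^+ k)) <=
    (3 * K * rho%:R ^- (2 * k)) * (2 * (4 * rho ^ 3) + 1)%N%:R ^+ 3.
  have b x : `|(\sum_i D i T * X i * weight ^+ k) x| <= 3 * K * rho%:R ^- (2 * k).
    rewrite sm_sum; apply: le_trans (ler_norm_sum _ _ _) _.
    apply: le_trans (_ : \sum_(i < 3) (K * rho%:R ^- (2 * k)) <= _); last first.
      by rewrite sumr_const card_ord -mulrA mulr_natl.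
    apply: ler_sum => i _; rewrite D_rescale !smM smcstE rescaleE smX XE.
    set y := _ *: x; have -> : x 0 i = cube_radius rho * y 0 i by rewrite mxE mulVKf ?gt_eqF.
    have [y1|y1] := ltrP (r2 y) 1.
      by rewrite D_outer2_zero // mulr0 !mul0r normr0 mulr_ge0 // invr_ge0 exprn_ge0.
    rewrite mulrACA mulVf ?gt_eqF // mul1r normrM.
    apply: ler_pM => //; first by have := HK i y; rewrite smM XE.
    have w0 := weight_gt0 x.
    have wr := weight_le_inv r0 y1.
    rewrite ger0_norm ?exprn_ge0 ?(ltW w0) // -[leRHS]mul1r ler_pdivlMr ?exprn_gt0 //.
    by rewrite exprM -exprMn exprn_ile1 // mulr_ge0 ?exprn_ge0 ?(ltW w0) // ltW.
  apply: Int_le_cube.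
  - by rewrite !mulr_ge0 // invr_ge0 exprn_ge0.
  - by lia.
  - by move=> x; apply: le_trans (b x); rewrite smN -normrN ler_norm.
  - move=> x xr; rewrite smN sm_sum big1 ?oppr0 // => i _.
    by rewrite smM smM (@supported_D _ _ _ i _ Ts) // !mul0r.
rewrite (le_trans I1) // I2.
apply: le_trans (ler_wpM2l _ I3) _; first by [].
have -> : 9 * K * 9 ^+ 3 * rho%:R ^+ (9 - 2 * k) =
   3 * (3 * K * rho%:R ^- (2 * k) * (9 * rho%:R ^+ 3) ^+ 3) :> R.
  have -> : rho%:R ^+ (9 - 2 * k) = rho%:R ^+ 9 * rho%:R ^- (2 * k) :> R.
    by rewrite expfB_cond ?gt_eqF //=; lia.
  by rewrite exprMn -exprM; ring.
rewrite ler_pM2l // ler_wpM2l //; first by rewrite !mulr_ge0 // invr_ge0 exprn_ge0.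
rewrite ler_pXn2r ?nnegrE ?mulr_ge0 ?exprn_ge0 // -natrX -natrM ler_nat.
have : (1 <= rho ^ 3)%N by rewrite expn_gt0 r0.
by lia.
Qed.

End WeightedIntegrals.

(** * Decay and growth *)

Section Vanishing.
Context {R : realType}.
Implicit Types (a b : nat -> nat -> R) (rho M : nat).

(* Boxes with room for all cutoffs of the given radius. *)
Definition good rho M := (0 < rho)%N && (4 * rho ^ 3 + 2 <= M)%N.

(** The upper limit of a over large radii, each seen in large boxes, is <= 0. *)
Definition vanishing a := forall e : R, 0 < e -> exists rho0 : nat, forall rho,
  (rho0 <= rho)%N -> exists M0 : nat, forall M, (M0 <= M)%N -> a rho M <= e.

Lemma vanishing_le a b : (forall rho M, good rho M -> a rho M <= b rho M) ->
  vanishing b -> vanishing a.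
Proof.
move=> ab hb e /hb[rho0 H]; exists rho0.+1 => rho rr.
have [M0 HM] := H rho (ltnW rr); exists (M0 + (4 * rho ^ 3 + 2))%N => M MM.
apply: le_trans (HM M _); last exact: leq_trans (leq_addr _ _) MM.
apply: ab; rewrite /good (leq_trans _ rr) //.
exact: leq_trans (leq_addl _ _) MM.
Qed.

Lemma vanishingD a b : vanishing a -> vanishing b ->
  vanishing (fun rho M => a rho M + b rho M).
Proof.
move=> ha hb e e0; have e2 : 0 < e / 2 by rewrite divr_gt0.
have [r1 H1] := ha _ e2; have [r2 H2] := hb _ e2.
exists (r1 + r2)%N => rho rr.
have [M1 K1] := H1 rho (leq_trans (leq_addr _ _) rr).
have [M2 K2] := H2 rho (leq_trans (leq_addl _ _) rr).
exists (M1 + M2)%N => M MM; rewrite [leRHS]splitr; apply: lerD.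
  exact/K1/(leq_trans (leq_addr _ _) MM).
exact/K2/(leq_trans (leq_addl _ _) MM).
Qed.

Lemma vanishing0 : vanishing (fun _ _ => 0).
Proof. by move=> e e0; exists 0%N => rho _; exists 0%N => M _; exact: ltW. Qed.

Lemma vanishing_sum (J : Type) (s : seq J) (P : pred J) (F : J -> nat -> nat -> R) :
  (forall i, vanishing (F i)) -> vanishing (fun rho M => \sum_(i <- s | P i) F i rho M).
Proof.
move=> hF; elim: s => [|i s IH].
  by apply: vanishing_le vanishing0 => rho M _; rewrite big_nil.
case Pi : (P i).
  by apply: vanishing_le (vanishingD (hF i) IH) => rho M _; rewrite big_cons Pi.
by apply: vanishing_le IH => rho M _; rewrite big_cons Pi.
Qed.

Lemma vanishingZ (c : R) a : 0 <= c -> vanishing a -> vanishing (fun rho M => c * a rho M).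
Proof.
move=> c0 ha e e0; have cp : 0 < c + 1 by rewrite ltr_wpDl.
have [r1 H1] := ha (e / (c + 1)) (divr_gt0 e0 cp).
exists r1 => rho /H1[M0 HM]; exists M0 => M /HM h.
apply: le_trans (ler_wpM2l c0 h) _.
by rewrite mulrA ler_pdivrMr // mulrC ler_pM2l // lerDl.
Qed.

Lemma vanishing_intro a :
  (forall e : R, 0 < e -> exists2 C : R, 0 <= C & forall rho M, good rho M ->
     a rho M <= e + C / rho%:R) -> vanishing a.
Proof.
move=> h e e0; have e2 : 0 < e / 2 by rewrite divr_gt0.
have [C C0 HC] := h _ e2.
have /truncn_itv/andP[_ t1] : 0 <= C / (e / 2) by rewrite divr_ge0 // ltW.
exists (Num.truncn (C / (e / 2))).+1 => rho rr.
have rp : (0 < rho)%N by exact: leq_ltn_trans rr.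
exists (4 * rho ^ 3 + 2)%N => M MM.
apply: le_trans (HC rho M _) _; first by rewrite /good rp.
rewrite [leRHS]splitr lerD2l ler_pdivrMr ?ltr0n // mulrC -ler_pdivrMr //.
by rewrite (le_trans (ltW t1)) // ler_nat.
Qed.

End Vanishing.

Section Decay.
Context {R : realType}.
Local Notation V := 'rV[R]_3.
Local Notation smfun := (smfun R 3).
Implicit Types (f g h : smfun) (rho M : nat) (x : V) (k : nat).

Local Notation w x := (@weight R 3 x).

(** The two decay classes, relative to powers of the weight
    (1 + |x|^2)^(-1/3), that is of |x|^(-2/3). The second term in the little-o
    class absorbs a ball, so that the bound holds on the whole space and can be
    integrated. *)
Definition bigO_weight k g := exists2 C : R, 0 <= C & forall x, `|g x| <= C * w x ^+ k.
Definition littleo_weight k g := forall e : R, 0 < e ->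
  exists2 C : R, 0 <= C & forall x, `|g x| <= e * w x ^+ k + C * w x ^+ k.+1.

Lemma weight_le1 x : w x <= 1.
Proof.
have w0 := weight_gt0 x; rewrite -(ler_pXn2r (n := 3)) ?nnegrE ?(ltW w0) // expr1n.
rewrite -[leRHS](weight_r2 x) ler_peMr ?exprn_ge0 ?(ltW w0) // lerDl.
exact: r2_ge0.
Qed.

Lemma littleo_bigO k g : littleo_weight k g -> bigO_weight k g.
Proof.
move=> /(_ 1 ltr01)[C C0 HC]; exists (1 + C) => [|x]; first by rewrite addr_ge0.
apply: le_trans (HC x) _; rewrite mulrDl lerD2l ler_wpM2l //.
have w0 := weight_gt0 x.
by rewrite exprS ler_piMl ?exprn_ge0 ?(ltW w0) // weight_le1.
Qed.

Lemma bigO_weak k l g : (k <= l)%N -> bigO_weight l g -> bigO_weight k g.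
Proof.
move=> kl [C C0 HC]; exists C => // x; apply: le_trans (HC x) _.
have w0 := weight_gt0 x.
by rewrite ler_wpM2l // ler_wiXn2l ?weight_le1 ?(ltW w0).
Qed.

Lemma bigOM k l g h : bigO_weight k g -> bigO_weight l h -> bigO_weight (k + l) (g * h).
Proof.
move=> [C C0 HC] [C' C'0 HC']; exists (C * C') => [|x]; first exact: mulr_ge0.
by rewrite smM normrM exprD mulrACA ler_pM.
Qed.

Lemma littleoM k l g h : littleo_weight k g -> bigO_weight l h ->
  littleo_weight (k + l) (g * h).
Proof.
move=> hg [C C0 HC] e e0; have cp : 0 < C + 1 by rewrite ltr_wpDl.
have [C' C'0 HC'] := hg (e / (C + 1)) (divr_gt0 e0 cp).
exists (C' * C) => [|x]; first exact: mulr_ge0.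
have w0 := ltW (weight_gt0 x).
rewrite smM normrM; apply: le_trans (ler_pM _ _ (HC' x) (HC x)) _ => //.
rewrite mulrDl mulrACA -exprD mulrACA -exprD addSn lerD2r ler_wpM2r ?exprn_ge0 //.
by rewrite mulrAC ler_pdivrMr // ler_pM2l // lerDl.
Qed.

Lemma littleoMC k l g h : bigO_weight k g -> littleo_weight l h ->
  littleo_weight (k + l) (g * h).
Proof. by move=> hg hh; rewrite addnC mulrC; exact: littleoM. Qed.

Lemma bigOD k g h : bigO_weight k g -> bigO_weight k h -> bigO_weight k (g + h).
Proof.
move=> [C C0 HC] [C' C'0 HC']; exists (C + C') => [|x]; first exact: addr_ge0.
by rewrite smD mulrDl (le_trans (ler_normD _ _)) // lerD.
Qed.

Lemma weight_int k : (k <= 4)%N -> exists2 C : R, 0 <= C & forall rho M, good rho M ->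
  Int M (rescale rho (outer * outer) * weight ^+ k : smfun) <= C * rho%:R ^+ (9 - 2 * k).
Proof.
move=> k4; have [C C0 HC] := @weight_integral R k k4; exists C => // rho M /andP[]; exact: HC.
Qed.

Lemma rescale_outer2_ge0 rho x : 0 <= (rescale rho (outer * outer) : smfun) x.
Proof. by rewrite rescaleE smM -expr2 sqr_ge0. Qed.

(** The volume rho^9 of the ball of radius rho^3 times the decay rho^(-2k). *)
Lemma Int_cutoff_bigO k (psi : smfun) (K : R) g : (k <= 4)%N -> 0 <= K ->
  dominated K psi -> bigO_weight k g ->
  exists2 C : R, 0 <= C & forall rho M, good rho M ->
    `|Int M (rescale rho psi * g)| <= C * rho%:R ^+ (9 - 2 * k).
Proof.
move=> k4 K0 pK [C C0 HC]; have [C1 C10 HC1] := weight_int k4.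
exists (K * C * C1) => [|rho M gr]; first by rewrite !mulr_ge0.
apply: le_trans (Int_abs_le (g := smcst (K * C) *
   (rescale rho (outer * outer) * weight ^+ k)) M _) _ => [x|].
  apply: le_trans (dominated_rescale g rho pK x) _.
  move: (rescale_outer2_ge0 rho x); move: (rescale rho (outer * outer)) => T T0.
  by rewrite !smM !smcstE smX -!mulrA ler_wpM2l // mulrCA ler_wpM2l.
by rewrite IntZ -[leRHS]mulrA ler_wpM2l ?mulr_ge0 // HC1.
Qed.

Lemma Int_cutoff_littleo k (psi : smfun) (K : R) g : (k < 4)%N -> 0 <= K ->
  dominated K psi -> littleo_weight k g ->
  forall e : R, 0 < e -> exists2 C : R, 0 <= C & forall rho M, good rho M ->
    `|Int M (rescale rho psi * g)| <= e * rho%:R ^+ (9 - 2 * k) + C * rho%:R ^+ (9 - 2 * k.+1).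
Proof.
move=> k4 K0 pK hg e e0; have [C1 C10 HC1] := weight_int (ltnW k4).
have [C2 C20 HC2] := weight_int k4.
have Kp : 0 < K * C1 + 1 by rewrite ltr_wpDl // mulr_ge0.
have [e' e'p Ke'] : exists2 e' : R, 0 < e' & K * e' * C1 <= e.
  exists (e / (K * C1 + 1)); first exact: divr_gt0.
  by rewrite mulrAC mulrA ler_pdivrMr // mulrC ler_pM2l // lerDl.
have e'0 := ltW e'p; have [C C0 HC] := hg e' e'p.
exists (K * C * C2) => [|rho M gr]; first by rewrite !mulr_ge0.
apply: le_trans (Int_abs_le (g := smcst (K * e') * (rescale rho (outer * outer) * weight ^+ k)
  + smcst (K * C) * (rescale rho (outer * outer) * weight ^+ k.+1)) M _) _ => [x|].
  apply: le_trans (dominated_rescale g rho pK x) _.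
  move: (rescale_outer2_ge0 rho x); move: (rescale rho (outer * outer)) => T T0.
  rewrite smD !smM !smcstE !smX -!mulrA -mulrDr ler_wpM2l //.
  by rewrite [e' * _]mulrCA [C * (_ * _)]mulrCA -mulrDr ler_wpM2l.
rewrite IntD !IntZ; apply: lerD; last first.
  by rewrite -[leRHS]mulrA ler_wpM2l ?mulr_ge0 // HC2.
apply: le_trans (ler_wpM2l _ (HC1 rho M gr)) _; first exact: mulr_ge0.
by rewrite mulrA ler_wpM2r ?exprn_ge0.
Qed.

Definition growth k (a : nat -> nat -> R) := exists2 C : R, 0 <= C &
  forall rho M, good rho M -> a rho M <= C * rho%:R ^+ k.
Definition growth_o k l (a : nat -> nat -> R) := forall e : R, 0 < e ->
  exists2 C : R, 0 <= C & forall rho M, good rho M ->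
    a rho M <= e * rho%:R ^+ k + C * rho%:R ^+ l.

Lemma growth_sum (J : finType) k (a : J -> nat -> nat -> R) : (forall i, growth k (a i)) ->
  growth k (fun rho M => \sum_i a i rho M).
Proof.
move=> ha; pose C i := s2val (cid2 (ha i)).
have C0 i : 0 <= C i by rewrite /C; case: cid2.
have HC i rho M : good rho M -> a i rho M <= C i * rho%:R ^+ k.
  by rewrite /C; case: cid2 => ? ? h /=; exact: h.
exists (\sum_i C i) => [|rho M gr]; first exact: sumr_ge0.
by rewrite mulr_suml; apply: ler_sum => i _; exact: HC.
Qed.

Lemma growth_o_sum (J : finType) k l (a : J -> nat -> nat -> R) :
  (forall i, growth_o k l (a i)) -> growth_o k l (fun rho M => \sum_i a i rho M).
Proof.
move=> ha e e0; have J0 : 0 < #|J|%:R + 1 :> R by rewrite ltr_wpDl.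
pose e' := e / (#|J|%:R + 1); have e'0 : 0 < e' by rewrite divr_gt0.
pose C i := s2val (cid2 (ha i e' e'0)).
have C0 i : 0 <= C i by rewrite /C; case: cid2.
have HC i rho M : good rho M -> a i rho M <= e' * rho%:R ^+ k + C i * rho%:R ^+ l.
  by rewrite /C; case: cid2 => ? ? h /=; exact: h.
exists (\sum_i C i) => [|rho M gr]; first exact: sumr_ge0.
apply: le_trans (ler_sum _ (fun i _ => HC i rho M gr)) _.
rewrite big_split /= -[X in _ + X <= _]mulr_suml sumr_const lerD2r -[X in X <= _]mulr_natl mulrA.
rewrite ler_wpM2r ?exprn_ge0 // /e' mulrA ler_pdivrMr // mulrC ler_pM2l //.
by rewrite lerDl.
Qed.

Lemma L2norm_outer_sqr g rho M : L2norm M (rescale rho outer * g) ^+ 2 =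
  Int M (rescale rho (outer * outer) * (g * g)).
Proof. by rewrite L2norm_sqr rescaleM mulrACA. Qed.

Lemma dominated_outer2 : dominated 1 (outer * outer : smfun).
Proof. by move=> x; rewrite smM mul1r ger0_norm // -expr2 sqr_ge0. Qed.

Lemma L2_growth g : bigO_weight 2 g ->
  growth 1 (fun rho M => L2norm M (rescale rho outer * g) ^+ 2).
Proof.
move=> hg; have [C C0 HC] := Int_cutoff_bigO (leqnn 4) ler01 dominated_outer2 (bigOM hg hg).
exists C => // rho M gr; rewrite L2norm_outer_sqr.
exact: le_trans (ler_norm _) (HC rho M gr).
Qed.

Lemma L2_growth_o g : littleo_weight 1 g ->
  growth_o 5 3 (fun rho M => L2norm M (rescale rho outer * g) ^+ 2).
Proof.
move=> hg e e0.
have gg : littleo_weight 2 (g * g) := littleoM hg (littleo_bigO hg).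
have [C C0 HC] := Int_cutoff_littleo (isT : (2 < 4)%N) ler01 dominated_outer2 gg e0.
exists C => // rho M gr; rewrite L2norm_outer_sqr.
exact: le_trans (ler_norm _) (HC rho M gr).
Qed.

Lemma sqr_sum3 (a : 'I_3 -> R) : (\sum_i a i) ^+ 2 <= 3 * \sum_i a i ^+ 2.
Proof.
rewrite !big_ord_recr !big_ord0 /= !add0r.
set x := a _; set y := a _; set z := a _.
have := sqr_ge0 (x - y); have := sqr_ge0 (y - z); have := sqr_ge0 (x - z).
by rewrite !sqrrB !sqrrD; lra.
Qed.

(** Products of an L2 norm o(rho^(5/2)) with one that is O(rho^(1/2)), over the
    radius rho^3. *)
Lemma vanishing_product (U F : nat -> nat -> R) :
  growth_o 5 3 (fun rho M => U rho M ^+ 2) -> growth 1 (fun rho M => F rho M ^+ 2) ->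
  vanishing (fun rho M => U rho M * ((cube_radius rho)^-1 * U rho M + F rho M) / cube_radius rho).
Proof.
move=> hU [CF CF0 HF]; apply: vanishing_intro => e e0.
have CFp : 0 < CF + 1 by rewrite ltr_wpDl.
have [d d0 dC] : exists2 d : R, 0 < d & d * CF <= e.
  exists (e / (CF + 1)); first exact: divr_gt0.
  by rewrite mulrAC ler_pdivrMr // ler_pM2l // lerDl.
have [C1 C10 H1] := hU 1 ltr01.
have [C2 C20 H2] := hU (e * d) (mulr_gt0 e0 d0).
exists (1 + C1 + C2 / d) => [|rho M gr].
  by rewrite !addr_ge0 // divr_ge0 // ltW.
have r0 : (0 < rho)%N by case/andP: gr.
move: (H1 _ _ gr) (H2 _ _ gr) (HF _ _ gr); clear H1 H2 HF hU; rewrite /cube_radius.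
have r1 : 1 <= rho%:R :> R by rewrite ler1n.
move: (rho%:R) r1 (U rho M) (F rho M) => r r1 {}U {}F h1 h2 h3.
have rp : 0 < r by exact: lt_le_trans r1.
have A1 : U ^+ 2 / r ^+ 6 <= (1 + C1) / r.
  rewrite ler_pdivrMr ?exprn_gt0 //; apply: le_trans h1 _.
  have -> : (1 + C1) / r * r ^+ 6 = r ^+ 5 + C1 * r ^+ 5.
    by field; rewrite gt_eqF.
  by rewrite mul1r lerD2l ler_wpM2l // ler_weXn2l.
have A2 : U * F / r ^+ 3 <= e + (C2 / d) / r.
  rewrite ler_pdivrMr ?exprn_gt0 //.
  have q0 : 0 < d * r ^+ 2 by rewrite pmulr_rgt0 ?exprn_gt0.
  have AG : 2 * (U * F) <= d * r ^+ 2 * F ^+ 2 + U ^+ 2 / (d * r ^+ 2).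
    rewrite -subr_ge0.
    have -> : d * r ^+ 2 * F ^+ 2 + U ^+ 2 / (d * r ^+ 2) - 2 * (U * F) =
      (d * r ^+ 2 * F - U) ^+ 2 / (d * r ^+ 2) by field; rewrite !gt_eqF.
    by rewrite divr_ge0 ?sqr_ge0 // ltW.
  have B1 : d * r ^+ 2 * F ^+ 2 <= e * r ^+ 3.
    apply: le_trans (_ : d * r ^+ 2 * (CF * r ^+ 1) <= _).
      by rewrite ler_wpM2l // mulr_ge0 ?exprn_ge0 ?(ltW d0) ?(ltW rp).
    have -> : d * r ^+ 2 * (CF * r ^+ 1) = d * CF * r ^+ 3 by ring.
    by rewrite ler_wpM2r ?exprn_ge0 ?(ltW rp).
  have B2 : U ^+ 2 / (d * r ^+ 2) <= e * r ^+ 3 + C2 / d / r * r ^+ 3.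
    rewrite ler_pdivrMr //; apply: le_trans h2 _.
    have -> : (e * r ^+ 3 + C2 / d / r * r ^+ 3) * (d * r ^+ 2) =
      e * d * r ^+ 5 + C2 * r ^+ 4 by field; rewrite !gt_eqF.
    by rewrite lerD2l ler_wpM2l // ler_weXn2l.
  have B3 : 0 <= C2 / d / r * r ^+ 3.
    by rewrite !mulr_ge0 ?invr_ge0 ?exprn_ge0 ?(ltW d0) ?(ltW rp).
  by rewrite mulrDl; lra.
have -> : U * ((r ^+ 3)^-1 * U + F) / r ^+ 3 = U ^+ 2 / r ^+ 6 + U * F / r ^+ 3.
  by field; rewrite gt_eqF.
apply: le_trans (lerD A1 A2) _.
by rewrite [(_ + _ + _) / r]mulrDl addrCA.
Qed.

End Decay.

(** * The energy identity *)

Lemma IBP_prod (R : realType) (n M : nat) (k : 'I_n) (f g h a b : smfun R n) :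
  supported (M%:R - 2) g -> f * (D k g * h) = a -> f * (g * D k h) = b ->
  Int M (D k f * (g * h)) = - Int M a - Int M b.
Proof.
move=> gs <- <-; rewrite IBP; last by apply/supported_mulr/supported_mull.
by rewrite DM mulrDr IntD opprD.
Qed.

HB.lock Definition grad2 (R : realType) (n : nat) (s : smfun R n) : smfun R n :=
  \sum_k D k s * D k s.

HB.lock Definition conv (R : realType) (n : nat) (u : 'I_n -> smfun R n)
    (phi s : smfun R n) : smfun R n :=
  lap 1 phi * (s * s) + (\sum_j u j * D j phi) * (s * s).

(** The bookkeeping of the energy identity: the coupling terms a and e cancel b
    and d up to the fluxes f and g. *)
Lemma sum_balances (R : realType) (n : nat) (gu gv cu cv pr d e g : 'I_n -> R)
    (a b f : 'I_n -> 'I_n -> R) (gt ct : R) :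
  (forall i, gu i = 2^-1 * cu i - pr i - \sum_j a i j) ->
  (forall i, gv i = 2^-1 * cv i - d i - \sum_j b i j) ->
  gt = 2^-1 * ct - \sum_j e j ->
  (forall i j, a i j = - b i j - f i j) -> (forall j, e j = - d j - g j) ->
  \sum_i gu i + \sum_i gv i + gt =
    2^-1 * (\sum_i cu i + \sum_i cv i + ct) - \sum_i pr i
    + \sum_i \sum_j f i j + \sum_j g j.
Proof.
move=> Eu Ev Et C1 C2; rewrite Et (eq_bigr _ (fun i _ => Eu i)).
rewrite (eq_bigr _ (fun i _ => Ev i)) (eq_bigr _ (fun j _ => C2 j)).
rewrite (eq_bigr (fun i => 2^-1 * cu i - pr i + (\sum_j b i j + \sum_j f i j))); last first.
  move=> i _; rewrite -big_split -sumrN; congr (_ + _); apply: eq_bigr => j _ /=.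
  by rewrite C1; ring.
rewrite !(sumrB, big_split) /= -!mulr_sumr sumrN; ring.
Qed.

(* Linear identities between integrals hold whatever the integrands are. *)
Ltac abstract_integrals :=
  repeat match goal with |- context [bigop.body ?a ?b ?c] =>
    generalize (bigop.body a b c); intro end;
  repeat match goal with |- context [Int ?M ?f] => generalize (Int M f); intro end.

Section Energy.
Context {R : realType}.
Local Notation V := 'rV[R]_3.
Local Notation smfun := (smfun R 3).
Implicit Types (f g h s phi : smfun) (rho M : nat) (x : V) (i j k : 'I_3).

Variables (u v : 'I_3 -> smfun) (p theta : smfun).
Hypothesis eq_u : forall i, - lap 1 (u i) + \sum_j u j * D j (u i) + D i p
  + \sum_j D j (v i * v j) = 0.
Hypothesis eq_v : forall i, - lap 1 (v i) + \sum_j u j * D j (v i) + D i theta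
  + \sum_j v j * D j (u i) = 0.
Hypothesis eq_theta : - lap 1 theta + \sum_j u j * D j theta + \sum_j D j (v j) = 0.
Hypothesis div_u : \sum_j D j (u j) = 0.

Lemma dissipation M phi s : supported (M%:R - 2) phi ->
  Int M (phi * s * - lap 1 s) =
  Int M (phi * grad2 s) - 2^-1 * Int M (lap 1 phi * (s * s)).
Proof.
move=> ps; rewrite !lap1 grad2.unlock mulrN IntN !mulr_sumr mulr_suml !Int_sum mulr_sumr.
rewrite -sumrB -sumrN; apply: eq_bigr => k _.
have E1 : Int M (phi * s * D k (D k s)) =
    - Int M (phi * (D k s * D k s)) - Int M (D k phi * (s * D k s)).
  transitivity (Int M (D k (D k s) * (phi * s))); first by rewrite mulrC.
  by rewrite addrC; apply: IBP_prod => //; ring.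
have E2 : Int M (D k (D k phi) * (s * s)) = - (2 * Int M (D k phi * (s * D k s))).
  rewrite IBP; last by apply/supported_mull/supported_D.
  by rewrite -IntZ DM; congr (- Int M _); rewrite rmorph_nat; ring.
by rewrite E1 E2; abstract_integrals; field.
Qed.

Lemma transport M phi s : supported (M%:R - 2) phi ->
  Int M (phi * s * \sum_j u j * D j s) =
  - (2^-1 * Int M ((\sum_j u j * D j phi) * (s * s))).
Proof.
move=> ps.
have E j : 2 * Int M (phi * s * (u j * D j s)) =
    - Int M (phi * (s * s) * D j (u j)) - Int M (u j * D j phi * (s * s)).
  transitivity (Int M (D j (s * s) * (phi * u j))).
    by rewrite -IntZ DM rmorph_nat; congr (Int M _); ring.
  by rewrite addrC; apply: IBP_prod => //; ring.
have S : 2 * Int M (phi * s * \sum_j u j * D j s) =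
    - Int M ((\sum_j u j * D j phi) * (s * s)).
  rewrite mulr_sumr mulr_suml !Int_sum mulr_sumr (eq_bigr _ (fun j _ => E j)).
  rewrite sumrB sumrN.
  have -> : \sum_j Int M (phi * (s * s) * D j (u j)) = 0.
    by rewrite -Int_sum -mulr_sumr div_u mulr0 Int0.
  by rewrite oppr0 sub0r.
by rewrite -[in RHS]mulrN -S mulrA mulVf ?mul1r.
Qed.

Local Notation conv := (conv u).

Let scalar_energy M phi s b : supported (M%:R - 2) phi ->
  - lap 1 s + \sum_j u j * D j s + b = 0 ->
  Int M (phi * grad2 s) = 2^-1 * Int M (conv phi s) - Int M (phi * s * b).
Proof.
move=> ps E; have := dissipation s ps; have := transport s ps.
have : Int M (phi * s * - lap 1 s) + Int M (phi * s * \sum_j u j * D j s)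
   + Int M (phi * s * b) = 0.
  by rewrite -!IntD -!mulrDr E mulr0 Int0.
by rewrite conv.unlock IntD; abstract_integrals; lra.
Qed.

Definition total_grad2 : smfun := \sum_i grad2 (u i) + \sum_i grad2 (v i) + grad2 theta.

(** Each equation is tested with phi times its own unknown. The coupling terms
    v.grad u against v with div (v x v) against u, and grad theta against v with
    div v against theta, are total derivatives up to the cutoff. *)
Lemma energy_identity M phi : supported (M%:R - 2) phi ->
  Int M (phi * total_grad2) =
  2^-1 * (\sum_i Int M (conv phi (u i)) + \sum_i Int M (conv phi (v i))
          + Int M (conv phi theta))
  - \sum_i Int M (D i p * (phi * u i))
  + \sum_i \sum_j Int M (D j phi * (u i * v i * v j))
  + \sum_j Int M (D j phi * (v j * theta)).
Proof.
move=> ps; rewrite /total_grad2 [phi * _]mulrDr [phi * (_ + _)]mulrDr !IntD [phi * \sum_i grad2 (u i)]mulr_sumr.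
rewrite [phi * \sum_i grad2 (v i)]mulr_sumr !Int_sum.
have Eu i : Int M (phi * grad2 (u i)) = 2^-1 * Int M (conv phi (u i))
    - Int M (D i p * (phi * u i)) - \sum_j Int M (phi * u i * D j (v i * v j)).
  have X : Int M (phi * u i * (D i p + \sum_j D j (v i * v j))) =
      Int M (D i p * (phi * u i)) + \sum_j Int M (phi * u i * D j (v i * v j)).
    by rewrite mulrDr IntD mulr_sumr Int_sum [phi * u i * D i p]mulrC.
  have := eq_u i; rewrite -addrA => /(scalar_energy ps) ->.
  by rewrite X opprD addrA.
have Ev i : Int M (phi * grad2 (v i)) = 2^-1 * Int M (conv phi (v i))
    - Int M (phi * v i * D i theta) - \sum_j Int M (phi * v i * (v j * D j (u i))).
  have X : Int M (phi * v i * (D i theta + \sum_j v j * D j (u i))) =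
      Int M (phi * v i * D i theta) + \sum_j Int M (phi * v i * (v j * D j (u i))).
    by rewrite mulrDr IntD mulr_sumr Int_sum.
  have := eq_v i; rewrite -addrA => /(scalar_energy ps) ->.
  by rewrite X opprD addrA.
have Et : Int M (phi * grad2 theta) = 2^-1 * Int M (conv phi theta)
    - \sum_j Int M (phi * theta * D j (v j)).
  by rewrite (scalar_energy ps eq_theta) [phi * theta * \sum_j _]mulr_sumr Int_sum.
have C1 i j : Int M (phi * u i * D j (v i * v j)) =
    - Int M (phi * v i * (v j * D j (u i))) - Int M (D j phi * (u i * v i * v j)).
  transitivity (Int M (D j (v i * v j) * (phi * u i))); first by rewrite mulrC.
  by rewrite addrC; apply: IBP_prod => //; ring.
have C2 j : Int M (phi * theta * D j (v j)) =
    - Int M (phi * v j * D j theta) - Int M (D j phi * (v j * theta)).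
  transitivity (Int M (D j (v j) * (phi * theta))); first by rewrite mulrC.
  by rewrite addrC; apply: IBP_prod => //; ring.
exact: sum_balances Eu Ev Et C1 C2.
Qed.

Hypothesis u_decay : forall i, littleo_weight 1 (u i).
Hypothesis v_decay : forall i, bigO_weight 1 (v i).
Hypothesis theta_decay : bigO_weight 1 theta.
Hypothesis vtheta_decay : forall i, littleo_weight 3 (v i * theta).

Let phi rho : smfun := rescale rho bumpfun.

Let phi_s rho M : good rho M -> supported (M%:R - 2) (phi rho).
Proof.
move=> /andP[r0 rM]; apply: supported_weak (supported_rescale r0 supported_bump).
rewrite lerBrDr /cube_radius -natrX mulrC -natrM -natrD ler_nat.
by [].
Qed.

Let D_bump_dom j : exists2 K : R, 0 <= K & dominated K (D j bumpfun).
Proof.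
have [K K0 HK] := supported_bounded (@supported_D R 3 4%:R j _ supported_bump).
exists K => //; apply: dominatedI => //.
have := sD_zeror 1 j (@outer_bump R 3).
by rewrite sDE rmorph1 mul1r.
Qed.

Let lap_bump_dom : exists2 K : R, 0 <= K & dominated K (lap 1 (bumpfun : smfun)).
Proof.
have [K K0 HK] := supported_bounded (@supported_lap R 3 1 4%:R _ supported_bump).
by exists K => //; apply: dominatedI => //; apply: lap_zeror; exact: outer_bump.
Qed.

(** A derivative of the cutoff is of size rho^(-3), and the integral of an
    o(|x|^(-2)) over the ball of radius rho^3 is o(rho^3). *)
Lemma flux_vanishing j g : littleo_weight 3 g ->
  vanishing (fun rho M => `|Int M (D j (phi rho) * g)|).
Proof.
move=> hg; have [K K0 HK] := D_bump_dom j; apply: vanishing_intro => e e0.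
have [C C0 HC] := Int_cutoff_littleo (isT : (3 < 4)%N) K0 HK hg e0.
exists C => // rho M gr; have r0 : (0 < rho)%N by case/andP: gr.
have R0 := cube_radius_gt0 (R := R) r0.
rewrite D_rescale -mulrA IntZ normrM gtr0_norm ?invr_gt0 // mulrC ler_pdivrMr //.
apply: le_trans (HC rho M gr) _; rewrite mulrDl lerD2l /cube_radius.
have rp : 1 <= rho%:R :> R by rewrite ler1n.
rewrite -mulrA ler_wpM2l // ler_pdivlMl ?(lt_le_trans _ rp) // -exprS.
by rewrite ler_weXn2l.
Qed.

(** The Laplacian of the cutoff is of size rho^(-6), and the integral of an
    O(|x|^(-4/3)) over the ball of radius rho^3 is O(rho^5). *)
Lemma lap_flux_vanishing g : bigO_weight 2 g ->
  vanishing (fun rho M => `|Int M (lap 1 (phi rho) * g)|).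
Proof.
move=> hg; have [K K0 HK] := lap_bump_dom; apply: vanishing_intro => e e0.
have [C C0 HC] := Int_cutoff_bigO (isT : (2 <= 4)%N) K0 HK hg.
exists C => // rho M gr; have r0 : (0 < rho)%N by case/andP: gr.
have R0 := cube_radius_gt0 (R := R) r0.
have -> : lap 1 (phi rho) * g =
    smcst (cube_radius rho ^- 2) * (rescale rho (lap 1 bumpfun) * g).
  rewrite !lap1 mulrA; congr (_ * _); apply: smext => x.
  rewrite smM smcstE rescaleE !sm_sum mulr_sumr; apply: eq_bigr => i _.
  by rewrite D_rescale DZ D_rescale !smM !smcstE rescaleE mulrA; congr (_ * _); rewrite -invfM -expr2.
have R2 : 0 < cube_radius rho ^+ 2 :> R by rewrite exprn_gt0.
rewrite IntZ normrM (gtr0_norm (x := _^-1)) ?invr_gt0 // mulrC ler_pdivrMr //.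
apply: le_trans (HC rho M gr) _; rewrite /cube_radius.
have rp : 0 < rho%:R :> R by rewrite ltr0n.
have -> : (e + C / rho%:R) * (rho%:R ^+ 3) ^+ 2 = e * (rho%:R ^+ 3) ^+ 2 + C * rho%:R ^+ 5.
  by field; rewrite gt_eqF.
by rewrite lerDr mulr_ge0 ?(ltW e0) ?exprn_ge0 // ltW.
Qed.

Let u_bigO i : bigO_weight 1 (u i).
Proof. exact: littleo_bigO. Qed.

Lemma conv_vanishing s : bigO_weight 1 s ->
  vanishing (fun rho M => Int M (conv (phi rho) s)).
Proof.
move=> hs; have ss : bigO_weight 2 (s * s) := bigOM hs hs.
have V : vanishing (fun rho M => `|Int M (lap 1 (phi rho) * (s * s))|
    + \sum_j `|Int M (D j (phi rho) * (u j * (s * s)))|).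
  apply: vanishingD; first exact: lap_flux_vanishing.
  apply: vanishing_sum => j; apply: flux_vanishing.
  exact: (littleoM (k := 1) (l := 2)).
apply: vanishing_le V => rho M _; rewrite conv.unlock IntD; apply: lerD; first exact: ler_norm.
rewrite mulr_suml Int_sum; apply: ler_sum => j _.
by rewrite (_ : u j * _ * _ = D j (phi rho) * (u j * (s * s))) ?ler_norm //; ring.
Qed.

(** The velocity has L2 norm o(rho^(5/2)) and the flux F = u x u + v x v has norm
    O(rho^(1/2)) on the ball of radius rho^3; their product, over the radius,
    tends to 0. The viscosity is 1 over the radius in the scaled derivations. *)
Lemma pressure_vanishing :
  vanishing (fun rho M => `|\sum_i Int M (D i p * (phi rho * u i))|).
Proof.
pose F i j : smfun := u i * u j + v i * v j.
have F_decay i j : bigO_weight 2 (F i j).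
  by apply: bigOD; exact: (bigOM (k := 1) (l := 1)).
have div_sD c : \sum_j sD c j (u j) = 0.
  by rewrite (eq_bigr (fun j => smcst c * D j (u j))) -?mulr_sumr ?div_u ?mulr0 // => j _; exact: sDE.
have momentum c : 0 < c -> forall i, sD c i p =
    smcst c^-1 * lap c (u i) - \sum_j sD c j (F i j).
  move=> c0 i; have -> : lap c (u i) = smcst c * (smcst c * lap 1 (u i)).
    rewrite lap1 /lap !mulr_sumr; apply: eq_bigr => k _.
    by rewrite !sDE DZ.
  rewrite mulrA -rmorphM mulVf ?gt_eqF // rmorph1 mul1r.
  rewrite (eq_bigr (fun j => smcst c * D j (F i j))) => [|j _]; last exact: sDE.
  rewrite -mulr_sumr -mulrBr sDE; congr (_ * _).
  have -> : \sum_j D j (F i j) = \sum_j u j * D j (u i) + \sum_j D j (v i * v j).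
    rewrite -big_split; transitivity (\sum_j (u j * D j (u i) + D j (v i * v j))
       + u i * \sum_j D j (u j)); last by rewrite div_u mulr0 addr0.
    by rewrite mulr_sumr -big_split; apply: eq_bigr => j _ /=; rewrite DD DM; ring.
  have := eq_u i; set a := lap 1 _; set b := \sum_j u j * _; set d := \sum_j D j _ => E.
  transitivity (D i p - (- a + b + D i p + d)); first by rewrite E subr0.
  by ring.
have [K K0 [phiK chiK LK]] : exists2 K : R, 0 <= K &
    [/\ (forall x, `|bumpfun x| <= K) /\ (forall j x, `|D j bumpfun x| <= K),
     [/\ forall x, `|plateau x| <= K, forall j x, `|D j plateau x| <= K,
       forall j k x, `|D j (D k plateau) x| <= K & forall x, `|lap 1 plateau x| <= K] &
     forall j x, `|lap 1 (D j plateau) x| <= K].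
  have sb : supported 4%:R (bumpfun : smfun) := supported_bump.
  have sq : supported 4%:R (plateau : smfun) := supported_plateau.
  have [K1 K10 H1] := supported_bounded sb.
  have [K2 K20 H2] := common_bound (fun j => @supported_D R 3 4%:R j _ sb).
  have [K3 K30 H3] := supported_bounded sq.
  have [K4 K40 H4] := common_bound (fun j => @supported_D R 3 4%:R j _ sq).
  have [K5 K50 H5] := @common_bound R 3 ('I_3 * 'I_3)%type 4%:R
    (fun jk => D jk.1 (D jk.2 plateau)) (fun jk => @supported_D R 3 4%:R jk.1 _ (@supported_D R 3 4%:R jk.2 _ sq)).
  have [K6 K60 H6] := supported_bounded (@supported_lap R 3 1 4%:R _ sq).
  have [K7 K70 H7] := common_bound (fun j => @supported_lap R 3 1 4%:R _ (@supported_D R 3 4%:R j _ sq)).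
  exists (K1 + K2 + K3 + K4 + K5 + K6 + K7); first by rewrite !addr_ge0.
  split; first split.
  - by move=> x; apply: le_trans (H1 x) _; lra.
  - by move=> j x; apply: le_trans (H2 j x) _; lra.
  - split.
    + by move=> x; apply: le_trans (H3 x) _; lra.
    + by move=> j x; apply: le_trans (H4 j x) _; lra.
    + by move=> j k x; apply: le_trans (H5 (j, k) x) _; lra.
    + by move=> x; apply: le_trans (H6 x) _; lra.
  - by move=> j x; apply: le_trans (H7 j x) _; lra.
pose U rho M := \sum_i L2norm M (rescale rho outer * u i).
pose G rho M := \sum_i \sum_j L2norm M (rescale rho outer * F i j).
have U_growth : growth_o 5 3 (fun rho M => U rho M ^+ 2).
  have h := growth_o_sum (fun i => L2_growth_o (u_decay i)).
  move=> e e0; have [C C0 HC] := h (e / 3) (divr_gt0 e0 (ltr0n _ 3)).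
  exists (3 * C) => [|rho M gr]; first by rewrite mulr_ge0.
  by apply: le_trans (sqr_sum3 _) _; have := HC rho M gr; lra.
have G_growth : growth 1 (fun rho M => G rho M ^+ 2).
  have [C C0 HC] := growth_sum (fun i => growth_sum (fun j => L2_growth (F_decay i j))).
  exists (9 * C) => [|rho M gr]; first by rewrite mulr_ge0.
  apply: le_trans (sqr_sum3 _) _.
  apply: le_trans (_ : 3 * \sum_i (3 * \sum_j L2norm M (rescale rho outer * F i j) ^+ 2) <= _).
    by rewrite ler_pM2l //; apply: ler_sum => i _; exact: sqr_sum3.
  by rewrite -mulr_sumr; have := HC rho M gr; lra.
have V := vanishingZ (@pressure_const_ge0 R 3 K K0) (vanishing_product U_growth G_growth).
move=> e e0; have e2 : 0 < e / 2 by rewrite divr_gt0.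
have [rho0 Hrho] := V _ e2; exists rho0.+1 => rho rr.
have r0 : (0 < rho)%N by exact: leq_ltn_trans rr.
have [M1 HM1] := Hrho rho (ltnW rr).
have R0 := cube_radius_gt0 (R := R) r0; set c : R := cube_radius rho in R0 HM1 *.
have sb f : supported 4%:R f -> supported (4 * rho ^ 3)%N%:R (rescale rho f).
  by move=> fs; rewrite natrM natrX mulrC; exact: supported_rescale.
have sdE f j x : sD c j (rescale rho f) x = D j f (c^-1 *: x).
  by rewrite sD_rescale // rescaleE.
have c'0 : 0 <= c^-1 by rewrite invr_ge0 ltW.
have phiKs : (forall x, `|rescale rho bumpfun x| <= K) /\
    (forall j x, `|sD c j (rescale rho bumpfun) x| <= K).
  by case: phiK => P1 P2; split=> [x|j x]; rewrite ?sdE // rescaleE.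
have chiKs : [/\ forall x, `|rescale rho plateau x| <= K,
    forall j x, `|sD c j (rescale rho plateau) x| <= K,
    forall j k x, `|sD c j (sD c k (rescale rho plateau)) x| <= K &
    forall x, `|lap c (rescale rho plateau) x| <= K].
  case: chiK => P1 P2 P3 P4; split=> [x|j x|j k x|x].
  - by rewrite rescaleE.
  - by rewrite sdE.
  - by rewrite [sD c k _]sD_rescale // sdE.
  - by rewrite lap_rescale // rescaleE.
have LKs j x : `|lap c (sD c j (rescale rho plateau)) x| <= K.
  by rewrite [sD c j _]sD_rescale // lap_rescale // rescaleE.
have [M2 HM2] := @pressure_bound R 3 c u F p c^-1 (rescale rho bumpfun) (rescale rho plateau)
  (rescale rho outer) K (4 * rho ^ 3)%N (c * (e / 2)) R0 c'0 K0 (mulr_gt0 R0 e2)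
  (div_sD c) (momentum c R0) (rescale_zero rho plateau_bump) (rescale_zero rho outer_plateau)
  (sb _ supported_bump) (sb _ supported_plateau) (sb _ supported_outer) phiKs chiKs LKs.
exists (M1 + M2)%N => M MM.
have := HM1 M (leq_trans (leq_addr _ _) MM).
have := HM2 M (leq_trans (leq_addl _ _) MM).
have S : \sum_i Int M (sD c i p * (rescale rho bumpfun * u i)) =
    c * \sum_i Int M (D i p * (phi rho * u i)).
  by rewrite mulr_sumr; apply: eq_bigr => i _; rewrite sDE -mulrA IntZ.
rewrite [X in `|X| <= _ -> _]S normrM (gtr0_norm R0) -/(U rho M) -/(G rho M) => h1 h2.
rewrite -(ler_pM2l R0); apply: le_trans h1 _.
rewrite mulrA -[_ * U rho M]mulrC in h2.
have -> : c * e = c * (e / 2) + c * (e / 2) by field.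
rewrite lerD2r.
have -> : @pressure_const R 3 K * U rho M * (c^-1 * U rho M + G rho M) =
  c * (@pressure_const R 3 K * (U rho M * (c^-1 * U rho M + G rho M) / c)).
  by field; rewrite gt_eqF.
rewrite ler_pM2l //; apply: le_trans h2; rewrite le_eqVlt; apply/orP; left; apply/eqP.
ring.
Qed.

Lemma total_grad2_vanishing : vanishing (fun rho M => Int M (phi rho * total_grad2)).
Proof.
have V : vanishing (fun rho M =>
   2^-1 * (\sum_i Int M (conv (phi rho) (u i)) + \sum_i Int M (conv (phi rho) (v i))
          + Int M (conv (phi rho) theta))
  + `|\sum_i Int M (D i p * (phi rho * u i))|
  + \sum_i \sum_j `|Int M (D j (phi rho) * (u i * v i * v j))|
  + \sum_j `|Int M (D j (phi rho) * (v j * theta))|).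
  apply: vanishingD; first apply: vanishingD; first apply: vanishingD.
  - apply: vanishingZ; first by [].
    apply: vanishingD; last exact: conv_vanishing.
    by apply: vanishingD; apply: vanishing_sum => i; exact: conv_vanishing.
  - exact: pressure_vanishing.
  - apply: vanishing_sum => i; apply: vanishing_sum => j; apply: flux_vanishing.
    apply: (littleoM (k := 2) (l := 1)) => //.
    exact: (littleoM (k := 1) (l := 1)).
  - by apply: vanishing_sum => j; exact: flux_vanishing.
apply: vanishing_le V => rho M gr; rewrite energy_identity; last exact: phi_s.
apply: lerD; first apply: lerD; first apply: lerD.
- by [].
- by rewrite -[leRHS]normrN ler_norm.
- by apply: ler_sum => i _; apply: ler_sum => j _; exact: ler_norm.
- by apply: ler_sum => j _; exact: ler_norm.
Qed.

End Energy.

(** * Rigidity *)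

Section Rigidity.
Context {R : realType}.
Local Notation V := 'rV[R]_3.
Local Notation smfun := (smfun R 3).
Implicit Types (f g : smfun) (x y : V) (i k : 'I_3).

Lemma natr_above (B : R) : exists N : nat, forall m, (N <= m)%N -> B <= m%:R.
Proof.
exists (Num.truncn `|B|).+1 => m Nm; apply: le_trans (ler_norm B) _.
have /truncn_itv/andP[_ /ltW h] := normr_ge0 B.
by apply: le_trans h _; rewrite ler_nat.
Qed.

Lemma r2_le_norm (B : R) x : `|x| <= B -> r2 x <= 3 * B ^+ 2.
Proof.
move=> xB; rewrite r2E; have B0 := le_trans (normr_ge0 x) xB.
apply: le_trans (_ : \sum_(i < 3) B ^+ 2 <= _); last first.
  by rewrite sumr_const card_ord mulr_natl.
apply: ler_sum => i _; rewrite -real_normK ?num_real // ler_pXn2r ?nnegrE //.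
exact: le_trans (coord_le_norm _ _) xB.
Qed.

(** A nonnegative continuous function that is positive at x0 has integral bounded
    below by its minimum on a dyadic box around x0, whatever the radius. *)
Lemma vanishing_eq0 g : (forall x, 0 <= g x) ->
  vanishing (fun rho M => Int M (rescale rho bumpfun * g)) -> forall x, g x = 0.
Proof.
move=> g0 hg x0; apply/eqP; apply: contraT => gx; exfalso.
have a0 : 0 < g x0 / 2 by rewrite divr_gt0 // lt_neqAle eq_sym gx g0.
have [d d0 Hd] := continuousP0 (@sm_continuous _ _ g x0) a0.
have [s /(_ s (leqnn s))] := mesh_small (ler01 : 0 <= 1 :> R) (divr_gt0 d0 (ltr0n _ 2)).
rewrite mul1r => sd; have m0 : 0 < mesh s :> R := mesh_gt0 s.
set b : R := flat 0 (1 / 2); have b0 : 0 < b by apply: flat0_gt0; rewrite divr_gt0.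
pose c := b * (g x0 / 2); have c0 : 0 < c by exact: mulr_gt0.
have e0 : 0 < c * mesh s ^+ 3 / 2 by rewrite divr_gt0 // mulr_gt0 // exprn_gt0.
have [rho0 /(_ _ _)] := hg _ e0.
pose B := `|x0| + d; have B0 : 0 < B by rewrite ltr_wpDl.
have [N HN] := natr_above (3 * B).
move=> /(_ (rho0 + N).+1 (leqW (leq_addr _ _))); set rho := (rho0 + N).+1 => -[M0 HM].
have [N' HN'] := natr_above (`|x0| + 1).
have MN : (N' <= M0 + N')%N by exact: leq_addl.
have := HM _ (leq_addr N' M0); move: (M0 + N')%N MN => M /HN' xM.
have R0 : 0 < cube_radius rho :> R by exact: cube_radius_gt0.
have RB : 3 * B <= cube_radius rho.
  apply: le_trans (HN rho _) _; first by rewrite /rho leqW // leq_addl.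
  by rewrite /cube_radius ler_eXnr // ler1n.
pose A i := Num.truncn ((x0 0 i + M%:R) * 2 ^+ s).
have xi i : `|x0 0 i| <= M%:R - 1.
  by apply: le_trans (coord_le_norm _ _) _; move: xM; lra.
have p0 : 0 < 2 ^+ s :> R by rewrite exprn_gt0.
have pm : 2 ^+ s * mesh s = 1 :> R by rewrite -exprMn mulfV // expr1n.
have Ai i : (A i)%:R * mesh s <= x0 0 i + M%:R < (A i).+1%:R * mesh s.
  have : 0 <= (x0 0 i + M%:R) * 2 ^+ s.
    by rewrite mulr_ge0 ?(ltW p0) //; have := xi i; rewrite ler_norml => /andP[]; lra.
  move=> /truncn_itv; rewrite -/(A i) => /andP[t1 t2].
  rewrite -(ler_pM2r p0) -(ltr_pM2r p0) -!mulrA [mesh s * _]mulrC pm !mulr1.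
  by rewrite t1.
apply/negP; rewrite -ltNge.
apply: lt_le_trans (_ : c * mesh s ^+ 3 <= _).
  by rewrite gtr_pMr ?(mulr_gt0 c0) ?exprn_gt0 // invf_lt1 // ltr1n.
apply: (@Int_ge_cube R 3 M _ c s A); first exact: ltW.
- by move=> x; rewrite smM rescaleE mulr_ge0 ?bump_ge0.
- move=> i; rewrite -(ltr_nat R) !natrM natrX.
  have := Ai i => /andP[t1 _]; have := xi i; rewrite ler_norml => /andP[_ t3].
  rewrite -(ltr_pM2r m0) -mulrA pm mulr1; apply: le_lt_trans t1 _; lra.
move=> x hx.
have xx0 : `|x - x0| < d.
  apply: le_lt_trans (_ : d / 2 < _); last by rewrite gtr_pMr // invf_lt1 // ltr1n.
  apply: le_trans sd; apply: norm_le_coord; first exact: ltW.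
  move=> i; rewrite !mxE ler_norml.
  have := hx i; have := Ai i; rewrite -[(A i).+1%:R]natr1 mulrDl mul1r.
  by move=> /andP[h1 h2] /andP[h3 h4]; apply/andP; split; lra.
rewrite smM rescaleE /c; apply: ler_pM; rewrite ?(ltW b0) ?(ltW a0) //.
  apply: bump_center; rewrite r2_scale exprVn mulrC ler_pdivrMr ?exprn_gt0 //.
  apply: le_trans (_ : 3 * B ^+ 2 <= _).
    apply: r2_le_norm; rewrite -[x](subrK x0) /B addrC.
    by apply: le_trans (ler_normD _ _) _; rewrite lerD2l ltW.
  have : (3 * B) ^+ 2 <= cube_radius rho ^+ 2.
    by rewrite ler_pXn2r ?nnegrE ?mulr_ge0 ?(ltW B0) ?(ltW R0).
  by rewrite exprMn; have := sqr_ge0 B; lra.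
by have := Hd _ xx0; rewrite ltr_norml => /andP[]; lra.
Qed.

(** Constancy along one axis is enough, as the weight tends to 0 along it. *)
Lemma gradient_free_eq0 f : (forall k, D k f = 0) -> bigO_weight 1 f -> forall x, f x = 0.
Proof.
move=> Df [C C0 HC] x.
have line h : f (h *: delta_mx 0 0 + x) = f x.
  have [c _ ] := sm_mvt f 0 x h; rewrite Df sm0 mulr0 => /eqP.
  by rewrite subr_eq0 => /eqP.
apply/eqP; apply: contraT => fx.
have a0 : 0 < `|f x| by rewrite normr_gt0.
have [N /(_ N (leqnn N))] := natr_above ((C / `|f x|) ^+ 3 + `|x 0 0| + 1).
set h : R := N%:R => hN; pose y : V := h *: delta_mx 0 0 + x.
have := HC y; rewrite line expr1 leNgt => /negP[].
have w0 := weight_gt0 y; have E := weight_r2 y.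
have q0 : 0 <= C / `|f x| by rewrite divr_ge0.
have q3 : 0 <= (C / `|f x|) ^+ 3 by rewrite exprn_ge0.
have r2y : (C / `|f x|) ^+ 3 < 1 + r2 y.
  have yh : h - `|x 0 0| <= `|y 0 0|.
    rewrite !mxE eqxx mulr1; apply: le_trans (lerB_normD _ _).
    by rewrite lerD2r ler_norm.
  have y2 : `|y 0 0| ^+ 2 <= r2 y.
    rewrite real_normK ?num_real // r2E (bigD1 0) //= lerDl.
    by apply: sumr_ge0 => i _; exact: sqr_ge0.
  have y1 : 1 <= `|y 0 0| by move: hN yh q3; lra.
  have : `|y 0 0| <= `|y 0 0| ^+ 2 by rewrite ler_eXnr.
  by move: hN yh y2 q3; lra.
have : C / `|f x| * weight y < 1.
  rewrite -(ltr_pXn2r (n := 3)) ?nnegrE ?mulr_ge0 ?(ltW w0) //.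
  by rewrite expr1n exprMn -E mulrC ltr_pM2l ?exprn_gt0.
by rewrite mulrAC ltr_pdivrMr // mul1r.
Qed.

Lemma grad2_ge0 f x : 0 <= grad2 f x.
Proof.
by rewrite grad2.unlock sm_sum sumr_ge0 // => k _; rewrite smM -expr2 sqr_ge0.
Qed.

Lemma grad2_eq0 f : (forall x, grad2 f x = 0) -> forall k, D k f = 0.
Proof.
move=> f0 k; apply: smext => x; have /eqP := f0 x.
rewrite grad2.unlock sm_sum psumr_eq0 => [/allP/(_ k)|i _]; last first.
  by rewrite smM -expr2 sqr_ge0.
by rewrite mem_index_enum smM -expr2 sqrf_eq0 sm0 => /(_ isT)/eqP.
Qed.

Lemma sum_grad2_eq0 (s : 'I_3 -> smfun) : (forall x, (\sum_i grad2 (s i)) x = 0) ->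
  forall i k, D k (s i) = 0.
Proof.
move=> s0 i; apply: grad2_eq0 => x; have /eqP := s0 x.
rewrite sm_sum psumr_eq0 => [/allP/(_ i)|j _]; last exact: grad2_ge0.
by rewrite mem_index_enum => /(_ isT)/eqP.
Qed.

(** What the four decay conditions share, in terms of the weight, is enough. *)
Lemma liouville (u v : 'I_3 -> smfun) (p theta : smfun) :
  (forall i, - lap 1 (u i) + \sum_j u j * D j (u i) + D i p
    + \sum_j D j (v i * v j) = 0) ->
  (forall i, - lap 1 (v i) + \sum_j u j * D j (v i) + D i theta
    + \sum_j v j * D j (u i) = 0) ->
  - lap 1 theta + \sum_j u j * D j theta + \sum_j D j (v j) = 0 ->
  \sum_j D j (u j) = 0 ->
  (forall i, littleo_weight 1 (u i)) -> (forall i, bigO_weight 1 (v i)) ->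
  bigO_weight 1 theta -> (forall i, littleo_weight 3 (v i * theta)) ->
  [/\ forall i x, u i x = 0, forall i x, v i x = 0 & forall x, theta x = 0].
Proof.
move=> eq_u eq_v eq_theta div_u hu hv ht hvt.
have V := total_grad2_vanishing eq_u eq_v eq_theta div_u hu hv ht hvt.
have sum_ge0 (s : 'I_3 -> smfun) x : 0 <= (\sum_i grad2 (s i)) x.
  by rewrite sm_sum sumr_ge0 // => i _; exact: grad2_ge0.
have G0 : forall x, total_grad2 u v theta x = 0.
  by apply: vanishing_eq0 V => x; rewrite !smD !addr_ge0 ?grad2_ge0 ?sum_ge0.
have split0 x : [/\ (\sum_i grad2 (u i)) x = 0, (\sum_i grad2 (v i)) x = 0 &
    grad2 theta x = 0].
  have := G0 x; rewrite !smD => /eqP.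
  rewrite paddr_eq0 ?addr_ge0 ?grad2_ge0 ?sum_ge0 // paddr_eq0 ?sum_ge0 //.
  by move=> /andP[/andP[/eqP -> /eqP ->] /eqP ->].
split=> [i|i|]; apply: gradient_free_eq0 => //.
- by apply: sum_grad2_eq0 => x; case: (split0 x).
- exact: littleo_bigO.
- by apply: sum_grad2_eq0 => x; case: (split0 x).
- by apply: grad2_eq0 => x; case: (split0 x).
Qed.

End Rigidity.

(** * Decay at infinity in terms of the weight *)

Section EuclideanDecay.
Context {R : realType}.
Local Notation V := 'rV[R]_3.
Local Notation smfun := (smfun R 3).
Implicit Types (f : smfun) (x : V) (k : nat).

Lemma enormE x : enorm x = Num.sqrt (r2 x). Proof. by rewrite r2E. Qed.

(** The cube of |x|^(-2/3) is |x|^(-2) <= 8 / (1 + |x|^2) outside the unit ball. *)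
Lemma epow_le k x : 1 <= enorm x -> epow (- (2 / 3)) x ^+ k <= 2 ^+ k * weight x ^+ k.
Proof.
move=> x1; have w0 := weight_gt0 x; have x0 : 0 < enorm x by exact: lt_le_trans x1.
rewrite -exprMn; have [->|k0] := eqVneq k 0%N; first by rewrite !expr0.
rewrite ler_pXn2r ?lt0n ?nnegrE ?powR_ge0 ?mulr_ge0 ?(ltW w0) //.
rewrite -(ler_pXn2r (n := 3)) ?nnegrE ?powR_ge0 ?mulr_ge0 ?(ltW w0) //.
rewrite -powR_mulrn ?powR_ge0 // /epow -powRrM.
have -> : - (2 / 3) * 3%:R = - 2%:R :> R by field.
rewrite powRN powR_mulrn ?(ltW x0) //.
have E : enorm x ^+ 2 = r2 x by rewrite enormE sqr_sqrtr // r2_ge0.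
have r1 : 1 <= r2 x by rewrite -E exprn_ege1.
have rp : 0 < r2 x by exact: lt_le_trans r1.
rewrite E -(ler_pM2r rp) mulVf ?gt_eqF // -[leLHS](weight_r2 x) exprMn.
have h : weight x ^+ 3 <= weight x ^+ 3 * r2 x by rewrite ler_peMr ?exprn_ge0 ?(ltW w0).
have h0 : 0 <= weight x ^+ 3 * r2 x by rewrite mulr_ge0 ?exprn_ge0 ?(ltW w0) ?(ltW rp).
by rewrite -mulrA mulrDr mulr1; move: h h0; lra.
Qed.

Lemma weight_ball l (B : R) x : (l <= 3)%N -> r2 x <= B -> 1 <= (1 + B) * weight x ^+ l.
Proof.
move=> l3 xB; have w0 := weight_gt0 x; rewrite -[leLHS](weight_r2 x) mulrC.
have r0 := r2_ge0 x.
have wl : weight x ^+ 3 <= weight x ^+ l by rewrite ler_wiXn2l ?weight_le1 ?(ltW w0).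
by apply: ler_pM => //; [exact: addr_ge0 | rewrite exprn_ge0 // ltW | rewrite lerD2l].
Qed.

Lemma ball_bounded f (B : R) : exists2 C : R, 0 <= C &
  forall x, enorm x <= B -> `|f x| <= C.
Proof.
have [C C0 HC] := sm_bounded f B; exists C => // x xB; apply: HC; apply: le_trans xB.
rewrite enormE -(ler_pXn2r (n := 2)) ?nnegrE ?sqrtr_ge0 // sqr_sqrtr ?r2_ge0 //.
exact: norm_sqr_le_r2.
Qed.

Lemma epow_exprn k (s : R) x : s = - (2 / 3) * k%:R -> epow s x = epow (- (2 / 3)) x ^+ k.
Proof. by move=> ->; rewrite /epow powRrM powR_mulrn // powR_ge0. Qed.

(* Near the origin any bound will do, as the weight is bounded below there. *)
Lemma weight_majorant k (s a : R) f : (k <= 2)%N -> s = - (2 / 3) * k%:R -> 0 <= a ->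
  (\forall x \near einfty, `|f x| <= a * `|epow s x|) ->
  exists2 C : R, 0 <= C & forall x, `|f x| <= a * 2 ^+ k * weight x ^+ k + C * weight x ^+ k.+1.
Proof.
move=> k2 sk a0 [M _ H]; pose B := Num.max M 1.
have B1 : 1 <= B by rewrite le_max lexx orbT.
have B0 : 0 <= B by exact: le_trans B1.
have [C C0 HC] := ball_bounded f B.
exists (C * (1 + B ^+ 2)) => [|x].
  by rewrite mulr_ge0 // addr_ge0 ?sqr_ge0.
have w0 := weight_gt0 x.
have [xB|] := leP (enorm x) B.
  apply: le_trans (HC x xB) _; rewrite -[leLHS]add0r; apply: lerD.
    by rewrite !mulr_ge0 ?exprn_ge0 ?(ltW w0).
  rewrite -mulrA -[leLHS]mulr1 ler_wpM2l // weight_ball //.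
  by rewrite -[r2 x]sqr_sqrtr ?r2_ge0 // -enormE ler_pXn2r ?nnegrE ?sqrtr_ge0.
rewrite gt_max => /andP[xM x1].
rewrite -[leLHS]addr0; apply: lerD; last first.
  by rewrite !mulr_ge0 ?exprn_ge0 ?(ltW w0) // addr_ge0 ?sqr_ge0.
apply: le_trans (H x xM) _; rewrite ger0_norm ?powR_ge0 // (epow_exprn _ sk) -mulrA.
by rewrite ler_wpM2l // epow_le // ltW.
Qed.

Lemma bigO_weightI k (s : R) (W : normedModType R) (g : V -> W) f :
  (k <= 2)%N -> s = - (2 / 3) * k%:R -> (forall x, `|f x| <= `|g x|) ->
  g =O_einfty epow s -> bigO_weight k f.
Proof.
move=> k2 sk fg /eqO_exP[a a0 H].
have [|C C0 HC] := @weight_majorant k s a f k2 sk (ltW a0).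
  by apply: filterS H => x; exact: le_trans.
exists (a * 2 ^+ k + C) => [|x].
  by rewrite addr_ge0 // mulr_ge0 ?exprn_ge0 // ltW.
apply: le_trans (HC x) _; rewrite mulrDl lerD2l ler_wpM2l //.
have w0 := weight_gt0 x.
by rewrite exprS ler_piMl ?exprn_ge0 ?(ltW w0) // weight_le1.
Qed.

Lemma littleo_weightI k (s : R) (W : normedModType R) (g : V -> W) f :
  (k <= 2)%N -> s = - (2 / 3) * k%:R -> (forall x, `|f x| <= `|g x|) ->
  g =o_einfty epow s -> littleo_weight k f.
Proof.
move=> k2 sk fg /eqoP H e e0.
have a0 : 0 < e / 2 ^+ k by rewrite divr_gt0 // exprn_gt0.
have [|C C0 HC] := @weight_majorant k s _ f k2 sk (ltW a0).
  by apply: filterS (H _ a0) => x; exact: le_trans.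
exists C => // x; apply: le_trans (HC x) _.
by rewrite divfK // gt_eqF // exprn_gt0.
Qed.

End EuclideanDecay.

Arguments bigO_weightI {R} k {s W g f}.
Arguments littleo_weightI {R} k {s W g f}.

(** * Coordinates of vector fields *)

Section Coordinates.
Context {R : realType} {n : nat}.
Local Notation V := 'rV[R]_n.
Local Notation pd := (@partial R n _).
Implicit Types (u : V -> V) (i j k : 'I_n) (x : V).

Lemma partial_coord u i j x : derivable u x (delta_mx 0 i) ->
  pd i (fun y => u y 0 j) x = pd i u x 0 j.
Proof. by move=> du; rewrite [in RHS]/partial derive_mx // mxE. Qed.

Lemma foldr_partial_coord u j s : smooth u ->
  foldr pd (fun y => u y 0 j) s = fun y => foldr pd u s y 0 j.
Proof.
move=> su; elim: s => [|i s IH] //=; rewrite IH; apply/funext => x.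
by apply: partial_coord; case: (su s).
Qed.

Lemma smooth_coord u j : smooth u -> smooth (fun y => u y 0 j).
Proof.
move=> su s; rewrite foldr_partial_coord //; case: (su s) => cu du; split=> [x|i x].
  exact: (continuous_comp (cu x) (@coord_continuous _ _ _ 0 j _)).
exact: (derivable_mxP _ _ _).1.
Qed.

Definition coord u (su : smooth u) j : smfun R n := SmFun (asboolT (smooth_coord j su)).

Lemma coordE u (su : smooth u) j x : coord su j x = u x 0 j. Proof. by []. Qed.

Lemma D_coord u (su : smooth u) i j : D i (coord su j) = coord (smooth_partial i su) j.
Proof.
apply: smext => x; rewrite DE coordE -partial_coord //.
by case: (su [::]).
Qed.

Lemma lap_coord u (su : smooth u) j x : lap 1 (coord su j) x = laplacian u x 0 j.
Proof.
by rewrite lap1 sm_sum summxE; apply: eq_bigr => i _; rewrite !D_coord.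
Qed.

Lemma advect_coord u w (su : smooth u) (sw : smooth w) j x :
  (\sum_k coord su k * D k (coord sw j)) x = advect u w x 0 j.
Proof.
rewrite sm_sum summxE; apply: eq_bigr => k _.
by rewrite smM D_coord !coordE mxE.
Qed.

Lemma div_tensor_coord u w (su : smooth u) (sw : smooth w) j x :
  (\sum_k D k (coord su j * coord sw k)) x = div_mx (tensor u w) x 0 j.
Proof.
have E k : D k (coord su j * coord sw k) x = pd k (fun y => tensor u w y j k) x.
  rewrite DE; congr (pd k _ x); apply/funext => y; by rewrite mxE.
by rewrite sm_sum mxE; exact: eq_bigr.
Qed.

Lemma lapE (f : smfun R n) x : lap 1 f x = laplacian f x.
Proof.
have E k : D k f = partial k f :> (V -> R) by apply/funext => y; rewrite DE.
by rewrite lap1 sm_sum; apply: eq_bigr => k _; rewrite DE E.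
Qed.

Lemma equation_coord (a b c d : V) i : - a + b + c + d = 0 ->
  - a 0 i + b 0 i + c 0 i + d 0 i = 0.
Proof. by move=> /(congr1 (fun M : V => M 0 i)); rewrite !mxE. Qed.

End Coordinates.

Theorem corollary1p2 (R : realType)
  (u : 'rV[R]_3 -> 'rV[R]_3) (p : 'rV[R]_3 -> R)
  (v : 'rV[R]_3 -> 'rV[R]_3) (theta : 'rV[R]_3 -> R)
  (hsol : tropical_climate_smooth_solution u p v theta)
  (hdecay :
    [\/ [/\ u =o_einfty epow (- (2 / 3)),
            v =O_einfty epow (- (2 / 3))
          & theta =o_einfty epow (- (4 / 3))],
        [/\ u =o_einfty epow (- (2 / 3)),
            v =o_einfty epow (- (2 / 3))
          & theta =O_einfty epow (- (4 / 3))],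
        [/\ u =o_einfty epow (- (2 / 3)),
            v =O_einfty epow (- (4 / 3))
          & theta =o_einfty epow (- (2 / 3))]
      | [/\ u =o_einfty epow (- (2 / 3)),
            v =o_einfty epow (- (4 / 3))
          & theta =O_einfty epow (- (2 / 3))]]) :
  [/\ forall x, u x = 0, forall x, v x = 0 & forall x, theta x = 0].
Proof.
case: hsol => -[su smp sv st] eqs.
pose U := coord su; pose W := coord sv.
pose P : smfun R 3 := SmFun (asboolT smp); pose T : smfun R 3 := SmFun (asboolT st).
have eq_U i : - lap 1 (U i) + \sum_j U j * D j (U i) + D i P + \sum_j D j (W i * W j) = 0.
  apply: smext => x; have [/(@equation_coord _ _ _ _ _ _ i) E _ _ _] := eqs x.
  rewrite !smD smN /U lap_coord advect_coord sm0 -[RHS]E; congr (_ + _ + _ + _).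
  - by rewrite DE mxE.
  - exact: div_tensor_coord.
have eq_W i : - lap 1 (W i) + \sum_j U j * D j (W i) + D i T + \sum_j W j * D j (U i) = 0.
  apply: smext => x; have [_ /(@equation_coord _ _ _ _ _ _ i) E _ _] := eqs x.
  rewrite !smD smN /U /W lap_coord !advect_coord sm0 -[RHS]E; congr (_ + _ + _ + _).
  by rewrite DE mxE.
have eq_T : - lap 1 T + \sum_j U j * D j T + \sum_j D j (W j) = 0.
  apply: smext => x; have [_ _ E _] := eqs x.
  rewrite !smD smN sm0 -[RHS]E lapE !sm_sum; congr (_ + _ + _).
  - by apply: eq_bigr => i _; rewrite smM DE.
  - by apply: eq_bigr => i _; rewrite DE.
have div_U : \sum_j D j (U j) = 0.
  apply: smext => x; have [_ _ _ E] := eqs x.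
  by rewrite sm0 -[RHS]E sm_sum; apply: eq_bigr => i _; rewrite DE.
have s1 : - (2 / 3) = - (2 / 3) * 1%:R :> R by rewrite mulr1.
have s2 : - (4 / 3) = - (2 / 3) * 2%:R :> R by field.
have Uu i x : `|U i x| <= `|u x| by exact: coord_le_norm.
have Wv i x : `|W i x| <= `|v x| by exact: coord_le_norm.
have Tt x : `|T x| <= `|theta x| by [].
(* for the weight w, every case gives u = o(w), v = O(w), theta = O(w) and v theta = o(w^3) *)
have [U1 W1 T1 WT] : [/\ forall i, littleo_weight 1 (U i), forall i, bigO_weight 1 (W i),
    bigO_weight 1 T & forall i, littleo_weight 3 (W i * T)].
  case: hdecay => -[hu hv ht]; split=> //;
    try by move=> i; exact: (littleo_weightI 1 isT s1 (Uu i) hu).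
  - by move=> i; exact: (bigO_weightI 1 isT s1 (Wv i) hv).
  - by apply: (@bigO_weak _ 1 2) => //; exact/littleo_bigO/(littleo_weightI 2 isT s2 Tt ht).
  - move=> i; apply: (@littleoMC _ 1 2); first exact: (bigO_weightI 1 isT s1 (Wv i) hv).
    exact: (littleo_weightI 2 isT s2 Tt ht).
  - by move=> i; exact/littleo_bigO/(littleo_weightI 1 isT s1 (Wv i) hv).
  - by apply: (@bigO_weak _ 1 2) => //; exact: (bigO_weightI 2 isT s2 Tt ht).
  - move=> i; apply: (@littleoM _ 1 2); first exact: (littleo_weightI 1 isT s1 (Wv i) hv).
    exact: (bigO_weightI 2 isT s2 Tt ht).
  - by move=> i; apply: (@bigO_weak _ 1 2) => //; exact: (bigO_weightI 2 isT s2 (Wv i) hv).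
  - exact/littleo_bigO/(littleo_weightI 1 isT s1 Tt ht).
  - move=> i; apply: (@littleoMC _ 2 1); first exact: (bigO_weightI 2 isT s2 (Wv i) hv).
    exact: (littleo_weightI 1 isT s1 Tt ht).
  - move=> i; apply: (@bigO_weak _ 1 2) => //.
    exact/littleo_bigO/(littleo_weightI 2 isT s2 (Wv i) hv).
  - exact: (bigO_weightI 1 isT s1 Tt ht).
  - move=> i; apply: (@littleoM _ 2 1); first exact: (littleo_weightI 2 isT s2 (Wv i) hv).
    exact: (bigO_weightI 1 isT s1 Tt ht).
have [U0 W0 T0] := liouville eq_U eq_W eq_T div_U U1 W1 T1 WT.
by split=> x; [apply/rowP => i; rewrite mxE; exact: U0 |
  apply/rowP => i; rewrite mxE; exact: W0 | exact: T0].
Qed.
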